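(* Given a set $P$ of $n$ colored points, a color set $C$, and a label bound $K$ (or a color vector $\vec k=(k_c)_{c\in C}$), one can compute a feasible (crossing-free) backbone labeling of $P$ with finite backbones that minimizes the total leader length in time $O(n^7|C|^2K^2)$ (or $O\bigl(n^7|C|^2(\prod_{c\in C}k_c)^2\bigr)$, respectively).
   Context: Setting: $P$ is a finite set of points in an axis-aligned rectangle $R$; each $p\in P$ has a color $c(p)\in C$; no two points share the same $x$- or the same $y$-coordinate, and the points are given in decreasing order of $y$-coordinate. A backbone labeling of $P$ consists of a finite set $\mathcal L$ of colored labels on the right side of $R$, together with an assignment of each point $p\in P$ to a label in $\mathcal L$ of color $c(p)$. A label $l$ is described by its color $c(l)$, the $y$-coordinate $y(l)$ of its backbone, and the set $P(l)$ of points assigned to it. The backbone leader of $l$ consists of a horizontal segment at height $y(l)$ (the backbone) together with, for each $p\in P(l)$, the vertical segment joining $p$ to the backbone. A finite backbone extends horizontally from the label on the right side of $R$ to the $x$-coordinate of the leftmost point of $P(l)$. Leaders of distinct labels may not overlap. The labeling is crossing-free if leaders of distinct labels do not cross, i.e. are disjoint; labelings are required to be crossing-free here. Minimum distances: a minimum allowed distance $\Delta>0$ is given; the vertical distance between any two backbones, and between a backbone and any point not connected to it, must be at least $\Delta$. A backbone may pass through an input point connected to it. Bounds on the number of labels: either a global bound $K\ge|C|$ on the total number of labels, or a color vector, allowing at most $k_c$ labels of color $c$ for each $c\in C$. A labeling is feasible if every point is assigned to a label of its own color, no leaders overlap, and the bound(s) on the number of labels hold. Total leader length: the sum of the lengths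 of all vertical segments, either including or excluding the horizontal lengths of the backbones; the result holds for both versions. *)

(* Defs.v *)
(* MathComp world, with the realType of MathComp-Analysis. *)
From HB Require Import structures.
From mathcomp Require Import all_boot all_order all_algebra.
From mathcomp Require Import mathcomp_extra boolp classical_sets reals.

Set Implicit Arguments.
Unset Strict Implicit.
Unset Printing Implicit Defensive.

Import Order.TTheory GRing.Theory Num.Theory.

Local Open Scope classical_set_scope.
Local Open Scope ring_scope.

(** * Backbone labelings *)

(* n points, coloured by the color set C = {0, ..., m-1}. *)
Record instance (R : realType) (n m : nat) := Instance {
  xl : R; xr : R; yb : R; yt : R;  (* the rectangle [xl, xr] x [yb, yt] *)
  minsep : R;                      (* the minimum distance Delta *)
  px : 'I_n -> R;
  py : 'I_n -> R;
  pc : 'I_n -> 'I_m }.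

Definition wf_instance (R : realType) n m (I : instance R n m) : Prop :=
  [/\ xl I < xr I /\ yb I < yt I,
      0 < minsep I,
      forall i, xl I <= px I i <= xr I /\ yb I <= py I i <= yt I,
      injective (px I)
    & forall i j : 'I_n, (i < j)%N -> py I j < py I i].

Record labeling (R : realType) (n m : nat) := Labeling {
  nlab : nat;
  lcolor : 'I_nlab -> 'I_m;
  ly : 'I_nlab -> R;
  assign : 'I_n -> 'I_nlab }.

Section Geometry.
Variables (R : realType) (n m : nat) (I : instance R n m) (L : labeling R n m).

(* All points satisfy px <= xr, so this is the abscissa of the leftmost point
   assigned to l as soon as there is such a point. *)
Definition leftx (l : 'I_(nlab L)) : R :=
  \big[Num.min/xr I]_(i < n | assign L i == l) px I i.

Definition backbone (l : 'I_(nlab L)) : set (R * R) :=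
  [set q | leftx l <= q.1 <= xr I /\ q.2 = ly l].

Definition vsegment (i : 'I_n) : set (R * R) :=
  let y := ly (assign L i) in
  [set q | q.1 = px I i /\ Num.min (py I i) y <= q.2 <= Num.max (py I i) y].

Definition leader (l : 'I_(nlab L)) : set (R * R) :=
  backbone l `|` \bigcup_(i in [set i | assign L i = l]) vsegment i.

Definition crossing_free : Prop := trivIset [set: 'I_(nlab L)] leader.

(* The distance conditions are purely vertical: they also concern points lying
   to the left of the backbone. *)
Definition min_distances : Prop :=
  (forall l l' : 'I_(nlab L), l != l' -> minsep I <= `|ly l - ly l'|) /\
  (forall (l : 'I_(nlab L)) (i : 'I_n),
     assign L i != l -> minsep I <= `|ly l - py I i|).

Definition backbone_labeling : Prop :=
  [/\ forall i, lcolor (assign L i) = pc I i,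
      forall l, exists i, assign L i = l,
      forall l : 'I_(nlab L), yb I <= ly l <= yt I,
      min_distances
    & crossing_free].

(* The Boolean selects whether the horizontal lengths are counted. *)
Definition leader_length (horiz : bool) : R :=
  \sum_(i < n) `|py I i - ly (assign L i)|
  + (if horiz then \sum_(l < nlab L) (xr I - leftx l) else 0).

End Geometry.

Definition global_bound (R : realType) n m (K : nat) (L : labeling R n m) :
  Prop := (nlab L <= K)%N.

Definition color_bound (R : realType) n m (k : 'I_m -> nat)
  (L : labeling R n m) : Prop :=
  forall c : 'I_m, (#|[set l | @lcolor R n m L l == c]%SET| <= k c)%N.

Definition feasible (R : realType) n m (I : instance R n m)
  (bound : labeling R n m -> Prop) (L : labeling R n m) : Prop :=
  backbone_labeling I L /\ bound L.

Definition optimal (R : realType) n m (I : instance R n m) (horiz : bool)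
  (bound : labeling R n m -> Prop) (L : labeling R n m) : Prop :=
  feasible I bound L /\
  forall L', feasible I bound L' ->
    leader_length I L horiz <= leader_length I L' horiz.

(** * The real RAM *)

(* A unit-cost real RAM, programmed in a structured language.  The memory is
   made of banks, numbered by literals of the program text (so that a program
   uses finitely many of them); each bank is an unbounded array of integer
   cells, resp. real cells, with indirect addressing by integers.

   Integers have no multiplication, division or bitwise operation, so that
   unit cost cannot be exploited through huge integers; reals are only added,
   subtracted and compared, are never converted to integers, and programs
   contain no real constants. *)

Inductive nexp :=
  | NConst of nat
  | NGet of nat & nexp          (* bank, index *)
  | NAdd of nexp & nexp
  | NSub of nexp & nexp.

Inductive rexp :=
  | RGet of nat & nexp
  | RAdd of rexp & rexp
  | RSub of rexp & rexp.

Inductive bexp :=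
  | BNatLe of nexp & nexp
  | BRealLe of rexp & rexp
  | BNot of bexp
  | BAnd of bexp & bexp.

Inductive cmd :=
  | Skip
  | NSet of nat & nexp & nexp   (* bank, index, value *)
  | RSet of nat & nexp & rexp
  | Seq of cmd & cmd
  | If of bexp & cmd & cmd
  | While of bexp & cmd.

Record state (R : realType) := State {
  nmem : nat -> nat -> nat;
  rmem : nat -> nat -> R }.

Definition upd T (mem : nat -> nat -> T) (b i : nat) (v : T) :
  nat -> nat -> T :=
  fun b' i' => if (b' == b) && (i' == i) then v else mem b' i'.

Fixpoint neval (R : realType) (s : state R) (e : nexp) : nat :=
  match e with
  | NConst k => k
  | NGet b i => nmem s b (neval s i)
  | NAdd e1 e2 => (neval s e1 + neval s e2)%N
  | NSub e1 e2 => (neval s e1 - neval s e2)%N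
  end.

Fixpoint reval (R : realType) (s : state R) (e : rexp) : R :=
  match e with
  | RGet b i => rmem s b (neval s i)
  | RAdd e1 e2 => reval s e1 + reval s e2
  | RSub e1 e2 => reval s e1 - reval s e2
  end.

Fixpoint beval (R : realType) (s : state R) (e : bexp) : bool :=
  match e with
  | BNatLe e1 e2 => (neval s e1 <= neval s e2)%N
  | BRealLe e1 e2 => reval s e1 <= reval s e2
  | BNot e1 => ~~ beval s e1
  | BAnd e1 e2 => beval s e1 && beval s e2
  end.

Fixpoint ncost (e : nexp) : nat :=
  match e with
  | NConst _ => 1
  | NGet _ i => (ncost i).+1
  | NAdd e1 e2 | NSub e1 e2 => (ncost e1 + ncost e2).+1
  end.

Fixpoint rcost (e : rexp) : nat :=
  match e with
  | RGet _ i => (ncost i).+1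
  | RAdd e1 e2 | RSub e1 e2 => (rcost e1 + rcost e2).+1
  end.

Fixpoint bcost (e : bexp) : nat :=
  match e with
  | BNatLe e1 e2 => (ncost e1 + ncost e2).+1
  | BRealLe e1 e2 => (rcost e1 + rcost e2).+1
  | BNot e1 => (bcost e1).+1
  | BAnd e1 e2 => (bcost e1 + bcost e2).+1
  end.

(* exec p s t s' : started in s, the program p halts in s' after t steps. *)
Inductive exec (R : realType) : cmd -> state R -> nat -> state R -> Prop :=
  | exec_skip s : exec Skip s 1 s
  | exec_nset s b i e :
      exec (NSet b i e) s (ncost i + ncost e).+1
        (State (upd (nmem s) b (neval s i) (neval s e)) (rmem s))
  | exec_rset s b i e :
      exec (RSet b i e) s (ncost i + rcost e).+1
        (State (nmem s) (upd (rmem s) b (neval s i) (reval s e)))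
  | exec_seq p1 p2 s s1 s2 t1 t2 :
      exec p1 s t1 s1 -> exec p2 s1 t2 s2 -> exec (Seq p1 p2) s (t1 + t2) s2
  | exec_if b p1 p2 s s1 t :
      exec (if beval s b then p1 else p2) s t s1 ->
      exec (If b p1 p2) s (bcost b + t).+1 s1
  | exec_while_false b p s :
      ~~ beval s b -> exec (While b p) s (bcost b).+1 s
  | exec_while_true b p s s1 s2 t1 t2 :
      beval s b -> exec p s t1 s1 -> exec (While b p) s1 t2 s2 ->
      exec (While b p) s (bcost b + t1 + t2).+1 s2.

(** * Input and output conventions *)

Definition table n T (d : T) (f : 'I_n -> T) : nat -> T :=
  fun i => oapp f d (insub i).

(* Integer banks: 0 holds n, |C| and the global bound, 1 the colors of the
   points, 2 the color vector.  Real banks: 0 holds the rectangle and the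
   minimum distance, 1 and 2 the coordinates of the points.  All other cells
   are 0. *)
Definition input_state (R : realType) n m (I : instance R n m)
  (K : nat) (k : nat -> nat) : state R :=
  State
    (fun b => match b with
      | 0 => nth 0%N [:: n; m; K]
      | 1 => table 0%N (fun i => pc I i : nat)
      | 2 => k
      | _ => fun=> 0%N
      end)
    (fun b => match b with
      | 0 => nth 0 [:: xl I; xr I; yb I; yt I; minsep I]
      | 1 => table 0 (px I)
      | 2 => table 0 (py I)
      | _ => fun=> 0
      end).

Definition input_global (R : realType) n m (I : instance R n m) (K : nat) :=
  input_state I K (fun=> 0%N).

Definition input_vector (R : realType) n m (I : instance R n m)
  (k : 'I_m -> nat) :=
  input_state I 0 (table 0%N k).

(* Output: the cells 0 and 1 of the integer bank 3 hold a success flag and the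
   number of labels, the integer banks 4 and 5 the colors of the labels and the
   assignment of the points, the real bank 3 the heights of the backbones. *)
Definition outputs (R : realType) n m (s : state R) (L : labeling R n m) :
  Prop :=
  [/\ nmem s 3 0 = 1%N,
      nmem s 3 1 = nlab L,
      forall l : 'I_(nlab L), nmem s 4 l = lcolor l,
      forall i : 'I_n, nmem s 5 i = assign L i
    & forall l : 'I_(nlab L), rmem s 3 l = ly l].

Definition outputs_none (R : realType) (s : state R) : Prop :=
  nmem s 3 0 = 0%N.

Definition solves (R : realType) n m (I : instance R n m) (horiz : bool)
  (bound : labeling R n m -> Prop) (s : state R) : Prop :=
  (exists L, optimal I horiz bound L /\ outputs s L) \/
  ((~ exists L, feasible I bound L) /\ outputs_none s).

(* Main.v *)
(* A labeling is determined by the heights of the backbones of the points.  Move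
   a maximal cluster of backbones at successive distances Delta, none of which
   is at distance 0 or Delta from a point or from the boundary: the total length
   is linear until a new contact occurs, so that moving in one of the directions
   does not increase it.  Hence only the O(n^2) heights a + k Delta matter, where
   a is the ordinate of a point or of a side of the rectangle and |k| <= n.

   In the strip between two backbones, the leftmost of the points still to be
   treated is connected to one of the two or to a new backbone inside; a new
   backbone crosses the strip from that point on, and splits the rest of the
   problem into two independent strips.  This gives a dynamic program over the
   number of points treated, the two bounding backbones (height and color) and a
   code of the numbers of labels used; combining two codes costs the square of
   the number of codes.  In the global version the code is the number of labels.
   In the vector version it consists of the numbers of labels per color, written
   in base n + 1. *)

Require Import Defs.
From HB Require Import structures.
From mathcomp Require Import all_boot all_order all_algebra.
From mathcomp Require Import mathcomp_extra boolp classical_sets reals.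
From mathcomp Require Import zify lra ring.

Set Implicit Arguments.
Unset Strict Implicit.
Unset Printing Implicit Defensive.

(** * For-programs compiled to the real RAM *)

(** The exponents leave no slack: n numbers of treated points, O(n^2|C|) types for each of two
    bounding backbones, O(n^2) heights for the next backbone, and a pair of codes. So the color of
    the next backbone is read off the point, never looped over. Its distance to points further left,
    which it does not reach but which the vertical distance conditions include, is tested in
    constant time against a precomputed index. The number of labels of a color takes k_c + 1 values;
    to get a product of k_c, the code omits one label per color.

    The time bound is proved on the program text. Loops are counted, and their limits sit in banks
    that the current phase does not write: such programs terminate, have a functional semantics, and
    cost at most a constant times the largest product of limits along a nest. A limit computed by
    the program must come from an earlier phase, which dictates how the program is cut. Without
    multiplication, table addresses are sums of tabulated multiples. Without recursion, the solution
    is recovered by one walk down the table per point. *)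

Inductive prog :=
  | PSkip
  | PN of nat & nexp & nexp
  | PR of nat & nexp & rexp
  | PSeq of prog & prog
  | PIf of bexp & prog & prog
  | PFor of nat & nat & nat & prog.

Definition var (b : nat) : nexp := NGet b (NConst 0).
Definition rvar (b : nat) : rexp := RGet b (NConst 0).
Definition NLt (e f : nexp) : bexp := BNot (BNatLe f e).
Definition NEq (e f : nexp) : bexp := BAnd (BNatLe e f) (BNatLe f e).
Definition RLt (e f : rexp) : bexp := BNot (BRealLe f e).

(** The compiled loop reads its limit again at every turn, whereas [den] reads it once on entry; the
    two agree for [static] programs. *)
Fixpoint compile (p : prog) : cmd :=
  match p with
  | PSkip => Skip
  | PN b i e => NSet b i e
  | PR b i e => RSet b i e
  | PSeq p q => Seq (compile p) (compile q)
  | PIf b p q => If b (compile p) (compile q)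
  | PFor v lb li p =>
      Seq (NSet v (NConst 0) (NConst 0))
          (While (NLt (var v) (NGet lb (NConst li)))
             (Seq (compile p) (NSet v (NConst 0) (NAdd (var v) (NConst 1)))))
  end.

Definition setn (R : realType) (b i v : nat) (s : state R) :=
  State (upd (nmem s) b i v) (rmem s).
Definition setr (R : realType) (b i : nat) (v : R) (s : state R) :=
  State (nmem s) (upd (rmem s) b i v).

Fixpoint den (R : realType) (p : prog) (s : state R) : state R :=
  match p with
  | PSkip => s
  | PN b i e => setn b (neval s i) (neval s e) s
  | PR b i e => setr b (neval s i) (reval s e) s
  | PSeq p q => den q (den p s)
  | PIf b p q => if beval s b then den p s else den q s
  | PFor v lb li p =>
      iteri (nmem s lb li) (fun k s => setn v 0 k.+1 (den p s)) (setn v 0 0 s)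
  end.

Fixpoint nwrites (p : prog) : seq nat :=
  match p with
  | PSkip | PR _ _ _ => [::]
  | PN b _ _ => [:: b]
  | PSeq p q | PIf _ p q => nwrites p ++ nwrites q
  | PFor v _ _ p => v :: nwrites p
  end.

Fixpoint rwrites (p : prog) : seq nat :=
  match p with
  | PSkip | PN _ _ _ => [::]
  | PR b _ _ => [:: b]
  | PSeq p q | PIf _ p q => rwrites p ++ rwrites q
  | PFor _ _ _ p => rwrites p
  end.

Fixpoint limits (p : prog) : seq (nat * nat) :=
  match p with
  | PSkip | PN _ _ _ | PR _ _ _ => [::]
  | PSeq p q | PIf _ p q => limits p ++ limits q
  | PFor _ lb li p => (lb, li) :: limits p
  end.

Fixpoint vars_ok (p : prog) : bool :=
  match p with
  | PSkip | PN _ _ _ | PR _ _ _ => true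
  | PSeq p q | PIf _ p q => vars_ok p && vars_ok q
  | PFor v _ _ p => (v \notin nwrites p) && vars_ok p
  end.

(** Limits lie in banks that all of [p] leaves alone. A bank computed by one phase can thus limit
    only the loops of later phases, and [static] is required of each phase separately. *)
Definition static (p : prog) : bool :=
  vars_ok p && all (fun l => l.1 \notin nwrites p) (limits p).

(** A turn of a loop adds 6 for the test, 6 for the increment and 1 for [While], which makes 13;
    initializing the counter costs 3 and the final test 7. A conditional is charged for both
    branches. *)
Fixpoint bnd (lim : nat -> nat -> nat) (p : prog) : nat :=
  match p with
  | PSkip => 1
  | PN _ i e => (ncost i + ncost e).+1
  | PR _ i e => (ncost i + rcost e).+1
  | PSeq p q => bnd lim p + bnd lim q
  | PIf b p q => (bcost b + (bnd lim p + bnd lim q)).+1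
  | PFor _ lb li p => lim lb li * (bnd lim p + 13) + 10
  end.

Fixpoint cst (p : prog) : nat :=
  match p with
  | PSkip => 1
  | PN _ i e => (ncost i + ncost e).+1
  | PR _ i e => (ncost i + rcost e).+1
  | PSeq p q => cst p + cst q
  | PIf b p q => (bcost b + (cst p + cst q)).+1
  | PFor _ _ _ p => cst p + 23
  end.

(* Only the deepest nests of loops matter for the order of the running time:
   the constant [cst p] absorbs everything else. *)
Fixpoint fits (lim : nat -> nat -> nat) (p : prog) (acc X : nat) : Prop :=
  match p with
  | PSkip | PN _ _ _ | PR _ _ _ => (acc <= X)%N
  | PSeq p q => fits lim p acc X /\ fits lim q acc X
  | PIf _ p q => [/\ (acc <= X)%N, fits lim p acc X & fits lim q acc X]
  | PFor _ lb li p =>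
      [/\ (acc <= X)%N, (acc * lim lb li <= X)%N
        & fits lim p (acc * lim lb li) X]
  end.

(** [acc] is the product of the limits of the loops around [p]. As [acc] and its product with the
    next limit are at most [X], the overhead of a loop is at most 10 + 13 times [X], whence the
    summand 23 in [cst]. *)
Lemma bnd_cst lim p acc X : fits lim p acc X -> (acc * bnd lim p <= cst p * X)%N.
Proof.
elim: p acc => [|b i e|b i e|p IHp q IHq|b p IHp q IHq|v lb li p IHp] acc /=.
- by move=> h; rewrite muln1 mul1n.
- by move=> h; rewrite mulnC leq_mul.
- by move=> h; rewrite mulnC leq_mul.
- by case=> /IHp h1 /IHq h2; rewrite mulnDr mulnDl leq_add.
- by case=> h /IHp h1 /IHq h2; nia.
- by case=> h0 h /IHp h1; nia.
Qed.

(** * Semantics of for-programs, and the invariant rule for loops *)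

Section Sem.
Variable R : realType.
Implicit Types (s : state R) (p : prog).

Lemma nframe p s b : b \notin nwrites p -> nmem (den p s) b = nmem s b.
Proof.
elim: p s => [|c i e|c i e|p IHp q IHq|c p IHp q IHq|v lb li p IHp] s //=.
- rewrite inE => /negbTE hb; apply: funext => k; by rewrite /upd hb.
- by rewrite mem_cat negb_or => /andP[h1 h2]; rewrite IHq ?IHp.
- by rewrite mem_cat negb_or => /andP[h1 h2]; case: ifP => _; rewrite ?IHq ?IHp.
- rewrite inE negb_or => /andP[hv hp].
  elim: (nmem s lb li) => [|N IHN] /=.
    by apply: funext => k; rewrite /upd (negbTE hv).
  by rewrite -IHN -(IHp _ hp); apply: funext => k; rewrite /upd (negbTE hv).
Qed.

Lemma rframe p s b : b \notin rwrites p -> rmem (den p s) b = rmem s b.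
Proof.
elim: p s => [|c i e|c i e|p IHp q IHq|c p IHp q IHq|v lb li p IHp] s //=.
- rewrite inE => /negbTE hb; apply: funext => k; by rewrite /upd hb.
- by rewrite mem_cat negb_or => /andP[h1 h2]; rewrite IHq ?IHp.
- by rewrite mem_cat negb_or => /andP[h1 h2]; case: ifP => _; rewrite ?IHq ?IHp.
- move=> hp; elim: (nmem s lb li) => [|N IHN] //=.
  by rewrite IHp.
Qed.

Lemma den_seq p q s : den (PSeq p q) s = den q (den p s).
Proof. by []. Qed.

Lemma den_if b p q s :
  den (PIf b p q) s = if beval s b then den p s else den q s.
Proof. by []. Qed.

Lemma nmem_setn b i v s b' i' : nmem (setn b i v s) b' i' =
  if (b' == b) && (i' == i) then v else nmem s b' i'.
Proof. by []. Qed.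

(** The limits are bounded in the initial state only: since a static program never writes them, the
    bounds pass to all intermediate states. *)
Lemma static_exec lim p s : static p ->
  (forall l, l \in limits p -> (nmem s l.1 l.2 <= lim l.1 l.2)%N) ->
  exists2 t, exec (compile p) s t (den p s) & (t <= bnd lim p)%N.
Proof.
elim: p s => [|b i e|b i e|p IHp q IHq|b p IHp q IHq|v lb li p IHp] s.
- by move=> _ _; exists 1; first exact: exec_skip.
- by move=> _ _; exists (ncost i + ncost e).+1; first exact: exec_nset.
- by move=> _ _; exists (ncost i + rcost e).+1; first exact: exec_rset.
- rewrite /static /= all_cat => /andP[/andP[vp vq] /andP[lp lq]] hl.
  have notw r x : all (fun l : nat * nat => l.1 \notin nwrites p ++ nwrites q) r ->
      x \in r -> (x.1 \notin nwrites p) /\ (x.1 \notin nwrites q).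
    by move=> /allP h /h; rewrite mem_cat negb_or => /andP[].
  have [] := IHp s.
  + by rewrite /static vp; apply/allP => x /(notw _ _ lp)[].
  + by move=> l hl'; apply: hl; rewrite mem_cat hl'.
  move=> t1 e1 b1; have [] := IHq (den p s).
  + by rewrite /static vq; apply/allP => x /(notw _ _ lq)[].
  + move=> l hl'; rewrite nframe; first by apply: hl; rewrite mem_cat hl' orbT.
    by have [] := notw _ _ lq hl'.
  move=> t2 e2 b2; exists (t1 + t2)%N; last exact: leq_add.
  exact: exec_seq e1 e2.
- rewrite /static /= all_cat => /andP[/andP[vp vq] /andP[lp lq]] hl.
  have notw r x : all (fun l : nat * nat => l.1 \notin nwrites p ++ nwrites q) r ->
      x \in r -> (x.1 \notin nwrites p) /\ (x.1 \notin nwrites q).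
    by move=> /allP h /h; rewrite mem_cat negb_or => /andP[].
  case hb: (beval s b).
  + have [] := IHp s.
    * by rewrite /static vp; apply/allP => x /(notw _ _ lp)[].
    * by move=> l hl'; apply: hl; rewrite mem_cat hl'.
    move=> t1 e1 b1; exists (bcost b + t1).+1; last by lia.
    by apply: exec_if; rewrite hb.
  + have [] := IHq s.
    * by rewrite /static vq; apply/allP => x /(notw _ _ lq)[].
    * by move=> l hl'; apply: hl; rewrite mem_cat hl' orbT.
    move=> t1 e1 b1; exists (bcost b + t1).+1; last by lia.
    by apply: exec_if; rewrite hb.
- rewrite /static /= => /andP[/andP[hv vp] /andP[hlb /allP lp]] hl.
  have notw x : x \in limits p -> (x.1 \notin nwrites p) /\ x.1 != v.
    by move=> /lp; rewrite inE negb_or => /andP[].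
  move: hlb; rewrite inE negb_or => /andP[lbv hlb].
  set N := nmem s lb li.
  set F := fun k s => setn v 0 k.+1 (den p s).
  set s0 := setn v 0 0 s.
  have inv k : [/\ nmem (iteri k F s0) v 0 = k,
      nmem (iteri k F s0) lb li = N
    & forall l, l \in limits p ->
        (nmem (iteri k F s0) l.1 l.2 <= lim l.1 l.2)%N].
    elim: k => [|k [h1 h2 h3]].
      split; rewrite /= /upd ?eqxx ?(negbTE lbv) //.
      move=> l hl'; have [_ /negbTE ->] := notw _ hl'.
      by apply: hl; rewrite inE hl' orbT.
    split; rewrite /= /upd ?eqxx ?(negbTE lbv) //=; first by rewrite nframe.
    by move=> l hl'; have [h4 /negbTE ->] := notw _ hl'; rewrite nframe // h3.
  have bd := bnd lim p.
  (* [d] is the number of turns left, and 7 pays for the test that fails. *)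
  suff loop d k : (k + d = N)%N -> exists2 t,
     exec (While (NLt (var v) (NGet lb (NConst li)))
             (Seq (compile p) (NSet v (NConst 0) (NAdd (var v) (NConst 1)))))
       (iteri k F s0) t (iteri N F s0)
     & (t <= d * (bnd lim p + 13) + 7)%N.
    have [t et bt] := loop N 0 (add0n _).
    exists (3 + t)%N.
      by apply: exec_seq et; exact: exec_nset.
    have : (N * (bnd lim p + 13) <= lim lb li * (bnd lim p + 13))%N.
      by rewrite leq_mul2r (hl (lb, li)) ?orbT // inE eqxx.
    by lia.
  elim: d k => [|d IHd] k hk.
    have {hk} -> : k = N by lia.
    have [h1 h2 _] := inv N.
    exists 7; last by lia.
    by apply: (@exec_while_false _ (NLt _ _)); rewrite /= h1 h2 leqnn.
  have [h1 h2 h3] := inv k.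
  have [] := IHp (iteri k F s0).
  + by rewrite /static vp; apply/allP => x /notw[].
  + by [].
  move=> t et bt.
  have [|t2 et2 bt2] := IHd k.+1; first by lia.
  exists (6 + (t + 6) + t2).+1; last by lia.
  apply: (@exec_while_true _ (NLt _ _) _ _ (iteri k.+1 F s0)) et2 => //.
    by rewrite /= h1 h2; lia.
  apply: exec_seq et _.
  rewrite /= {2}/F /setn.
  have -> : k.+1 = neval (den p (iteri k F s0)) (NAdd (var v) (NConst 1)).
    by rewrite /= nframe // h1 addn1.
  exact: exec_nset.
Qed.

(* The invariant may be used with the fact that everything outside the banks
   written by the loop is as it was before the loop. *)
Lemma for_ind v lb li p s (P : nat -> state R -> Prop) N :
  v \notin nwrites p -> nmem s lb li = N ->
  P 0 (setn v 0 0 s) ->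
  (forall k s', (k < N)%N -> nmem s' v 0 = k ->
     (forall b, b \notin v :: nwrites p -> nmem s' b = nmem s b) ->
     (forall b, b \notin rwrites p -> rmem s' b = rmem s b) ->
     P k s' -> P k.+1 (setn v 0 k.+1 (den p s'))) ->
  P N (den (PFor v lb li p) s).
Proof.
move=> hv /= -> h0 hS.
set F := fun k s => setn v 0 k.+1 (den p s).
suff [//] : P N (iteri N F (setn v 0 0 s)) /\
  [/\ nmem (iteri N F (setn v 0 0 s)) v 0 = N,
     forall b, b \notin v :: nwrites p ->
       nmem (iteri N F (setn v 0 0 s)) b = nmem s b
   & forall b, b \notin rwrites p ->
       rmem (iteri N F (setn v 0 0 s)) b = rmem s b].
elim: {-2}N (leqnn N) => [|k IHk] hk.
  split=> //; split => //; first by rewrite /= /upd eqxx.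
  move=> b; rewrite inE negb_or => /andP[/negbTE hb _].
  by apply: funext => i; rewrite /= /upd hb.
have [h1 [h2 h3 h4]] := IHk (ltnW hk).
split; first exact: hS.
split => /=; first by rewrite /= /upd eqxx.
  move=> b hb; rewrite -(h3 b hb); move: hb.
  rewrite inE negb_or => /andP[/negbTE hb hp].
  apply: funext => i; rewrite /= /upd hb /=; by rewrite nframe.
by move=> b hb; rewrite -(h4 b hb) rframe.
Qed.

End Sem.

(** * The dynamic program over strips *)

Import Order.TTheory GRing.Theory Num.Theory.
Local Open Scope ring_scope.

Lemma far_cases (R : realDomainType) (d a b : R) :
  (d <= `|a - b|) = (d <= a - b) || (d <= b - a).
Proof. by rewrite ler_normr opprB. Qed.

(** A horizontal line at height [z] misses the vertical segment between the heights [a] and [b],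
    endpoints included. *)
Definition off_range (R : realDomainType) (z a b : R) : Prop :=
  (z < a /\ z < b) \/ (a < z /\ b < z).

Ltac clra :=
  repeat match goal with H : forall _, _ |- _ => clear H end; lra.

Ltac nlia :=
  repeat match goal with
  | H : ?T |- _ =>
    lazymatch T with
    | is_true (leq _ _) => fail
    | is_true (leq _ _ && leq _ _) => fail
    | is_true (~~ (@eq_op _ _ _)) => fail
    | @eq nat _ _ => fail
    | _ => lazymatch type of T with Prop => clear H end
    end
  end; lia.

Section Strips.
Variables (R : realType) (n Q : nat) (D ylo yhi : R).
Variables (Y g tpos : nat -> R) (C w tcol : nat -> nat).

(** Half-open, so that cutting a strip at a backbone partitions its points, even if one lies at the
    height of the backbone. *)
Definition strip (q q' i : nat) : bool := tpos q <= Y i < tpos q'.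

(** Indices grow leftwards, so these are the points to the left of [k]. A backbone starting at [k]
    does not reach them but must keep its vertical distance from them. *)
Definition clear (k b : nat) : bool :=
  all (fun y => (k < y)%N ==> (D <= `|Y y - tpos b|)) (iota 0 n).

Definition opens (q q' b : nat) : bool := (b != q) && (b != q').

(** If [k] joins one bounding backbone, only its distance to the other one is left to check: its
    vertical segment stays in the strip, and backbones opened later start further right. *)
Definition admissible (k q q' b : nat) : bool :=
  [&& ylo <= tpos b, tpos b <= yhi &
    if b == q then D <= tpos q' - Y k
    else if b == q' then D <= Y k - tpos q
    else [&& D <= tpos b - tpos q, D <= tpos q' - tpos b,
             D <= Y k - tpos q, D <= tpos q' - Y k & clear k b]].

Lemma clearP k b : reflect
  (forall y, (k < y < n)%N -> D <= `|Y y - tpos b|) (clear k b).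
Proof.
apply: (iffP allP) => [h y /andP[h1 h2]|h y].
  by have := h y; rewrite mem_iota add0n h2 h1; apply.
by rewrite mem_iota add0n => /= h2; apply/implyP => h1; apply: h; rewrite h1.
Qed.

(* Points are indexed from right to left.  [f] maps the points of index [< k]
   of the strip between [q] and [q'] to backbones of this strip, the points of
   index [>= k] being already treated. *)
Record fits_strip (k q q' : nat) (f : nat -> nat) : Prop := FitsStrip {
  fs_type : forall i, (i < k)%N -> strip q q' i ->
    [/\ (f i < Q)%N, tcol (f i) = C i, ylo <= tpos (f i) & tpos (f i) <= yhi];
  fs_between : forall i, (i < k)%N -> strip q q' i ->
    (f i = q \/ D <= tpos (f i) - tpos q) /\
    (f i = q' \/ D <= tpos q' - tpos (f i));
  fs_other : forall i, (i < k)%N -> strip q q' i ->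
    (f i = q \/ D <= Y i - tpos q) /\ (f i = q' \/ D <= tpos q' - Y i);
  fs_far : forall i j, (i < k)%N -> strip q q' i -> (j < k)%N -> strip q q' j ->
    f i = f j \/ (D <= `|tpos (f i) - tpos (f j)| /\ D <= `|tpos (f j) - Y i|);
  fs_cross : forall i j, (i < j < k)%N -> strip q q' i -> strip q q' j ->
    f i = f j \/ off_range (tpos (f j)) (Y i) (tpos (f i));
  fs_left : forall i y, (i < k)%N -> strip q q' i -> (k <= y < n)%N ->
    opens q q' (f i) -> D <= `|Y y - tpos (f i)| }.

Hypothesis D_gt0 : 0 < D.

Lemma opensP q q' b : reflect (b <> q /\ b <> q') (opens q q' b).
Proof.
by apply: (iffP andP) => -[h1 h2]; split; apply/eqP => //; apply/eqP.
Qed.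

Lemma fits_strip_skip k q q' f : (k < n)%N -> ~~ strip q q' k ->
  fits_strip k.+1 q q' f <-> fits_strip k q q' f.
Proof.
have D0 := D_gt0; move=> kn nk; split => -[h1 h2 h3 h4 h5 h6].
  split.
  - by move=> i hi; apply: h1; nlia.
  - by move=> i hi; apply: h2; nlia.
  - by move=> i hi; apply: h3; nlia.
  - by move=> i j hi si hj; apply: h4 => //; nlia.
  - by move=> i j hi; apply: h5; nlia.
  - move=> i y hi si; rewrite leq_eqVlt => /andP[/orP[/eqP <- _|hy yn] ho].
      (* Here [y] is [k] itself. It lies beyond one of the bounding backbones, which is at distance
         [D] from every backbone opened inside. *)
      have [|b1 b2] := h2 i _ si; first by nlia.
      have [n1 n2] := opensP _ _ _ ho.
      move: si nk; rewrite /strip far_cases => /andP[s1 s2].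
      case: b1 => // b1; case: b2 => // b2.
      by rewrite negb_and -!ltNge -?leNgt => /orP[] h; apply/orP; clra.
    by apply: h6 => //; nlia.
have sk i : (i < k.+1)%N -> strip q q' i -> (i < k)%N.
  by rewrite ltnS leq_eqVlt => /orP[/eqP ->|//]; rewrite (negbTE nk).
split.
- by move=> i hi si; apply: h1 => //; apply: sk.
- by move=> i hi si; apply: h2 => //; apply: sk.
- by move=> i hi si; apply: h3 => //; apply: sk.
- by move=> i j hi si hj sj; apply: h4 => //; apply: sk.
- move=> i j /andP[ij jk] si sj; apply: h5 => //.
  by rewrite ij sk.
- move=> i y hi si hy ho; apply: h6 => //; first exact: sk.
  by move: hy; nlia.
Qed.

(** The remaining points all lie to the right of [k], where the backbone [f k] runs through the
    whole strip. A point on one side of it can only be attached on that side or to [f k] itself,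
    which makes the two halves independent. *)
Lemma fits_strip_split k q q' f : (k < n)%N -> strip q q' k ->
  fits_strip k.+1 q q' f ->
  [/\ admissible k q q' (f k), fits_strip k q (f k) f & fits_strip k (f k) q' f].
Proof.
have D0 := D_gt0; move=> kn sk [h1 h2 h3 h4 h5 h6].
have [b eb] : exists b, f k = b by exists (f k).
rewrite eb.
have [_ _ lob hib] := h1 k (ltnSn k) sk.
have [b1 b2] := h2 k (ltnSn k) sk.
have [c1 c2] := h3 k (ltnSn k) sk.
have [sk1 sk2] := andP sk; rewrite eb in lob hib b1 b2 c1 c2.
have qb : tpos q <= tpos b by case: b1 => [->//|?]; clra.
have bq : tpos b <= tpos q' by case: b2 => [->//|?]; clra.
have low i : strip q b i -> strip q q' i by rewrite /strip; clra.
have high i : strip b q' i -> strip q q' i by rewrite /strip; clra.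
split.
- rewrite /admissible lob hib /=; case: eqP => [e|nq].
    case: c2 => // e2; exfalso; move: sk; rewrite /strip -e -e2; clra.
  case: eqP => [e|nq']; first by case: c1.
  case: b1 => // ->; case: b2 => // ->; case: c1 => // ->; case: c2 => // ->.
  apply/clearP => y hy; rewrite -eb; apply: (h6 k) => //.
  by rewrite /opens eb; apply/andP; split; apply/eqP.
- split.
  + by move=> i hi si; apply: h1; [nlia|exact: low].
  + move=> i hi si; have ik : (i < k.+1)%N by nlia.
    have [? _] := h2 i ik (low i si).
    split => //; case: (eqVneq (f i) b) => [->|/eqP ne]; first by left.
    right; case: (h4 i k ik (low i si) (ltnSn k) sk); rewrite eb // => -[u u'].
    have ikk : (i < k < k.+1)%N by nlia.
    case: (h5 i k ikk (low i si) sk); rewrite eb // => v.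
    by move: si u v; rewrite /strip /off_range far_cases => si u v; clra.
  + move=> i hi si; have ik : (i < k.+1)%N by nlia.
    have [? _] := h3 i ik (low i si).
    split => //; case: (eqVneq (f i) b) => [->|/eqP ne]; first by left.
    right; case: (h4 i k ik (low i si) (ltnSn k) sk); rewrite eb // => -[u u'].
    by move: si u'; rewrite /strip far_cases => si u'; clra.
  + by move=> i j hi si hj sj; apply: h4; [nlia|exact: low|nlia|exact: low].
  + by move=> i j hi si sj; apply: h5; [nlia|exact: low|exact: low].
  + move=> i y hi si hy /opensP[n1 n2].
    have ik : (i < k.+1)%N by nlia.
    have := h4 k i (ltnSn k) sk ik (low i si); rewrite eb => -[e|[u u']].
      by case: n2.
    case: (eqVneq y k) => [->|nyk]; first by rewrite distrC.
    apply: h6; [nlia|exact: low|nlia|apply/opensP; split => // e].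
    (* A point below [b] cannot be attached to [q']: its vertical segment would cross [b]. *)
    case: b2 => [e3|e3]; first by rewrite e3 in n2.
    have ikk : (i < k < k.+1)%N by nlia.
    have := h5 i k ikk (low i si) sk; rewrite eb => -[e'|v]; first by case: n2.
    move: si u' v; rewrite /strip /off_range far_cases e => si v; clra.
- split.
  + by move=> i hi si; apply: h1; [nlia|exact: high].
  + move=> i hi si; have ik : (i < k.+1)%N by nlia.
    have [_ ?] := h2 i ik (high i si).
    split => //; case: (eqVneq (f i) b) => [->|/eqP ne]; first by left.
    right; case: (h4 i k ik (high i si) (ltnSn k) sk); rewrite eb // => -[u u'].
    have ikk : (i < k < k.+1)%N by nlia.
    case: (h5 i k ikk (high i si) sk); rewrite eb // => v.
    by move: si u v; rewrite /strip /off_range far_cases => si u v; clra.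
  + move=> i hi si; have ik : (i < k.+1)%N by nlia.
    have [_ ?] := h3 i ik (high i si).
    split => //; case: (eqVneq (f i) b) => [->|/eqP ne]; first by left.
    right; case: (h4 i k ik (high i si) (ltnSn k) sk); rewrite eb // => -[u u'].
    by move: si u'; rewrite /strip far_cases => si u'; clra.
  + by move=> i j hi si hj sj; apply: h4; [nlia|exact: high|nlia|exact: high].
  + by move=> i j hi si sj; apply: h5; [nlia|exact: high|exact: high].
  + move=> i y hi si hy /opensP[n1 n2].
    have ik : (i < k.+1)%N by nlia.
    have := h4 k i (ltnSn k) sk ik (high i si); rewrite eb => -[e|[u u']].
      by case: n1.
    case: (eqVneq y k) => [->|nyk]; first by rewrite distrC.
    apply: h6; [nlia|exact: high|nlia|apply/opensP; split => // e].
    case: b1 => [e3|e3]; first by rewrite e3 in n1.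
    have ikk : (i < k < k.+1)%N by nlia.
    have := h5 i k ikk (high i si) sk; rewrite eb => -[e'|v]; first by case: n1.
    move: si u' v; rewrite /strip /off_range far_cases e => si v; clra.
Qed.

Lemma admissible_between k q q' b : strip q q' k -> admissible k q q' b ->
  [/\ (b = q \/ D <= tpos b - tpos q) /\ (b = q' \/ D <= tpos q' - tpos b),
      (b = q \/ D <= Y k - tpos q) /\ (b = q' \/ D <= tpos q' - Y k),
      opens q q' b -> clear k b,
      ylo <= tpos b <= yhi
    & tpos q <= tpos b <= tpos q'].
Proof.
have D0 := D_gt0; move=> sk /and3P[-> -> /=].
rewrite /opens; move: (sk) => /andP[s1 s2].
case: eqP => [->|nq].
  by move=> h; split => //; [split; [left|right; clra]|split; [left|right]|clra].
case: eqP => [->|nq'].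
  by move=> h; split => //; [split; [right; clra|left]|split; [right|left]|clra].
case/and5P => h1 h2 h3 h4 h5; split => //; try by split; right.
by apply/andP; split; clra.
Qed.

Lemma strip_split k q q' b : strip q q' k -> admissible k q q' b ->
  forall i, strip q q' i = strip q b i || strip b q' i.
Proof.
move=> sk vk i; have [_ _ _ _ /andP[h1 h2]] := admissible_between sk vk.
rewrite /strip; case: (lerP (tpos b) (Y i)) => h; rewrite ?andbF ?andbT ?orbF /=.
  by rewrite (le_trans h1 h).
by rewrite (lt_le_trans h h2) andbT.
Qed.

(** Converse of [fits_strip_split]. A backbone other than [f k] and its points are at distance [D]
    from [f k], on their own side; the conditions relating the two sides follow by comparing with
    [f k]. *)
Lemma fits_strip_glue k q q' f : (k < n)%N -> strip q q' k ->
  (f k < Q)%N -> tcol (f k) = C k -> admissible k q q' (f k) ->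
  fits_strip k q (f k) f -> fits_strip k (f k) q' f ->
  fits_strip k.+1 q q' f.
Proof.
have D0 := D_gt0; move=> kn sk hQ hC vk [l1 l2 l3 l4 l5 l6] [u1 u2 u3 u4 u5 u6].
have spl := strip_split sk vk.
have [B1 B2 B3 /andP[B4 B5] /andP[B6 B7]] := admissible_between sk vk.
have [b eb] : exists b, f k = b by exists (f k).
rewrite eb in hQ hC l1 l2 l3 l4 l5 l6 u1 u2 u3 u4 u5 u6 spl B1 B2 B3 B4 B5 B6 B7.
have low i : strip q b i -> tpos q <= Y i /\ Y i < tpos b by move=> /andP.
have upp i : strip b q' i -> tpos b <= Y i /\ Y i < tpos q' by move=> /andP.
have cases i : (i < k.+1)%N -> strip q q' i ->
    i = k \/ ((i < k)%N /\ strip q b i) \/ ((i < k)%N /\ strip b q' i).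
  rewrite ltnS leq_eqVlt spl => /orP[/eqP ->|ik]; first by left.
  by case/orP => s; right; [left|right].
have lowf i : (i < k)%N -> strip q b i -> f i = b \/
    (D <= tpos b - tpos (f i) /\ D <= tpos b - Y i).
  move=> ik si; have [_ [->|h]] := l2 i ik si; first by left.
  have [_ [->|h']] := l3 i ik si; first by left.
  by right.
have uppf i : (i < k)%N -> strip b q' i -> f i = b \/
    (D <= tpos (f i) - tpos b /\ D <= Y i - tpos b).
  move=> ik si; have [[->|h] _] := u2 i ik si; first by left.
  have [[->|h'] _] := u3 i ik si; first by left.
  by right.
(* If [f i] is [q], this is part of the admissibility of [f k]. Otherwise [f i] is opened in the
   lower half, where [k] counts as a point to the left. *)
have lowk i : (i < k)%N -> strip q b i -> f i = b \/ D <= `|Y k - tpos (f i)|.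
  move=> ik si; case: (eqVneq (f i) b) => [->|/eqP nb]; first by left.
  right; case: (eqVneq (f i) q) => [eq|/eqP nq].
    case: B2 => -[e|h] _; first by rewrite eq e in nb.
    by rewrite far_cases eq h.
  by apply: l6 => //; [rewrite leqnn kn | apply/opensP].
have uppk i : (i < k)%N -> strip b q' i -> f i = b \/ D <= `|Y k - tpos (f i)|.
  move=> ik si; case: (eqVneq (f i) b) => [->|/eqP nb]; first by left.
  right; case: (eqVneq (f i) q') => [eq|/eqP nq].
    case: B2 => _ [e|h]; first by rewrite eq e in nb.
    by rewrite far_cases eq h orbT.
  by apply: u6 => //; [rewrite leqnn kn | apply/opensP].
split.
- move=> i hi si; case: (cases i hi si) => [->|[[ik sl]|[ik su]]].
  + by rewrite eb.
  + exact: l1.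
  + exact: u1.
- move=> i hi si; case: (cases i hi si) => [->|[[ik sl]|[ik su]]].
  + by rewrite eb.
  + have [h h'] := l2 i ik sl; split => //.
    case: h' => [->|h']; first by case: B1.
    by right; clra.
  + have [h h'] := u2 i ik su; split => //.
    case: h => [->|h]; first by case: B1.
    by right; clra.
- move=> i hi si; case: (cases i hi si) => [->|[[ik sl]|[ik su]]].
  + by rewrite eb.
  + have [h h'] := l3 i ik sl; split => //.
    have [sl1 sl2] := low _ sl.
    case: h' => [->|h']; last by right; clra.
    case: B1 => _ [?|?]; first by left.
    by right; clra.
  + have [h h'] := u3 i ik su; split => //.
    have [su1 su2] := upp _ su.
    case: h => [->|h]; last by right; clra.
    case: B1 => [[?|?] _]; first by left.
    by right; clra.
- move=> i j hi si hj sj.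
  case: (cases i hi si) => [->|[[ik sl]|[ik su]]];
    case: (cases j hj sj) => [->|[[jk sl']|[jk su']]].
  + by left.
  + rewrite eb; case: (lowk j jk sl') => [->|h]; first by left.
    case: (lowf j jk sl') => [->|[h1 h2]]; first by left.
    by right; split; [rewrite far_cases h1|rewrite distrC].
  + rewrite eb; case: (uppk j jk su') => [->|h]; first by left.
    case: (uppf j jk su') => [->|[h1 h2]]; first by left.
    by right; split; [rewrite far_cases h1 orbT|rewrite distrC].
  + rewrite eb; case: (lowf i ik sl) => [->|[h1 h2]]; first by left.
    by right; split; rewrite far_cases ?h1 ?h2 ?orbT.
  + exact: l4.
  + case: (lowf i ik sl) => [->|[h1 h2]];
      case: (uppf j jk su') => [->|[h3 h4]]; try by left.
    * right; have [h5 h6] := low _ sl; have [h7 h8] := upp _ su'.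
      by split; rewrite far_cases; apply/orP; [right|left]; clra.
    * by right; split; rewrite far_cases; apply/orP; [right|left]; clra.
    * by right; split; rewrite far_cases; apply/orP; [right|left]; clra.
  + rewrite eb; case: (uppf i ik su) => [->|[h1 h2]]; first by left.
    by right; split; rewrite far_cases ?h1 ?h2 ?orbT.
  + case: (uppf i ik su) => [->|[h1 h2]];
      case: (lowf j jk sl') => [->|[h3 h4]]; try by left.
    * right; have [h5 h6] := upp _ su; have [h7 h8] := low _ sl'.
      by split; rewrite far_cases; apply/orP; [left|right]; clra.
    * by right; split; rewrite far_cases; apply/orP; [left|right]; clra.
    * by right; split; rewrite far_cases; apply/orP; [left|right]; clra.
  + exact: u4.
- move=> i j /andP[ij hj] si sj.
  have hi : (i < k.+1)%N by nlia.
  case: (cases i hi si) => [eik|[[ik sl]|[ik su]]]; first by nlia.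
    case: (cases j hj sj) => [->|[[jk sl']|[jk su']]].
    + rewrite eb; case: (lowf i ik sl) => [->|[h1 h2]]; first by left.
      by right; right; split; clra.
    + by apply: l5 => //; rewrite ij.
    + have [h5 h6] := low _ sl.
      case: (lowf i ik sl) => [->|[h1 h2]];
        case: (uppf j jk su') => [->|[h3 h4]]; try by left.
      * by right; right; split; clra.
      * by right; right; split; clra.
      * by right; right; split; clra.
  case: (cases j hj sj) => [->|[[jk sl']|[jk su']]].
  + rewrite eb; case: (uppf i ik su) => [->|[h1 h2]]; first by left.
    by right; left; split; clra.
  + have [h5 h6] := upp _ su.
    case: (uppf i ik su) => [->|[h1 h2]];
      case: (lowf j jk sl') => [->|[h3 h4]]; try by left.
    * by right; left; split; clra.
    * by right; left; split; clra.
    * by right; left; split; clra.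
  + by apply: u5 => //; rewrite ij.
- move=> i y hi si /andP[ky yn] /[dup] ho /opensP[n1 n2].
  case: (cases i hi si) => [ei|[[ik sl]|[ik su]]].
  + move: ho; rewrite ei eb => /B3/clearP; apply; rewrite ky yn //.
  + case: (eqVneq (f i) b) => [e|/eqP nb].
      by move: ho; rewrite e => /B3/clearP; apply; rewrite ky yn.
    by apply: l6 => //; [nlia | apply/opensP].
  + case: (eqVneq (f i) b) => [e|/eqP nb].
      by move: ho; rewrite e => /B3/clearP; apply; rewrite ky yn.
    by apply: u6 => //; [nlia | apply/opensP].
Qed.

(* A label is accounted for at its leftmost point, i.e. the one of largest index;
   the labels of the two bounding backbones are accounted for elsewhere. *)
Definition isnew (k q q' : nat) (f : nat -> nat) (i : nat) : bool :=
  [&& (i < k)%N, strip q q' i, opens q q' (f i) &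
    all (fun y => (i < y)%N ==> strip q q' y ==> (f y != f i)) (iota 0 k)].

(** Generic in the weights: real ones give the horizontal lengths, integer ones the code of the
    labels used. *)
Definition newsum (M : nmodType) (wt : nat -> M) k q q' (f : nat -> nat) : M :=
  \sum_(i < n | isnew k q q' f i) wt i.

Definition vertical k q q' (f : nat -> nat) : R :=
  \sum_(i < n | (i < k)%N && strip q q' i) `|Y i - tpos (f i)|.

Definition cost k q q' f : R := vertical k q q' f + newsum g k q q' f.
Definition code k q q' f : nat := newsum w k q q' f.

Lemma isnewP k q q' f i : reflect
  [/\ (i < k)%N, strip q q' i, opens q q' (f i) &
    forall y, (i < y < k)%N -> strip q q' y -> f y <> f i]
  (isnew k q q' f i).
Proof.
apply: (iffP and4P) => -[h1 h2 h3 h4]; split => //.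
  move=> y /andP[iy yk] sy; apply/eqP.
  by move/allP: h4 => /(_ y); rewrite mem_iota add0n yk iy sy; apply.
apply/allP => y; rewrite mem_iota add0n => /= yk.
by apply/implyP => iy; apply/implyP => sy; apply/eqP; apply: h4; rewrite ?iy.
Qed.

Lemma sum_split3 (M : nmodType) (P P1 P2 P3 : pred 'I_n) (F : 'I_n -> M) :
  (forall i, P i = [|| P1 i, P2 i | P3 i]) ->
  (forall i, P1 i -> ~~ P2 i && ~~ P3 i) -> (forall i, P2 i -> ~~ P3 i) ->
  \sum_(i | P i) F i
    = \sum_(i | P1 i) F i + (\sum_(i | P2 i) F i + \sum_(i | P3 i) F i).
Proof.
move=> e d1 d2; rewrite (bigID P1) /=; congr (_ + _).
  apply: eq_bigl => i; rewrite e; case h1: (P1 i) => //=.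
  by rewrite andbF.
rewrite (bigID P2) /=; congr (_ + _); apply: eq_bigl => i; rewrite e.
  case h2: (P2 i); rewrite ?andbF ?orbT ?andbT //=.
  by apply/negP => /d1 /=; rewrite h2.
case h1: (P1 i); case h2: (P2 i); case h3: (P3 i) => //=.
- by have := d1 _ h1; rewrite h3 andbF.
- by have := d1 _ h1; rewrite h3 andbF.
- by have := d2 _ h2; rewrite h3.
Qed.

(** * Additivity of the cost and of the code when a strip is split *)

Section Decompose.
Variables (k q q' : nat) (f : nat -> nat).
Hypotheses (kn : (k < n)%N) (sk : strip q q' k) (F : fits_strip k.+1 q q' f).

Let vk := let: And3 v _ _ := fits_strip_split kn sk F in v.
Let Fl := let: And3 _ v _ := fits_strip_split kn sk F in v.
Let Fu := let: And3 _ _ v := fits_strip_split kn sk F in v.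

Lemma strip_disjoint b i : strip q b i -> ~~ strip b q' i.
Proof. by rewrite /strip => /andP[_]; case: lerP. Qed.

Lemma lower_lt i : (i < k)%N -> strip q (f k) i -> f i <> f k ->
  tpos (f i) < tpos (f k).
Proof.
have D0 := D_gt0.
by move=> ik si nb; have [_ [//|h]] := fs_between Fl ik si; clra.
Qed.

Lemma upper_gt i : (i < k)%N -> strip (f k) q' i -> f i <> f k ->
  tpos (f k) < tpos (f i).
Proof.
have D0 := D_gt0.
by move=> ik si nb; have [[//|h] _] := fs_between Fu ik si; clra.
Qed.

(** A type other than [f k] occurs on one side only, being strictly below or strictly above [f k];
    its leftmost point in the half is therefore its leftmost point in the strip. The type [f k], if
    new, starts at [k]. *)
Lemma isnew_split i : isnew k.+1 q q' f i =
  [|| (i == k) && opens q q' (f k), isnew k q (f k) f i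
    | isnew k (f k) q' f i].
Proof.
have spl := strip_split sk vk.
have [_ _ _ _ /andP[qb bq]] := admissible_between sk vk.
apply/isnewP/or3P => [[ik si oi hi]|].
  case: (eqVneq i k) => [e|nik]; first by apply: Or31; rewrite -e.
  have {}ik : (i < k)%N by nlia.
  have nb : f i <> f k by move=> e; apply: (hi k) => //; nlia.
  have [n1 n2] := opensP _ _ _ oi.
  move: (si); rewrite spl => /orP[sl|su].
    apply: Or32; apply/isnewP; split => //; first exact/opensP.
    by move=> y hy sy; apply: hi; [nlia|rewrite spl sy].
  apply: Or33; apply/isnewP; split => //; first exact/opensP.
  by move=> y hy sy; apply: hi; [nlia|rewrite spl sy orbT].
case=> [/andP[/eqP -> o]|/isnewP[ik si oi hi]|/isnewP[ik si oi hi]].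
- by split => // y; nlia.
- have [n1 n2] := opensP _ _ _ oi.
  have := lower_lt ik si n2 => lt.
  split; rewrite ?spl ?si //; first by nlia.
    by apply/opensP; split => // e; move: lt; rewrite e ltNge bq.
  move=> y /andP[iy]; rewrite ltnS leq_eqVlt => /orP[/eqP -> _ e|yk].
    by rewrite e in n2.
  rewrite spl => /orP[sy|sy]; first by apply: hi => //; rewrite iy.
  case: (eqVneq (f y) (f k)) => [-> e|/eqP nb e]; first by rewrite e in n2.
  by have := upper_gt yk sy nb; rewrite e => /(lt_trans lt); rewrite ltxx.
- have [n1 n2] := opensP _ _ _ oi.
  have := upper_gt ik si n1 => gt.
  split; rewrite ?spl ?si ?orbT //; first by nlia.
    by apply/opensP; split => // e; move: gt; rewrite e ltNge qb.
  move=> y /andP[iy]; rewrite ltnS leq_eqVlt => /orP[/eqP -> _ e|yk].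
    by rewrite e in n1.
  rewrite spl => /orP[sy|sy]; last by apply: hi => //; rewrite iy.
  case: (eqVneq (f y) (f k)) => [-> e|/eqP nb e]; first by rewrite e in n1.
  by have := lower_lt yk sy nb; rewrite e => /(lt_trans gt); rewrite ltxx.
Qed.

Lemma newsum_split (M : nmodType) (wt : nat -> M) :
  newsum wt k.+1 q q' f = (if opens q q' (f k) then wt k else 0)
    + (newsum wt k q (f k) f + newsum wt k (f k) q' f).
Proof.
rewrite /newsum (sum_split3 _ (fun i => isnew_split i)); first last.
- move=> i /isnewP[_ si _ _]; apply/negP => /isnewP[_ si' _ _].
  by move: (strip_disjoint si); rewrite si'.
- by move=> i /andP[/eqP -> _]; rewrite /isnew ltnn.
congr (_ + _); case: ifP => o.
  by rewrite (big_pred1 (Ordinal kn)) // => i; rewrite andbT.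
by rewrite big_pred0 // => i; rewrite andbF.
Qed.

Lemma vertical_split : vertical k.+1 q q' f =
  `|Y k - tpos (f k)| + (vertical k q (f k) f + vertical k (f k) q' f).
Proof.
have spl := strip_split sk vk.
rewrite /vertical (@sum_split3 _ _ (fun i => val i == k)
  (fun i => (i < k)%N && strip q (f k) i) (fun i => (i < k)%N && strip (f k) q' i)).
- by rewrite (big_pred1 (Ordinal kn)).
- move=> i; rewrite ltnS leq_eqVlt; case: (eqVneq (val i) k) => [e|ne] /=.
    by rewrite e sk.
  by rewrite -andb_orr -spl.
- by move=> i /eqP ->; rewrite ltnn.
- by move=> i /andP[_ /strip_disjoint/negbTE ->]; rewrite andbF.
Qed.

End Decompose.

Lemma newsum_skip (M : nmodType) (wt : nat -> M) k q q' f :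
  ~~ strip q q' k -> newsum wt k.+1 q q' f = newsum wt k q q' f.
Proof.
move=> /negP nk; apply: eq_bigl => i.
apply/isnewP/isnewP => -[h1 h2 h3 h4]; split => //.
- by move: h1; rewrite ltnS leq_eqVlt => /orP[/eqP e|//]; rewrite e in h2.
- by move=> y hy; apply: h4; nlia.
- by nlia.
- move=> y /andP[iy]; rewrite ltnS leq_eqVlt => /orP[/eqP -> //|yk].
  by apply: h4; rewrite iy.
Qed.

Lemma vertical_skip k q q' f :
  ~~ strip q q' k -> vertical k.+1 q q' f = vertical k q q' f.
Proof.
move=> /negbTE nk; apply: eq_bigl => i; rewrite ltnS leq_eqVlt.
by case: (eqVneq (val i) k) => [->|]; rewrite ?nk ?andbF.
Qed.

Lemma eq_newsum (M : nmodType) (wt : nat -> M) k q q' f f' :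
  (forall i, (i < k)%N -> strip q q' i -> f i = f' i) ->
  newsum wt k q q' f = newsum wt k q q' f'.
Proof.
move=> e; apply: eq_bigl => i.
apply/isnewP/isnewP => -[h1 h2 h3 h4]; split => //; rewrite -?e // ?e //.
  by move=> y hy sy; rewrite -!e //; [exact: h4|nlia].
by move=> y hy sy; rewrite !e //; [exact: h4|nlia].
Qed.

Lemma eq_vertical k q q' f f' :
  (forall i, (i < k)%N -> strip q q' i -> f i = f' i) ->
  vertical k q q' f = vertical k q q' f'.
Proof. by move=> e; apply: eq_bigr => i /andP[ik si]; rewrite e. Qed.

Lemma eq_fits_strip k q q' f f' :
  (forall i, (i < k)%N -> strip q q' i -> f i = f' i) ->
  fits_strip k q q' f -> fits_strip k q q' f'.
Proof.
move=> e [h1 h2 h3 h4 h5 h6]; split.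
- by move=> i ik si; rewrite -e //; apply: h1.
- by move=> i ik si; rewrite -e //; apply: h2.
- by move=> i ik si; rewrite -e //; apply: h3.
- by move=> i j ik si jk sj; rewrite -!e //; apply: h4.
- by move=> i j ijk si sj; rewrite -!e //; [apply: h5|nlia..].
- by move=> i y ik si hy; rewrite -!e //; apply: h6.
Qed.

Definition charge q q' k b : nat := if opens q q' b then w k else 0%N.
Definition price q q' k b : R :=
  `|Y k - tpos b| + (if opens q q' b then g k else 0).

Lemma cost_split k q q' f : (k < n)%N -> strip q q' k ->
  fits_strip k.+1 q q' f ->
  cost k.+1 q q' f = cost k q (f k) f + cost k (f k) q' f + price q q' k (f k).
Proof.
move=> kn sk Fit; rewrite /cost vertical_split //.
have e : newsum g k.+1 q q' f = (if opens q q' (f k) then g k else 0) +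
  (newsum g k q (f k) f + newsum g k (f k) q' f) :> R := newsum_split kn sk Fit g.
by rewrite e /price; clra.
Qed.

(** * Soundness and completeness of a correctly filled table *)

Section Table.
Variables (F : nat -> nat -> nat -> nat -> bool)
  (T : nat -> nat -> nat -> nat -> R)
  (choice lowcode upcode : nat -> nat -> nat -> nat -> nat) (V : pred nat).

Definition option_ok k q q' b u v : Prop :=
  [/\ (b < Q)%N, tcol b = C k, admissible k q q' b, V u /\ V v &
      F k q b u /\ F k b q' v].

(** The interface between program and combinatorics, free of any memory layout: [F] marks the
    reached entries, [T] gives their values, [V] holds the codes kept. A reached entry is realized
    by its recorded option, and no option does better. *)
Record table_ok : Prop := TableOk {
  tab_base : forall q q' j, (q < Q)%N -> (q' < Q)%N -> V j ->
    F 0 q q' j = (j == 0%N) /\ T 0 q q' 0 = 0;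
  tab_skip : forall k q q' j, (k < n)%N -> (q < Q)%N -> (q' < Q)%N -> V j ->
    ~~ strip q q' k ->
    F k.+1 q q' j = F k q q' j /\ (F k q q' j -> T k.+1 q q' j = T k q q' j);
  tab_choice : forall k q q' j, (k < n)%N -> (q < Q)%N -> (q' < Q)%N -> V j ->
    strip q q' k -> F k.+1 q q' j ->
    let b := choice k.+1 q q' j in
    let u := lowcode k.+1 q q' j in let v := upcode k.+1 q q' j in
    [/\ option_ok k q q' b u v, (u + v + charge q q' k b)%N = j
      & T k.+1 q q' j = T k q b u + T k b q' v + price q q' k b];
  tab_best : forall k q q' b u v, (k < n)%N -> (q < Q)%N -> (q' < Q)%N ->
    strip q q' k -> option_ok k q q' b u v ->
    let j := (u + v + charge q q' k b)%N in V j ->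
    F k.+1 q q' j /\
    T k.+1 q q' j <= T k q b u + T k b q' v + price q q' k b }.

(** Only the half that contains the point [i] is entered, so that this is a walk and not a recursion
    on a tree: it can be run as a loop. The comparison with [tpos b] follows the half-open
    convention of [strip]. *)
Fixpoint trace k q q' j i : nat :=
  if k isn't l.+1 then 0%N else
  if ~~ strip q q' l then trace l q q' j i else
  let b := choice k q q' j in
  if i == l then b
  else if tpos b <= Y i then trace l b q' (upcode k q q' j) i
  else trace l q b (lowcode k q q' j) i.

Hypothesis tabP : table_ok.

Lemma trace_sound k q q' j : (k <= n)%N -> (q < Q)%N -> (q' < Q)%N -> V j ->
  F k q q' j -> let f := trace k q q' j in
  [/\ fits_strip k q q' f, cost k q q' f = T k q q' j & code k q q' f = j].
Proof.
elim: k q q' j => [|k IHk] q q' j kn hq hq' Vj Fj f.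
  have [e0 T0] := tab_base tabP hq hq' Vj.
  move: Fj @f; rewrite e0 => /eqP ->; split.
  - by split => [i|i|i|i i2|i i2|i y]; rewrite ?ltn0 ?andbF.
  - rewrite T0 /cost /vertical /newsum !big_pred0 ?addr0 //.
  - by rewrite /code /newsum big_pred0.
case/boolP: (strip q q' k) => [sk|ns]; last first.
  have [eF eT] := tab_skip tabP kn hq hq' Vj ns.
  rewrite eF in Fj; have [h1 h2 h3] := IHk _ _ _ (ltnW kn) hq hq' Vj Fj.
  have -> : f = trace k q q' j by apply: funext => i; rewrite /f /= ns.
  split; first exact/fits_strip_skip.
  - by rewrite /cost vertical_skip // newsum_skip // eT.
  - by rewrite /code newsum_skip.
have /= := tab_choice tabP kn hq hq' Vj sk Fj.
set b := choice _ _ _ _; set u := lowcode _ _ _ _; set v := upcode _ _ _ _.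
move=> [[hb cb vb [Vu Vv] [Fu Fv]] ej eT].
have ef i : f i = if i == k then b else if tpos b <= Y i then trace k b q' v i
    else trace k q b u i by rewrite /f /= sk.
have [l1 l2 l3] := IHk _ _ _ (ltnW kn) hq hb Vu Fu.
have [u1 u2 u3] := IHk _ _ _ (ltnW kn) hb hq' Vv Fv.
have fk : f k = b by rewrite ef eqxx.
have fl i : (i < k)%N -> strip q b i -> trace k q b u i = f i.
  move=> ik /andP[_ ib]; rewrite ef (ltn_eqF ik).
  by rewrite leNgt ib.
have fu i : (i < k)%N -> strip b q' i -> trace k b q' v i = f i.
  by move=> ik /andP[ib _]; rewrite ef (ltn_eqF ik) ib.
have Fit : fits_strip k.+1 q q' f.
  by apply: fits_strip_glue; rewrite ?fk //;
    [apply: eq_fits_strip l1|apply: eq_fits_strip u1].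
split => //.
- rewrite cost_split // fk eT -l2 -u2 /cost.
  by rewrite -(eq_vertical fl) -(eq_vertical fu) -(eq_newsum _ fl) -(eq_newsum _ fu).
- rewrite /code newsum_split // fk -(eq_newsum _ fl) -(eq_newsum _ fu).
  by rewrite -ej; move: l3 u3; rewrite /code => -> ->; rewrite addrC.
Qed.

(** Entries exist for codes in [V] only, so the codes of the two halves, which are sums over fewer
    labels, must belong to [V] too. *)
Hypothesis V_down : forall P P' : pred 'I_n, (forall i, P i -> P' i) ->
  V (\sum_(i < n | P' i) w i)%N -> V (\sum_(i < n | P i) w i)%N.

Lemma table_complete k q q' f : (k <= n)%N -> (q < Q)%N -> (q' < Q)%N ->
  fits_strip k q q' f -> V (code k q q' f) ->
  F k q q' (code k q q' f) /\ T k q q' (code k q q' f) <= cost k q q' f.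
Proof.
elim: k q q' => [|k IHk] q q' kn hq hq' Fit Vj.
  have e0 (M : nmodType) (wt : nat -> M) : newsum wt 0 q q' f = 0.
    by rewrite /newsum big_pred0 // => i; apply/negP => /isnewP[].
  have [eF T0] := tab_base tabP hq hq' Vj.
  rewrite eF /code e0 eqxx; split => //.
  by rewrite T0 /cost /vertical e0 big_pred0 ?addr0.
case/boolP: (strip q q' k) => [sk|ns]; last first.
  have [eF eT] := tab_skip tabP kn hq hq' Vj ns.
  have ec : code k.+1 q q' f = code k q q' f by rewrite /code newsum_skip.
  rewrite ec in eF eT Vj *.
  have [h1 h2] := IHk q q' (ltnW kn) hq hq' (proj1 (fits_strip_skip f kn ns) Fit) Vj.
  rewrite eF; split => //.
  by rewrite /cost vertical_skip // newsum_skip // eT.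
have [vb Fl Fu] := fits_strip_split kn sk Fit.
have [hb cb _ _] := fs_type Fit (ltnSn k) sk.
have isl i : isnew k q (f k) f i -> isnew k.+1 q q' f i.
  by rewrite (isnew_split kn sk Fit) => ->; rewrite orbT.
have isu i : isnew k (f k) q' f i -> isnew k.+1 q q' f i.
  by rewrite (isnew_split kn sk Fit) => ->; rewrite !orbT.
have Vl : V (code k q (f k) f) by apply: V_down Vj => i; apply: isl.
have Vu : V (code k (f k) q' f) by apply: V_down Vj => i; apply: isu.
have [Fl1 Tl] := IHk _ _ (ltnW kn) hq hb Fl Vl.
have [Fu1 Tu] := IHk _ _ (ltnW kn) hb hq' Fu Vu.
have ej : code k.+1 q q' f =
    (code k q (f k) f + code k (f k) q' f + charge q q' k (f k))%N.
  rewrite /code newsum_split // /charge; case: ifP => _; rewrite ?add0r ?addn0 //.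
  by rewrite addrC.
have [|F1 T1] := @tab_best tabP k q q' (f k) _ _ kn hq hq' sk
  (And5 hb cb vb (conj Vl Vu) (conj Fl1 Fu1)).
  by rewrite -ej.
rewrite -ej in F1 T1; split => //; apply: (le_trans T1).
by rewrite cost_split //; clra.
Qed.

End Table.
End Strips.

(** * Height functions and candidate positions *)

Lemma nearest_signed (R : realFieldType) (s : seq R) :
  (exists2 x, x \in s & 0 < x) ->
  exists2 d, d \in s & 0 < d /\ forall x, x \in s -> 0 < x -> d <= x.
Proof.
elim: s => [[x]//|y s IHs] [x].
case: (pselect (exists2 x, x \in s & 0 < x)) => [/IHs [d ds [d0 dm]] _ _|ns].
  case: (ltrP 0 y) => y0; last first.
    exists d; [by rewrite inE ds orbT|split => // z].
    rewrite inE => /orP[/eqP -> z0|zs z0]; last exact: dm.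
    by rewrite leNgt in y0; rewrite z0 in y0.
  case: (lerP d y) => dy.
    exists d; [by rewrite inE ds orbT|split => // z].
    by rewrite inE => /orP[/eqP ->//|zs z0]; apply: dm.
  exists y; [by rewrite inE eqxx|split => // z].
  by rewrite inE => /orP[/eqP ->//|zs z0]; apply: le_trans (ltW dy) _; apply: dm.
rewrite inE => /orP[/eqP -> y0|xs x0]; last by case: ns; exists x.
exists y; [by rewrite inE eqxx|split => // z].
by rewrite inE => /orP[/eqP ->//|zs z0]; case: ns; exists z.
Qed.

Section Heights.
Variables (R : realType) (n m : nat) (I : instance R n m).
Local Notation D := (minsep I).

(** In [hf_cross], the backbone at height [h j] extends over the abscissa of [i] as soon as one of
    its points lies further left; letting [j] range over all points covers this. *)
Record height_feasible (h : 'I_n -> R) : Prop := HeightFeasible {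
  hf_color : forall i j, h i = h j -> pc I i = pc I j;
  hf_range : forall i, yb I <= h i <= yt I;
  hf_sep : forall i j, h i <> h j -> D <= `|h i - h j|;
  hf_far : forall i j, h i <> h j -> D <= `|h j - py I i|;
  hf_cross : forall i j, px I j < px I i -> h i <> h j ->
    off_range (h j) (py I i) (h i) }.

Definition opener (h : 'I_n -> R) (i : 'I_n) : bool :=
  [forall j, (px I j < px I i) ==> (h j != h i)].

Definition height_cost (horiz : bool) (h : 'I_n -> R) : R :=
  \sum_(i < n) `|py I i - h i|
  + (if horiz then \sum_(i < n | opener h i) (xr I - px I i) else 0).

Definition same_classes (h h' : 'I_n -> R) : Prop :=
  forall i j, (h' i == h' j) = (h i == h j).

Lemma opener_same h h' : same_classes h h' -> opener h' =1 opener h.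
Proof. by move=> e i; apply: eq_forallb => j; rewrite e. Qed.

Definition anchors0 : seq R := [seq py I i | i <- enum 'I_n] ++ [:: yb I; yt I].
Definition anchors : seq R :=
  flatten [seq [:: a; a + D; a - D] | a <- anchors0].

(** The clusters are the connected components of this relation. Equality is included so that all
    points of a label move together. *)
Definition tight (h : 'I_n -> R) : rel 'I_n := fun i j =>
  [|| h i == h j, h i == h j + D | h i == h j - D].

Lemma tight_sym h : symmetric (tight h).
Proof.
move=> i j; rewrite /tight; congr (_ || _); first by rewrite eq_sym.
by rewrite orbC; congr (_ || _); apply/eqP/eqP => ->; ring.
Qed.

(* It increases with every shift and is bounded, so that shifting terminates. *)
Definition tightness (h : 'I_n -> R) : nat :=
  #|[set p : 'I_n * 'I_n | tight h p.1 p.2]| + #|[set i | h i \in anchors]|.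

Lemma anchors_near a : a \in anchors0 ->
  [/\ a \in anchors, a + D \in anchors & a - D \in anchors].
Proof.
by move=> ha; split; apply/flatten_mapP; exists a => //; rewrite !inE eqxx ?orbT.
Qed.

Lemma anchors0_py i : py I i \in anchors0.
Proof. by rewrite mem_cat map_f ?mem_enum. Qed.
Lemma anchors0_yb : yb I \in anchors0.
Proof. by rewrite mem_cat !inE eqxx orbT. Qed.
Lemma anchors0_yt : yt I \in anchors0.
Proof. by rewrite mem_cat !inE eqxx !orbT. Qed.

Hypothesis wfI : wf_instance I.

Let D_gt0 : 0 < D. Proof. by case: wfI. Qed.

(** * Moving a cluster up to the next contact *)

Section Shift.
Variables (h : 'I_n -> R) (S : {set 'I_n}) (d : R).
Hypothesis hf : height_feasible h.
Hypothesis S_loose : forall i j, i \in S -> j \notin S -> ~~ tight h i j.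
Hypothesis S_free : forall i, i \in S -> h i \notin anchors.

Definition events : seq R :=
  anchors ++ flatten [seq [:: h j + D; h j - D] | j <- enum (~: S)].

Definition shift (i : 'I_n) : R := if i \in S then h i + d else h i.

(** The derivative of the vertical length at [h i]. For [i] in [S] it exists, since [py I i] is an
    anchor and [h i] is not. *)
Definition slope (i : 'I_n) : R := if h i < py I i then -1 else 1.

Hypothesis d_ok : forall i e, i \in S -> e \in events ->
  (h i < e -> h i + d <= e) /\ (e < h i -> e <= h i + d).

Lemma events_other j : j \notin S -> h j + D \in events /\ h j - D \in events.
Proof.
move=> jS; rewrite !mem_cat; split; apply/orP; right; apply/flatten_mapP;
  by exists j; rewrite ?mem_enum ?inE ?jS ?eqxx ?orbT.
Qed.

Lemma shift_anchor i a : a \in anchors ->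
  (h i <= a -> shift i <= a) /\ (a <= h i -> a <= shift i).
Proof.
move=> ha; rewrite /shift; case: ifPn => // iS.
have [|h1 h2] := @d_ok i a iS; first by rewrite mem_cat ha.
have /eqP ne : h i != a by apply: contraNneq (S_free iS) => ->.
by split; rewrite le_eqVlt => /orP[/eqP //|]; [apply: h1|move=> e; exfalso; apply: ne|apply: h2].
Qed.

(** Stated without absolute value, so that the vertical order of the backbones is kept along with
    their distance. If only one of them moves, looseness makes the gap strictly larger than [D], and
    the motion stops at the event where it equals [D]. *)
Lemma shift_sep i j : D <= h i - h j -> D <= shift i - shift j.
Proof.
have D0 := D_gt0; rewrite /shift; case: ifPn => iS; case: ifPn => jS // hij.
- by lra.
- have [e1 _] := events_other jS; have [_ h2] := d_ok iS e1.
  have : h j + D < h i.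
    rewrite lt_neqAle; apply/andP; split; last by lra.
    by apply: contraNneq (S_loose iS jS) => e; rewrite /tight -e eqxx orbT.
  by move=> /h2; lra.
- have [_ e1] := events_other iS; have [h2 _] := d_ok jS e1.
  have : h j < h i - D.
    rewrite lt_neqAle; apply/andP; split; last by lra.
    by apply: contraNneq (S_loose jS iS) => e; rewrite /tight e eqxx !orbT.
  by move=> /h2; lra.
Qed.

Lemma shift_classes : same_classes h shift.
Proof.
have D0 := D_gt0; move=> i j; case: (eqVneq (h i) (h j)) => [e|/eqP ne].
  rewrite /shift; case: ifPn => iS; case: ifPn => jS; rewrite ?e ?eqxx //.
    by have := S_loose iS jS; rewrite /tight e eqxx.
  by have := S_loose jS iS; rewrite /tight e eqxx.
apply/negP => /eqP e.
have := hf_sep hf ne; rewrite far_cases => /orP[] /shift_sep; rewrite e; lra.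
Qed.

Lemma shift_feasible : height_feasible shift.
Proof.
have D0 := D_gt0.
have cl i j : shift i <> shift j -> h i <> h j.
  by move=> ne e; apply: ne; apply/eqP; rewrite shift_classes e.
split.
- by move=> i j /eqP; rewrite shift_classes => /eqP; apply: hf_color.
- move=> i; have /andP[h1 h2] := hf_range hf i.
  have [a1 _ _] := anchors_near anchors0_yb.
  have [a2 _ _] := anchors_near anchors0_yt.
  by rewrite (proj2 (shift_anchor i a1)) // (proj1 (shift_anchor i a2)).
- by move=> i j /cl/(hf_sep hf); rewrite !far_cases => /orP[] /shift_sep ->;
    rewrite ?orbT.
- move=> i j /cl/(hf_far hf); have [_ a1 a2] := anchors_near (anchors0_py i).
  rewrite !far_cases => /orP[] e.
    have k := proj2 (shift_anchor j a1).
    have {}e : py I i + D <= h j by lra.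
    by apply/orP; left; have := k e; lra.
  have k := proj1 (shift_anchor j a2).
  have {}e : h j <= py I i - D by lra.
  by apply/orP; right; have := k e; lra.
- move=> i j ij /cl ne; have := hf_cross hf ij ne.
  have := hf_sep hf ne; have := hf_far hf ne.
  have [_ a1 a2] := anchors_near (anchors0_py i).
  have k1 := proj2 (shift_anchor j a1); have k2 := proj1 (shift_anchor j a2).
  (* A strict inequality could become an equality under the shift, so both are first sharpened to
     gaps of at least [D]. *)
  rewrite !far_cases => f1 f2 [[c1 c2]|[c1 c2]].
    have f1' : h j <= py I i - D by lra.
    have f2' : D <= h i - h j by lra.
    by left; split; [have := k2 f1'|have := shift_sep f2']; lra.
  have f1' : py I i + D <= h j by lra.
  have f2' : D <= h j - h i by lra.
  by right; split; [have := k1 f1'|have := shift_sep f2']; lra.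
Qed.

Lemma shift_vertical i :
  `|py I i - shift i| = `|py I i - h i| + (if i \in S then slope i * d else 0).
Proof.
have [a _ _] := anchors_near (anchors0_py i).
have [h1 h2] := shift_anchor i a; move: h1 h2.
rewrite /shift /slope; case: ifP => iS; last by rewrite addr0.
case: ltrP => c h1 h2.
  have c1 := ltW c; rewrite !ger0_norm ?subr_ge0 ?h1 //; ring.
by rewrite !ler0_norm ?subr_le0 ?h2 //; ring.
Qed.

Lemma shift_cost horiz : d * \sum_(i in S) slope i <= 0 ->
  height_cost horiz shift <= height_cost horiz h.
Proof.
move=> hd; rewrite /height_cost; apply: lerD; last first.
  by case: horiz => //; rewrite (eq_bigl _ _ (opener_same shift_classes)).
rewrite (eq_bigr _ (fun i _ => shift_vertical i)) big_split /=.
by rewrite -big_mkcond -mulr_suml mulrC gerDl.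
Qed.

(** Nothing is lost: a tight pair lies entirely inside or outside [S], and no height of [S] was an
    anchor. The event that is hit adds an anchored height or a tight pair. *)
Lemma shift_tightness : (exists i e, [/\ i \in S, e \in events & h i + d = e]) ->
  (tightness h < tightness shift)%N.
Proof.
case=> i [e [iS eev hit]].
have s1 : [set p : 'I_n * 'I_n | tight h p.1 p.2] \subset
    [set p | tight shift p.1 p.2].
  apply/fintype.subsetP => -[a b]; rewrite !inE /= => t.
  have ab : (a \in S) = (b \in S).
    case aS: (a \in S); case bS: (b \in S) => //.
      by have := S_loose aS (negbT bS); rewrite t.
    by have := S_loose bS (negbT aS); rewrite tight_sym t.
  move: t; rewrite /tight /shift ab; case: ifP => // _.
  by case/or3P => /eqP ->; apply/or3P; [apply: Or31|apply: Or32|apply: Or33];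
    apply/eqP; ring.
have s2 : [set i | h i \in anchors] \subset [set i | shift i \in anchors].
  apply/fintype.subsetP => a; rewrite !inE /shift; case: ifP => // aS ha.
  by have := S_free aS; rewrite ha.
move: eev; rewrite mem_cat => /orP[ea|/flatten_mapP[j]].
  rewrite /tightness -addnS leq_add ?subset_leq_card //.
  apply: proper_card; apply/properP; split => //; exists i; rewrite !inE.
    by rewrite /shift iS hit.
  exact: S_free.
rewrite mem_enum inE => jS ej.
rewrite /tightness -addSn leq_add ?subset_leq_card //.
apply: proper_card; apply/properP; split => //; exists (i, j); rewrite !inE /=.
  rewrite /tight /shift iS (negbTE jS) hit.
  by move: ej; rewrite !inE => /orP[] /eqP ->; rewrite eqxx !orbT.
exact: S_loose.
Qed.

End Shift.

(* [S] is moved, in a direction in which the total length does not increase, up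
   to the nearest event; one exists on both sides because of yb and yt. *)
Lemma improve horiz h (S : {set 'I_n}) : height_feasible h ->
  (exists i, i \in S) ->
  (forall i j, i \in S -> j \notin S -> ~~ tight h i j) ->
  (forall i, i \in S -> h i \notin anchors) ->
  exists h', [/\ height_feasible h', same_classes h h',
    height_cost horiz h' <= height_cost horiz h & (tightness h < tightness h')%N].
Proof.
move=> hf [i0 i0S] Sl Sf.
pose L := [seq e - h i | i <- enum S, e <- events h S].
(* No event is at displacement 0, so the nearest event on either side is a genuine move. *)
have Lnz x : x \in L -> x != 0.
  case/allpairsPdep => i [e [+ + ->]]; rewrite mem_enum => iS.
  rewrite mem_cat => /orP[ea|/flatten_mapP[j]].
    by rewrite subr_eq0; apply: contraNneq (Sf i iS) => <-.
  rewrite mem_enum inE => jS ej; rewrite subr_eq0.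
  apply: contraNneq (Sl i j iS jS) => e1; rewrite /tight -e1.
  by move: ej; rewrite !inE => /orP[] /eqP ->; rewrite eqxx ?orbT.
have Levt i e : i \in S -> e \in events h S -> e - h i \in L.
  by move=> iS ee; apply/allpairsPdep; exists i, e; rewrite mem_enum.
have [ha1 _ _] := anchors_near anchors0_yt.
have [ha2 _ _] := anchors_near anchors0_yb.
have Lt : yt I - h i0 \in L by apply: Levt => //; rewrite mem_cat ha1.
have Lb : yb I - h i0 \in L by apply: Levt => //; rewrite mem_cat ha2.
have /andP[rb rt] := hf_range hf i0.
have [|u uL [u0 um]] := @nearest_signed _ L.
  by exists (yt I - h i0) => //; rewrite lt_neqAle eq_sym Lnz //= subr_ge0.
have [|v vL [v0 vm]] := @nearest_signed _ [seq - x | x <- L].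
  exists (- (yb I - h i0)); first exact: map_f.
  by rewrite lt_neqAle eq_sym oppr_eq0 Lnz //= oppr_ge0 subr_le0.
pose d := if \sum_(i in S) slope h i <= 0 then u else - v.
have dL : d \in L.
  by rewrite /d; case: ifP => // _; case/mapP: vL => x xL ->; rewrite opprK.
have hd : d * \sum_(i in S) slope h i <= 0.
  rewrite /d; case: ifP => hs; first by rewrite pmulr_rle0.
  by rewrite mulNr oppr_le0 mulr_ge0 ?(ltW v0) // ltW // ltNge hs.
have d_ok i e : i \in S -> e \in events h S ->
    (h i < e -> h i + d <= e) /\ (e < h i -> e <= h i + d).
  move=> iS ee; have eL := Levt _ _ iS ee.
  have vm' x : x \in L -> x < 0 -> v <= - x.
    by move=> xL x0; apply: vm; [exact: map_f|lra].
  split => hlt.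
    have eu : u <= e - h i by apply: um => //; lra.
    by rewrite /d; case: ifP => _; lra.
  have ev : v <= - (e - h i) by apply: vm' => //; lra.
  by rewrite /d; case: ifP => _; lra.
exists (shift h S d); split.
- exact: shift_feasible.
- exact: shift_classes.
- exact: shift_cost.
- apply: shift_tightness => //.
  case/allpairsPdep: dL => i [e [+ ee ->]]; rewrite mem_enum => iS.
  by exists i, e; split => //; ring.
Qed.

Definition anchored h i := exists2 j, connect (tight h) i j & h j \in anchors.

Lemma anchor_all horiz h : height_feasible h ->
  exists h', [/\ height_feasible h', same_classes h h',
    height_cost horiz h' <= height_cost horiz h & forall i, anchored h' i].
Proof.
have bound h0 : (tightness h0 <= n * n + n)%N.
  rewrite leq_add //; last by rewrite -[leqRHS]card_ord max_card.
  by rewrite (leq_trans (max_card _)) // card_prod card_ord.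
move: {2}(n * n + n - tightness h)%N (erefl (n * n + n - tightness h)%N) => N.
elim/ltn_ind: N h => N IHN h eN hf.
case: (pselect (forall i, anchored h i)) => [a|/existsNP[i na]].
  by exists h; split => // i j.
pose S := [set j | connect (tight h) i j].
have sym : connect_sym (tight h) by apply: sym_connect_sym; exact: tight_sym.
have [||| h' [hf' cl c t]] := @improve horiz h S hf.
- by exists i; rewrite inE connect0.
- move=> j k; rewrite !inE => ij; apply: contra => t.
  exact: connect_trans ij (connect1 t).
- by move=> j; rewrite inE => ij; apply/negP => ha; apply: na; exists j.
have [|//|h'' [f2 c2 l2 a2]] := IHN _ _ h' (erefl _).
  by rewrite -eN; have := bound h'; lia.
exists h''; split => //; last exact: le_trans l2 c.
by move=> j k; rewrite c2 cl.
Qed.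

(** Steps up and steps down are counted separately, so that the length of the path bounds [a + b]
    and not only their difference. *)
Lemma path_tight h p i : path (tight h) i p ->
  exists a b : nat, (a + b <= size p)%N /\ h i = h (last i p) + a%:R * D - b%:R * D.
Proof.
elim: p i => [|j p IHp] i /=; first by exists 0%N, 0%N; split => //; ring.
case/andP => t /IHp [a [b [ab e]]].
case/or3P: t => /eqP ->; rewrite e.
- by exists a, b; split; [lia|].
- by exists a.+1, b; split; [lia|]; rewrite -natr1; ring.
- by exists a, b.+1; split; [lia|]; rewrite -natr1; ring.
Qed.

(** A path without repetitions has fewer than n edges, and the anchor at its end is within one [D]
    of a point or a side: the offset is at most n steps either way. The index [k] is this offset
    shifted by n, hence [n + n + 1] values. *)
Lemma anchored_candidate h i : anchored h i ->
  exists2 a, a \in anchors0 &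
  exists2 k, (k < n + n + 1)%N & h i = a - n%:R * D + k%:R * D.
Proof.
case=> j /connectP[p0 pp0 ->]; case/shortenP: pp0 => p pp up _ ha.
have [a [b [ab e]]] := path_tight pp.
have sp : (size p < n)%N.
  by have := card_uniqP up; rewrite /= -[X in _ -> (_ < X)%N]card_ord => <-;
     apply: max_card.
case/flatten_mapP: ha => c hc; rewrite !inE => hlast; exists c => //.
have abn : (a + b < n)%N by exact: leq_ltn_trans ab sp.
have key (x y : nat) : (x + y <= n)%N -> h i = c + x%:R * D - y%:R * D ->
    exists2 k, (k < n + n + 1)%N & h i = c - n%:R * D + k%:R * D.
  move=> xy ->; exists (n + x - y)%N; first by lia.
  by rewrite natrB; [rewrite natrD; ring|lia].
case/or3P: hlast => /eqP el.
- by apply: (key a b); [exact: ltnW|rewrite e el].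
- by apply: (key a.+1 b); [by []|rewrite e el -natr1; ring].
- by apply: (key a b.+1); [by rewrite addnS|rewrite e el -natr1; ring].
Qed.

Theorem candidate_heights horiz h : height_feasible h ->
  exists h', [/\ height_feasible h', same_classes h h',
    height_cost horiz h' <= height_cost horiz h
  & forall i, exists2 a, a \in anchors0 &
      exists2 k, (k < n + n + 1)%N & h' i = a - n%:R * D + k%:R * D].
Proof.
move=> /(anchor_all horiz)[h' [h1 h2 h3 h4]]; exists h'; split => // i.
exact: anchored_candidate.
Qed.

End Heights.

(** * Labelings and their height functions *)

Section Labelings.
Variables (R : realType) (n m : nat) (I : instance R n m).
Local Notation D := (minsep I).
Hypothesis wfI : wf_instance I.

Definition heights (L : labeling R n m) (i : 'I_n) : R := ly (assign L i).

Lemma first_point (L : labeling R n m) (l : 'I_(nlab L)) :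
  (exists i, assign L i = l) ->
  exists i, [/\ assign L i = l, leftx I l = px I i
    & forall j, assign L j = l -> px I i <= px I j].
Proof.
case=> i0 e0; pose i := [arg min_(j < i0 | assign L j == l) px I j]%O.
have [/eqP ei mi] : assign L i == l /\
    forall j, assign L j == l -> px I i <= px I j.
  by rewrite /i; case: arg_minP => [|j h1 h2]; rewrite ?e0.
exists i; split => //; last by move=> j /eqP; apply: mi.
apply/le_anti; rewrite bigmin_le_cond ?ei //=; apply: le_bigmin; last exact: mi.
by case: wfI => _ _ /(_ i) [/andP[]].
Qed.

Section FromLabeling.
Variable L : labeling R n m.
Hypothesis BL : backbone_labeling I L.

Lemma ly_inj : injective (@ly R n m L).
Proof.
have [_ D0 _ _ _] := wfI; move=> l l' e; apply/eqP/negPn/negP => ne.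
case: BL => _ _ _ [/(_ l l' ne)]; rewrite e subrr normr0; lra.
Qed.

Lemma heights_eq i j : (heights L i == heights L j) = (assign L i == assign L j).
Proof. by rewrite /heights (inj_eq ly_inj). Qed.

Lemma heights_feasible : height_feasible I (heights L).
Proof.
have [_ D0 rect pxI _] := wfI; case: BL => col surj rng [d1 d2] cf.
have ne i j : heights L i <> heights L j -> assign L i != assign L j.
  by move=> /eqP; rewrite heights_eq.
split.
- by move=> i j /eqP; rewrite heights_eq -!col => /eqP ->.
- by move=> i; apply: rng.
- by move=> i j /ne; apply: d1.
- by move=> i j /ne; apply: d2.
- move=> i j ij /ne nij.
  have nb : ~ (Num.min (py I i) (heights L i) <= heights L j
      <= Num.max (py I i) (heights L i)).
    move=> hb; move: nij; apply/negP/negPn/eqP/esym; apply: cf => //.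
    (* This point lies on the vertical segment of [i], and on the backbone of [j], which starts at
       or to the left of [px I j]. *)
    exists (px I i, heights L j); split; last first.
      by right; exists i => //=; split.
    left; split => //=; have [xl1 xl2] := rect i.
    rewrite (le_trans _ (ltW ij)) ?bigmin_le_cond //=.
    by case: (rect i) => /andP[].
  rewrite /off_range; move: nb; rewrite ge_min le_max.
  move: (heights L i) (heights L j) (py I i) => a b c.
  case: (ltrP b c) => h1; case: (ltrP b a) => h2 nb.
  + by left.
  + by case: nb; rewrite ?h2 (ltW h1) ?orbT.
  + by case: nb; rewrite ?h1 (ltW h2) ?orbT.
  + right; split; rewrite ltNge; apply/negP => h3; apply: nb.
      by rewrite ?h1 h3.
    by rewrite ?h1 h3 ?orbT.
Qed.

Lemma opener_label (i : 'I_n) : opener I (heights L) i ->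
  leftx I (assign L i) = px I i.
Proof.
have [_ _ _ pxI _] := wfI.
move/forallP => o; have [|j [e -> mj]] := @first_point L (assign L i).
  by exists i.
have := mj i erefl; rewrite le_eqVlt => /orP[/eqP //|lt].
by have := o j; rewrite lt heights_eq e eqxx.
Qed.

(** Every label has exactly one opener, its leftmost point. The total length, the number of labels
    and their numbers per color are all instances of this sum. *)
Lemma sum_openers (M : nmodType) (F : 'I_(nlab L) -> M) :
  \sum_l F l = \sum_(i < n | opener I (heights L) i) F (assign L i).
Proof.
have [_ _ _ pxI _] := wfI; have [_ surj _ _ _] := BL.
have [fst fstP] := boolp.choice (fun l => first_point (surj l)).
rewrite (reindex_onto (assign L) fst); last by move=> l _; case: (fstP l).
apply: eq_bigl => i; have [e1 e2 e3] := fstP (assign L i).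
apply/eqP/forallP => [e j|o] /=.
  apply/implyP => lt; rewrite heights_eq; apply/eqP => ej.
  by have := e3 j ej; rewrite e leNgt lt.
apply: pxI; have := e3 i erefl; rewrite le_eqVlt => /orP[/eqP //|lt].
by have := o (fst (assign L i)); rewrite lt heights_eq e1 eqxx.
Qed.

Lemma leader_length_heights horiz :
  leader_length I L horiz = height_cost I horiz (heights L).
Proof.
rewrite /leader_length /height_cost; congr (_ + _); case: horiz => //.
by rewrite sum_openers; apply: eq_bigr => i o; rewrite opener_label.
Qed.

Lemma nlab_heights : nlab L = #|[pred i | opener I (heights L) i]|.
Proof.
have := sum_openers (fun=> 1%N).
by rewrite [LHS]sum1_card card_ord => {1}->; rewrite [LHS]sum1_card.
Qed.

Lemma color_heights c : #|[set l | @lcolor R n m L l == c]%SET| =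
  #|[pred i | opener I (heights L) i && (pc I i == c)]|.
Proof.
have [col _ _ _ _] := BL.
have := sum_openers (fun l => (@lcolor R n m L l == c) : nat).
rewrite -big_mkcond /= sum1_card => e; rewrite cardsE; rewrite [LHS]e.
by under eq_bigr do rewrite col; rewrite -big_mkcondr sum1_card.
Qed.

End FromLabeling.

Lemma backbone_labelingP (L : labeling R n m) :
  (forall i, lcolor (assign L i) = pc I i) ->
  (forall l, exists i, assign L i = l) -> injective (@ly R n m L) ->
  height_feasible I (heights L) -> backbone_labeling I L.
Proof.
have [_ D0 _ pxI _] := wfI; move=> col surj inj hf.
have ne i j : assign L i != assign L j -> heights L i <> heights L j.
  by move=> /eqP h /inj.
split => //.
- by move=> l; have [i <-] := surj l; exact: hf_range hf i.
- split.
    move=> l l'; have [i <-] := surj l; have [j <-] := surj l'.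
    by move=> /ne/(hf_sep hf).
  by move=> l i; have [j <-] := surj l => /ne/(hf_far hf).
- move=> l l' _ _ [q [ql ql']].
  apply/eqP/negPn/negP => nl.
  (* Two backbones are disjoint by their heights and two vertical segments by their abscissas; only
     a backbone and a segment need an argument. *)
  have crossing (a b : 'I_(nlab L)) : a != b -> backbone I a q ->
      ~ (\bigcup_(i in [set i | assign L i = b]) vsegment I L i)%classic q.
    move=> ab [/andP[q1 _] q2] [i /= ei [q3 q4]].
    have [j [ej lj _]] := first_point (surj a).
    rewrite lj q3 in q1.
    have nij : assign L i != assign L j by rewrite ei ej eq_sym.
    have ltji : px I j < px I i.
      rewrite lt_neqAle q1 andbT; apply: contra nij => /eqP/pxI ->.
      exact: eqxx.
    have := hf_cross hf ltji (ne _ _ nij).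
    rewrite /off_range; move: q4; rewrite q2 /heights ej ei.
    rewrite ge_min le_max => /andP[/orP c1 /orP c2].
    by case: c1; case: c2 => c1 c2 [[c3 c4]|[c3 c4]]; lra.
  case: ql ql' => [ql|ql] [ql'|ql'].
  + by case: ql ql' => _ e1 [_ e2]; move: nl; rewrite (inj l l') ?eqxx -?e1.
  + exact: crossing ql ql'.
  + by apply: crossing ql' ql; rewrite eq_sym.
  + case: ql ql' => i /= e1 [e2 _] [j /= e3 [e4 _]].
    by move: nl; rewrite -e1 -e3 (pxI i j) ?eqxx -?e2.
Qed.

End Labelings.

(** * Points sorted from right to left *)

Section Ranks.
Variables (R : realType) (n m : nat) (I : instance R n m).
Local Notation D := (minsep I).
Hypothesis wfI : wf_instance I.

Definition rk (i : 'I_n) : nat := #|[pred j | px I i < px I j]|.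

Lemma rk_lt i j : (rk i < rk j)%N = (px I j < px I i).
Proof.
apply/idP/idP => [|lt].
  apply: contraTT; rewrite -leNgt -leqNgt => le.
  apply: subset_leq_card; apply/fintype.subsetP => k; rewrite !inE.
  exact: le_lt_trans.
apply: proper_card; apply/properP; split.
  apply/fintype.subsetP => k; rewrite !inE; exact: lt_trans.
by exists i; rewrite !inE ?ltxx.
Qed.

Lemma rk_inj : injective rk.
Proof.
have [_ _ _ pxI _] := wfI; move=> i j e; apply: pxI; apply/le_anti.
by rewrite !leNgt -!rk_lt e !ltnn.
Qed.

Lemma rk_ord i : (rk i < n)%N.
Proof.
rewrite -[ltnRHS]card_ord; apply: proper_card; apply/properP; split.
  by apply/fintype.subsetP.
by exists i; rewrite ?inE ?ltxx.
Qed.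

Definition rko i := Ordinal (rk_ord i).

Lemma rko_inj : injective rko.
Proof. by move=> i j /(congr1 val); apply: rk_inj. Qed.

Lemma rk_onto k : (k < n)%N -> exists i, rk i = k.
Proof.
move=> kn; exists (invF rko_inj (Ordinal kn)).
by have := f_invF rko_inj (Ordinal kn) => /(congr1 val).
Qed.

Lemma sum_rk (M : nmodType) (P : pred nat) (F : nat -> M) :
  \sum_(k < n | P k) F k = \sum_(i < n | P (rk i)) F (rk i).
Proof. by rewrite (reindex_inj rko_inj). Qed.

Variables (horiz : bool) (Q top : nat).
Variables (Y g tpos : nat -> R) (C tcol : nat -> nat).

(** At distance [D] outside the rectangle, the two outer backbones satisfy every distance condition
    automatically and stay out of the range allowed for labels. *)
Record sorted_input : Prop := SortedInput {
  si_y : forall i, Y (rk i) = py I i;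
  si_c : forall i, C (rk i) = pc I i;
  si_g : forall i, g (rk i) = if horiz then xr I - px I i else 0;
  si_bot : tpos 0 = yb I - D;
  si_top : tpos top = yt I + D }.

Hypothesis si : sorted_input.

Local Notation fits := (fits_strip n Q D (yb I) (yt I) Y tpos C tcol n 0 top).

Lemma strip_all k : (k < n)%N -> strip Y tpos 0 top k.
Proof.
have [_ D0 rect _ _] := wfI.
move=> /rk_onto[i <-]; rewrite /strip si_y // si_bot // si_top //.
have [_ /andP[h1 h2]] := rect i; apply/andP; split; lra.
Qed.

(** * Height functions given by types *)

Section Typed.
Variable f : nat -> nat.
Hypothesis F : fits f.

Definition typed_heights (i : 'I_n) : R := tpos (f (rk i)).

(** Different types in use are at distance [D > 0], so two of them never share a height, even with
    different colors. *)
Lemma typed_heights_eq i j :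
  (typed_heights i == typed_heights j) = (f (rk i) == f (rk j)).
Proof.
have [_ D0 _ _ _] := wfI.
apply/eqP/eqP => [e|]; last by rewrite /typed_heights => ->.
case: (fs_far F (rk_ord i) (strip_all (rk_ord i)) (rk_ord j)
  (strip_all (rk_ord j))) => [//|[far _]].
by exfalso; move: e far; rewrite /typed_heights => ->; rewrite subrr normr0 => far; lra.
Qed.

Lemma typed_feasible : height_feasible I typed_heights.
Proof.
have ne i j : typed_heights i <> typed_heights j -> f (rk i) <> f (rk j).
  by move=> h e; apply: h; apply/eqP; rewrite typed_heights_eq e.
have fa i j h := fs_far F (rk_ord i) (strip_all (rk_ord i)) (rk_ord j) h.
split.
- move=> i j /eqP; rewrite typed_heights_eq => /eqP e; apply: val_inj.
  have [_ c1 _ _] := fs_type F (rk_ord i) (strip_all (rk_ord i)).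
  have [_ c2 _ _] := fs_type F (rk_ord j) (strip_all (rk_ord j)).
  by rewrite /= -!si_c // -c1 -c2 e.
- move=> i; have [_ _ h1 h2] := fs_type F (rk_ord i) (strip_all (rk_ord i)).
  by rewrite /typed_heights h1 h2.
- by move=> i j /ne h; have [|[]] := fa i j (strip_all (rk_ord j)).
- by move=> i j /ne h; rewrite -si_y //; have [|[]] := fa i j (strip_all (rk_ord j)).
- move=> i j lt /ne h; rewrite -si_y //.
  have ij : (rk i < rk j < n)%N by rewrite rk_lt lt rk_ord.
  by have [] := fs_cross F ij (strip_all (rk_ord i)) (strip_all (rk_ord j)).
Qed.

(** The outer types are out of range for labels, so in the full strip the leftmost point of each
    class opens a backbone. *)
Lemma typed_opener i :
  isnew Y tpos n 0 top f (rk i) = opener I typed_heights i.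
Proof.
have [_ D0 _ _ _] := wfI.
have si1 := strip_all (rk_ord i).
apply/isnewP/forallP => [[_ _ _ h] j|h].
  apply/implyP => lt; rewrite typed_heights_eq; apply/eqP; apply: h.
    by rewrite rk_lt lt rk_ord.
  exact/strip_all/rk_ord.
split; rewrite ?rk_ord //.
  have [_ _ h1 h2] := fs_type F (rk_ord i) si1.
  apply/opensP; split => e; [move: h1|move: h2].
    by rewrite e si_bot //; lra.
  by rewrite e si_top //; lra.
move=> y /andP[iy yn] _; have [j ej] := rk_onto yn.
have := h j; rewrite -ej -rk_lt {1}ej iy typed_heights_eq /= => /eqP //.
Qed.

Lemma newsum_heights (M : nmodType) (wt : nat -> M) :
  newsum n Y tpos wt n 0 top f =
  \sum_(i < n | opener I typed_heights i) wt (rk i).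
Proof. by rewrite /newsum sum_rk; apply: eq_bigl => i; exact: typed_opener. Qed.

Lemma cost_heights : cost n Y g tpos n 0 top f = height_cost I horiz typed_heights.
Proof.
rewrite /cost /height_cost; congr (_ + _).
  rewrite /vertical (sum_rk (fun k => (k < n)%N && strip Y tpos 0 top k)
    (fun k => `|Y k - tpos (f k)|)).
  apply: eq_big => [i|i _]; last by rewrite si_y.
  by rewrite rk_ord strip_all ?rk_ord.
rewrite newsum_heights; case: horiz (si_g si) => sg; first exact: eq_bigr.
by apply: big1 => i _; rewrite sg.
Qed.

End Typed.

Lemma typed_complete h : height_feasible I h ->
  (forall i, exists t, [/\ (t < Q)%N, tcol t = pc I i & tpos t = h i]) ->
  exists2 f, fits f & forall i, h i = typed_heights f i.
Proof.
have [_ D0 rect _ _] := wfI.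
move=> hf ht.
(* Several candidates may coincide in height; [find] fixes one type per height and color, so that
   the points of a label all get the same type. *)
pose ty (x : R) (c : nat) := find (fun t => (tcol t == c) && (tpos t == x)) (iota 0 Q).
have tyP i : [/\ (ty (h i) (pc I i) < Q)%N, tcol (ty (h i) (pc I i)) = pc I i
    & tpos (ty (h i) (pc I i)) = h i].
  have [t [tQ tc tp]] := ht i.
  have hs : has (fun t => (tcol t == pc I i) && (tpos t == h i)) (iota 0 Q).
    by apply/hasP; exists t; rewrite ?mem_iota // tc tp !eqxx.
  have lt := hs; rewrite has_find size_iota in lt.
  by have := nth_find 0%N hs; rewrite nth_iota // add0n => /andP[/eqP e1 /eqP e2].
pose f k := oapp (fun o : 'I_n => let i := invF rko_inj o in
  ty (h i) (pc I i)) 0%N (insub k).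
have fE i : f (rk i) = ty (h i) (pc I i).
  by rewrite /f (insubT (fun k => k < n)%N (rk_ord i)) /= -/(rko i) invF_f.
have tne i j : f (rk i) <> f (rk j) -> h i <> h j.
  by rewrite !fE => ne e; apply: ne; rewrite e (hf_color hf e).
have tf i : tpos (f (rk i)) = h i by rewrite fE; case: (tyP i).
exists f; last by move=> i; rewrite /typed_heights tf.
split.
- move=> k /rk_onto[i <-] _; rewrite fE si_c //; have [-> -> ->] := tyP i.
  by have /andP[-> ->] := hf_range hf i.
- move=> k /rk_onto[i <-] _; rewrite tf si_bot // si_top //.
  by have /andP[h1 h2] := hf_range hf i; split; right; lra.
- move=> k /rk_onto[i <-] _; rewrite si_y // si_bot // si_top //.
  by have [_ /andP[h1 h2]] := rect i; split; right; lra.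
- move=> k l /rk_onto[i <-] _ /rk_onto[j <-] _; rewrite si_y // !tf.
  case: (eqVneq (f (rk i)) (f (rk j))) => [->|/eqP/tne ne]; first by left.
  by right; split; [exact: hf_sep|exact: hf_far].
- move=> k l /andP[kl ln]; move: (kl); have [j <-] := rk_onto ln.
  have [i <-] := rk_onto (ltn_trans kl ln) => ij _ _.
  case: (eqVneq (f (rk i)) (f (rk j))) => [->|/eqP/tne ne]; first by left.
  by right; rewrite si_y // !tf; apply: hf_cross => //; rewrite -rk_lt.
- by move=> k y _ _; case: ltnP; rewrite ?andbT ?andbF // => h1; rewrite leqNgt h1.
Qed.

End Ranks.

(** * The program *)

Local Close Scope ring_scope.
Declare Scope prog_scope.
Delimit Scope prog_scope with prog.
Local Open Scope prog_scope.

Notation "p ;; q" := (PSeq p q) (at level 60, right associativity) : prog_scope.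

Definition incr (b : nat) : prog := PN b (NConst 0) (NAdd (var b) (NConst 1)).
Definition setv (b : nat) (e : nexp) : prog := PN b (NConst 0) e.
Definition setrv (b : nat) (e : rexp) : prog := PR b (NConst 0) e.

Definition dist (e f : rexp) (b : nat) : prog :=
  PIf (BRealLe e f) (setrv b (RSub f e)) (setrv b (RSub e f)).

Definition delta : rexp := RGet 0 (NConst 4).

(* A type is a candidate height together with a color: the type r * |C| + c
   stands for the r-th candidate with color c.  The candidates 0 and 1, at
   yb - Delta and yt + Delta, are no positions of labels: their types 0 and |C|
   bound the strip containing all points.

   Memory, with points indexed by their rank from right to left:
   - points: 10 index in the input, 11 color, real 8 ordinate, real 9 length of
     a backbone starting there, 39 weight in the code;
   - candidates: 20 number, real 5 height, 21 first type;
   - types: 25 number, real 7 height, 24 color, 26 see [lim_body];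
   - codes: 38 number, 36 list, 37 characteristic function, 28 strict bound;
   - the table, at address 31[k] + 29[q] + 30[q'] + code: 49 reachable, real 11
     cost, 50 chosen type, 51 and 52 codes of the lower and upper strips;
   - 58 type of each point, 59 one plus the label of a type;
   - vector version: 61 the bounds min(k_c, n), 62 the powers of n + 1. *)
Definition sort_body (horiz : bool) : prog :=
  setv 14 (NConst 0) ;;
  PFor 13 0 0 (PIf (RLt (RGet 1 (var 12)) (RGet 1 (var 13))) (incr 14) PSkip) ;;
  PN 10 (var 14) (var 12) ;;
  PN 11 (var 14) (NGet 1 (var 12)) ;;
  PR 8 (var 14) (RGet 2 (var 12)) ;;
  PR 9 (var 14) (RSub (if horiz then RGet 0 (NConst 1) else RGet 1 (var 12))
                      (RGet 1 (var 12))) ;;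
  PR 4 (var 12) (RGet 2 (var 12)).

Definition sort_phase horiz : prog :=
  PFor 12 0 0 (sort_body horiz) ;;
  PR 4 (NGet 0 (NConst 0)) (RGet 0 (NConst 2)) ;;
  PR 4 (NAdd (NGet 0 (NConst 0)) (NConst 1)) (RGet 0 (NConst 3)) ;;
  setv 35 (NAdd (NGet 0 (NConst 0)) (NConst 1)) ;;
  setv 15 (NAdd (NGet 0 (NConst 0)) (NConst 2)) ;;
  setv 16 (NAdd (NAdd (NGet 0 (NConst 0)) (NGet 0 (NConst 0))) (NConst 1)).

(** Without multiplication, the lowest candidate of an anchor is reached by n subtractions of Delta,
    and the others by additions from there. *)
Definition cand_body : prog :=
  setrv 6 (RGet 4 (var 17)) ;;
  PFor 12 0 0 (setrv 6 (RSub (rvar 6) delta)) ;;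
  PFor 19 16 0 (
    PR 5 (var 18) (rvar 6) ;;
    setrv 6 (RAdd (rvar 6) delta) ;;
    incr 18).

Definition cand_phase : prog :=
  PR 5 (NConst 0) (RSub (RGet 0 (NConst 2)) delta) ;;
  PR 5 (NConst 1) (RAdd (RGet 0 (NConst 3)) delta) ;;
  setv 18 (NConst 2) ;;
  PFor 17 15 0 cand_body ;;
  setv 20 (var 18).

Definition type_body : prog :=
  PN 21 (var 22) (var 18) ;;
  PFor 23 0 1 (
    PR 7 (var 18) (RGet 5 (var 22)) ;;
    PN 24 (var 18) (var 23) ;;
    incr 18).

Definition type_phase : prog :=
  setv 18 (NConst 0) ;;
  PFor 22 20 0 type_body ;;
  setv 25 (var 18).

Definition close (y p : rexp) : bexp :=
  BAnd (RLt (RSub y p) delta) (RLt (RSub p y) delta).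

(* The last point too close to a type, plus one: a type is far from all points
   of index larger than k if and only if this is at most k + 1. *)
Definition lim_body : prog :=
  PN 26 (var 41) (NConst 0) ;;
  PFor 27 0 0 (
    PIf (close (RGet 8 (var 27)) (RGet 7 (var 41)))
      (PN 26 (var 41) (NAdd (var 27) (NConst 1))) PSkip).

Definition lim_phase : prog := PFor 41 25 0 lim_body.

(** Tabulates the multiples of a stride by repeated addition and leaves the next multiple in bank
    32, which is the stride of the next index. An address in the table then needs additions only. *)
Definition multiples (arr v limit : nat) (step : nexp) : prog :=
  setv 32 (NConst 0) ;;
  PFor v limit 0 (
    PN arr (var v) (var 32) ;;
    setv 32 (NAdd (var 32) step)).

Definition addr_phase : prog :=
  multiples 30 41 25 (var 28) ;; setv 33 (var 32) ;;
  multiples 29 41 25 (var 33) ;; setv 34 (var 32) ;;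
  multiples 31 40 35 (var 34).

Definition addr (k q q' j : nexp) : nexp :=
  NAdd (NAdd (NAdd (NGet 31 k) (NGet 29 q)) (NGet 30 q')) j.

(** The sum of two codes may be so large that its address denotes an unrelated cell; the test on
    bank 37 ensures that nothing is written there. *)
Definition relax : prog :=
  let j := NAdd (NAdd (NGet 36 (var 44)) (NGet 36 (var 45))) (var 47) in
  let a1 := addr (var 40) (var 41) (var 46) (NGet 36 (var 44)) in
  let a2 := addr (var 40) (var 46) (var 42) (NGet 36 (var 45)) in
  let a := addr (NAdd (var 40) (NConst 1)) (var 41) (var 42) j in
  let new := RAdd (RAdd (RGet 11 a1) (RGet 11 a2)) (rvar 10) in
  PIf (BAnd (BAnd (NEq (NGet 37 j) (NConst 1))
        (BAnd (NEq (NGet 49 a1) (NConst 1)) (NEq (NGet 49 a2) (NConst 1))))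
        (BNot (BAnd (NEq (NGet 49 a) (NConst 1)) (BRealLe (RGet 11 a) new))))
    (PR 11 a new ;;
     PN 49 a (NConst 1) ;;
     PN 50 a (var 46) ;;
     PN 51 a (NGet 36 (var 44)) ;;
     PN 52 a (NGet 36 (var 45)))
    PSkip.

(** The type combines the current candidate height with the color of the point [k]. The loop around
    it thus runs over heights only, which keeps the exponent of |C| at 2. *)
Definition check_type : prog :=
  let y := RGet 8 (var 40) in
  let b := RGet 7 (var 46) in
  let lo := RGet 7 (var 41) in
  let hi := RGet 7 (var 42) in
  let far_lo := BRealLe delta (RSub y lo) in
  let far_hi := BRealLe delta (RSub hi y) in
  setv 46 (NAdd (NGet 21 (var 43)) (NGet 11 (var 40))) ;;
  setv 48 (NConst 0) ;;
  setv 47 (NConst 0) ;;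
  dist y b 10 ;;
  PIf (BAnd (BRealLe (RGet 0 (NConst 2)) b) (BRealLe b (RGet 0 (NConst 3))))
    (PIf (NEq (var 46) (var 41)) (PIf far_hi (setv 48 (NConst 1)) PSkip)
    (PIf (NEq (var 46) (var 42)) (PIf far_lo (setv 48 (NConst 1)) PSkip)
      (setv 47 (NGet 39 (var 40)) ;;
       setrv 10 (RAdd (rvar 10) (RGet 9 (var 40))) ;;
       PIf (BAnd (BRealLe delta (RSub b lo)) (BAnd (BRealLe delta (RSub hi b))
         (BAnd far_lo (BAnd far_hi
           (BNatLe (NGet 26 (var 46)) (NAdd (var 40) (NConst 1)))))))
         (setv 48 (NConst 1)) PSkip)))
    PSkip.

Definition in_strip (y lo hi : rexp) : bexp := BAnd (BRealLe lo y) (RLt y hi).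

Definition split_loop : prog :=
  PFor 43 20 0 (
    check_type ;;
    PIf (NEq (var 48) (NConst 1)) (PFor 44 38 0 (PFor 45 38 0 relax)) PSkip).

(** The recorded choices are not copied: the walk consults them only at points inside the strip. *)
Definition copy_loop : prog :=
  let j := NGet 36 (var 44) in
  let a := addr (NAdd (var 40) (NConst 1)) (var 41) (var 42) j in
  let a0 := addr (var 40) (var 41) (var 42) j in
  PFor 44 38 0 (PN 49 a (NGet 49 a0) ;; PR 11 a (RGet 11 a0)).

Definition strip_body : prog :=
  PIf (in_strip (RGet 8 (var 40)) (RGet 7 (var 41)) (RGet 7 (var 42)))
    split_loop copy_loop.

Definition base_phase : prog :=
  PFor 41 25 0 (PFor 42 25 0 (
    PN 49 (addr (NConst 0) (var 41) (var 42) (NConst 0)) (NConst 1) ;;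
    PR 11 (addr (NConst 0) (var 41) (var 42) (NConst 0)) (RSub (rvar 0) (rvar 0)))).

Definition dp_phase : prog :=
  PFor 40 0 0 (PFor 41 25 0 (PFor 42 25 0 strip_body)).

Definition best_phase : prog :=
  setv 53 (NConst 0) ;;
  PFor 44 38 0 (
    let j := NGet 36 (var 44) in
    let a := addr (NGet 0 (NConst 0)) (NConst 0) (NGet 0 (NConst 1)) j in
    PIf (BAnd (NEq (NGet 49 a) (NConst 1))
              (BNot (BAnd (NEq (var 53) (NConst 1)) (BRealLe (rvar 12) (RGet 11 a)))))
      (setv 53 (NConst 1) ;; setrv 12 (RGet 11 a) ;; setv 54 j) PSkip) ;;
  PN 3 (NConst 0) (var 53).

(** Loops count upwards, while the walk goes from k = n - 1 down to 0. The address [a] depends on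
    banks 55, 56 and 57: the chosen type is saved in bank 46 and the new code is read before the
    bounding type changes. *)
Definition walk_body : prog :=
  let k := NSub (NSub (NGet 0 (NConst 0)) (var 40)) (NConst 1) in
  let a := addr (NAdd k (NConst 1)) (var 55) (var 56) (var 57) in
  let c := NGet 50 a in
  PIf (in_strip (RGet 8 k) (RGet 7 (var 55)) (RGet 7 (var 56)))
    (PIf (NEq (var 12) k) (PN 58 (var 12) c)
      (PIf (BRealLe (RGet 7 c) (RGet 8 (var 12)))
        (setv 46 c ;; setv 57 (NGet 52 a) ;; setv 55 (var 46))
        (setv 46 c ;; setv 57 (NGet 51 a) ;; setv 56 (var 46))))
    PSkip.

Definition walk_phase : prog :=
  PFor 12 0 0 (
    setv 55 (NConst 0) ;; setv 56 (NGet 0 (NConst 1)) ;; setv 57 (var 54) ;;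
    PFor 40 0 0 walk_body).

Definition output_phase : prog :=
  setv 60 (NConst 0) ;;
  PFor 12 0 0 (
    let t := NGet 58 (var 12) in
    PIf (NEq (NGet 59 t) (NConst 0))
      (PN 4 (var 60) (NGet 11 (var 12)) ;;
       PR 3 (var 60) (RGet 7 t) ;;
       incr 60 ;;
       PN 59 t (var 60))
      PSkip ;;
    PN 5 (NGet 10 (var 12)) (NSub (NGet 59 t) (NConst 1))) ;;
  PN 3 (NConst 1) (var 60).

Definition global_counts : prog :=
  setv 38 (NAdd (NGet 0 (NConst 2)) (NConst 1)).

Definition global_codes : prog :=
  PFor 44 38 0 (PN 36 (var 44) (var 44) ;; PN 37 (var 44) (NConst 1)) ;;
  PFor 40 0 0 (PN 39 (var 40) (NConst 1)) ;;
  setv 28 (var 38).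

(** Two products by repeated addition: the radix times n in bank 65, the number of codes times the
    cap in bank 64. The second uses a guard inside a loop of n turns because the cap, written in
    this phase, cannot be a limit. *)
Definition color_loop : prog :=
  PFor 23 0 1 (
    PIf (BNatLe (NGet 2 (var 23)) (NGet 0 (NConst 0)))
      (PN 61 (var 23) (NGet 2 (var 23))) (PN 61 (var 23) (NGet 0 (NConst 0))) ;;
    PN 62 (var 23) (var 63) ;;
    setv 64 (NConst 0) ;;
    setv 65 (NConst 0) ;;
    PFor 12 0 0 (
      setv 65 (NAdd (var 65) (var 63)) ;;
      PIf (NLt (var 12) (NGet 61 (var 23))) (setv 64 (NAdd (var 64) (var 38))) PSkip) ;;
    setv 63 (NAdd (var 65) (var 63)) ;;
    setv 38 (var 64)).

Definition weight_loop : prog :=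
  PFor 40 0 0 (
    PN 39 (var 40) (NConst 0) ;;
    PFor 27 0 0 (
      PIf (BAnd (NLt (var 40) (var 27)) (NEq (NGet 11 (var 27)) (NGet 11 (var 40))))
        (PN 39 (var 40) (NGet 62 (NGet 11 (var 40)))) PSkip)).

(** Kept apart from [vector_codes], where bank 38, computed here, is a loop limit. *)
Definition vector_counts : prog :=
  setv 38 (NConst 1) ;; setv 63 (NConst 1) ;; color_loop ;;
  setv 28 (var 63) ;; weight_loop.

(** The length of the list to copy, in bank 67, changes during the phase; the limit is the final
    number of codes, with a guard. *)
Definition append_loop : prog :=
  PFor 44 38 0 (
    PIf (NLt (var 44) (var 67))
      (PN 36 (var 66) (NAdd (NGet 36 (var 44)) (var 68)) ;; incr 66)
      PSkip).

Definition vector_codes : prog :=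
  PN 36 (NConst 0) (NConst 0) ;;
  setv 66 (NConst 1) ;;
  PFor 23 0 1 (
    setv 67 (var 66) ;;
    setv 68 (NConst 0) ;;
    PFor 12 0 0 (
      PIf (NLt (NAdd (var 12) (NConst 1)) (NGet 61 (var 23)))
        (setv 68 (NAdd (var 68) (NGet 62 (var 23))) ;; append_loop) PSkip)) ;;
  PFor 44 38 0 (PN 37 (NGet 36 (var 44)) (NConst 1)).

Definition main_tail : prog :=
  (lim_phase ;; addr_phase) ;; (base_phase ;; dp_phase) ;;
  (best_phase ;; walk_phase ;; output_phase).

Lemma static_sort horiz : static (sort_phase horiz).
Proof. by case: horiz. Qed.
Lemma static_gcounts : static global_counts. Proof. by []. Qed.
Lemma static_gcodes : static global_codes. Proof. by []. Qed.
Lemma static_vcounts : static vector_counts. Proof. by []. Qed.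
Lemma static_vcodes : static vector_codes. Proof. by []. Qed.

Local Close Scope prog_scope.

(** * Correctness of the preparatory phases *)

Lemma count_iotaS (P : pred nat) k :
  count P (iota 0 k.+1) = count P (iota 0 k) + P k.
Proof. by rewrite -addn1 iotaD count_cat /= add0n addn0. Qed.

Section Specs.
Variables (R : realType) (n m : nat) (I : instance R n m).
Local Notation D := (minsep I).
Implicit Types s : state R.

Record input_ok s : Prop := InputOk {
  in_n : nmem s 0 0 = n;
  in_m : nmem s 0 1 = m;
  in_c : forall i : 'I_n, nmem s 1 i = pc I i;
  in_xr : rmem s 0 1 = xr I;
  in_yb : rmem s 0 2 = yb I;
  in_yt : rmem s 0 3 = yt I;
  in_D : rmem s 0 4 = D;
  in_x : forall i : 'I_n, rmem s 1 i = px I i;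
  in_y : forall i : 'I_n, rmem s 2 i = py I i }.

Lemma input_ok_agree s s' : input_ok s ->
  (forall b, b \in [:: 0; 1]%N -> nmem s' b = nmem s b) ->
  (forall b, b \in [:: 0; 1; 2]%N -> rmem s' b = rmem s b) -> input_ok s'.
Proof.
by case=> h1 h2 h3 h4 h5 h6 h7 h8 h9 hn hr; split=> [||i|||||i|i]; rewrite ?hn ?hr.
Qed.

Lemma input_ok_out (ws wr : seq nat) s s' : input_ok s ->
  (forall b, b \notin ws -> nmem s' b = nmem s b) ->
  (forall b, b \notin wr -> rmem s' b = rmem s b) ->
  all [pred b | b \notin ws] [:: 0; 1] && all [pred b | b \notin wr] [:: 0; 1; 2] ->
  input_ok s'.
Proof.
move=> inp hn hr /andP[/allP an /allP ar].
by apply: input_ok_agree inp _ _ => b hb; [apply/hn/an|apply/hr/ar].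
Qed.

Lemma input_ok_den p s : input_ok s ->
  all [pred b | b \notin nwrites p] [:: 0; 1] &&
  all [pred b | b \notin rwrites p] [:: 0; 1; 2] -> input_ok (den p s).
Proof.
by move=> inp; apply: input_ok_out inp _ _ => b; [apply: nframe|apply: rframe].
Qed.

Lemma rk_count i :
  rk I i = count (fun j => oapp (fun j' => (px I i < px I j')%R) false (insub j)) (iota 0 n).
Proof.
rewrite -val_enum_ord count_map enumT /rk cardE /enum_mem size_filter; apply: eq_count => j /=.
by rewrite valK.
Qed.

Definition sorted_at s (horiz : bool) (i : 'I_n) : Prop :=
  [/\ nmem s 10 (rk I i) = i, nmem s 11 (rk I i) = pc I i,
      rmem s 8 (rk I i) = py I i,
      rmem s 9 (rk I i) = (if horiz then xr I - px I i else 0)%R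
    & rmem s 4 i = py I i].

Lemma sort_body_spec horiz s (i : 'I_n) : input_ok s -> nmem s 12 0 = i ->
  let s' := den (sort_body horiz) s in
  sorted_at s' horiz i /\ forall j, j <> i -> rk I j <> rk I i ->
   sorted_at s horiz j -> sorted_at s' horiz j.
Proof.
move=> inp ei; rewrite /sort_body.
set loop := PFor 13 0 0 _; set rest := (_ ;; _)%prog.
set s1 := den (loop) (den (setv 14 (NConst 0)) s).
have e14 : nmem s1 14 0 = rk I i.
  rewrite rk_count.
  pose P k s' := nmem s' 14 0 = count
    (fun j => oapp (fun j' => (px I i < px I j')%R) false (insub j)) (iota 0 k).
  apply: (@for_ind _ 13 0 0 _ _ P) => //=.
    by rewrite /upd /= (in_n inp).
  move=> k s' kn ek hn hr; rewrite /P count_iotaS => IH.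
  have e12 : nmem s' 12 0 = i by rewrite hn.
  have xk : rmem s 1 k = px I (Ordinal kn) := in_x inp (Ordinal kn).
  rewrite /= hr // e12 ek (in_x inp) xk -ltNge (insubT (fun j => j < n) kn) /= -IH.
  by case: ifP => _; rewrite /upd /= ?addn0.
have fn b : b \notin [:: 13; 14] -> nmem s1 b = nmem s b.
  rewrite /s1 => hb; rewrite nframe //; apply: funext => k.
  by move: hb; rewrite !inE negb_or /= /upd => /andP[_ /negbTE ->].
have fr : rmem s1 = rmem s by apply: funext => b; rewrite /s1 rframe.
have -> : den rest s = den (PN 10 (var 14) (var 12) ;;
  PN 11 (var 14) (NGet 1 (var 12)) ;;
  PR 8 (var 14) (RGet 2 (var 12)) ;;
  PR 9 (var 14) (RSub (if horiz then RGet 0 (NConst 1) else RGet 1 (var 12))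
                      (RGet 1 (var 12))) ;;
  PR 4 (var 12) (RGet 2 (var 12)))%prog s1 by [].
clear rest; rewrite /= /upd /= e14 !fn // !fr ei (in_c inp) (in_y inp) (in_x inp).
split.
  split; rewrite /= /upd /= ?eqxx //; case: horiz => /=; first by rewrite /upd /= fr (in_xr inp).
  by rewrite /upd /= fn // ei fr (in_x inp) subrr.
move=> j /eqP nji /eqP/negbTE nr [h1 h2 h3 h4 h5].
have nji' : (nat_of_ord j == i) = false by apply/negbTE.
by split; rewrite /= /upd /= ?fn ?fr ?nr ?nji'.
Qed.

Lemma sort_phase_spec horiz s : wf_instance I -> input_ok s ->
  let s' := den (sort_phase horiz) s in
  [/\ forall i, sorted_at s' horiz i,
      (rmem s' 4 n = yb I /\ rmem s' 4 n.+1 = yt I)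
    & [/\ nmem s' 35 0 = n.+1, nmem s' 15 0 = n.+2 & nmem s' 16 0 = n + n + 1]].
Proof.
move=> wfI inp; rewrite /sort_phase.
set loop := PFor 12 0 0 _; rewrite den_seq.
have inp1 : input_ok (den loop s) by exact: input_ok_den.
have {}srt : forall i : 'I_n, sorted_at (den loop s) horiz i.
  pose P k s' := forall i : 'I_n, i < k -> sorted_at s' horiz i.
  suff hP : P n (den loop s) by move=> i; apply: hP.
  apply: for_ind => //; first exact: in_n.
  move=> k s' kn ek hn hr IH i ik.
  have inp' : input_ok s'.
    exact: input_ok_out inp hn hr _.
  have [h1 h2] := @sort_body_spec horiz s' (Ordinal kn) inp' ek.
  case: (eqVneq i (Ordinal kn)) => [->|/eqP ne]; first exact: h1.
  suff : sorted_at (den (sort_body horiz) s') horiz i by [].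
  apply: h2 => //; first by move/(rk_inj wfI).
  by apply: IH; rewrite ltn_neqAle -ltnS ik andbT; apply/eqP => e; apply: ne; apply: val_inj.
move: (den loop s) inp1 srt => s1 inp1 srt {loop}; split.
- move=> i; have [h1 h2 h3 h4 h5] := srt i.
  split => //; rewrite /= /upd /= (in_n inp1) h5 addn1.
  by rewrite (ltn_eqF (ltn_ord i)) (ltn_eqF (ltnW (ltn_ord i : i.+1 < n.+1))).
- rewrite /= /upd /= (in_n inp1) (in_yb inp1) (in_yt inp1) addn1.
  by rewrite !(ltn_eqF (ltnSn _)) !eqxx.
- by rewrite /= /upd /= (in_n inp1) addn1 addn2.
Qed.

Lemma cand_body_spec s a : input_ok s -> nmem s 16 0 = n + n + 1 ->
  nmem s 17 0 = a ->
  let p := nmem s 18 0 in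
  let s' := den cand_body s in
  [/\ nmem s' 18 0 = p + (n + n + 1),
      forall x, x < p -> rmem s' 5 x = rmem s 5 x
    & forall k, k < n + n + 1 ->
        rmem s' 5 (p + k) = (rmem s 4 a - n%:R * D + k%:R * D)%R].
Proof.
move=> inp e16 e17 p s'; rewrite /s' /cand_body !den_seq; set loop := PFor 19 _ _ _.
set s0 := den _ s.
have inp0 : input_ok s0 by exact: input_ok_den.
have [g6 g18 g16 g5] : [/\ rmem s0 6 0 = rmem s 4 a, nmem s0 18 = nmem s 18,
    nmem s0 16 = nmem s 16 & rmem s0 5 = rmem s 5].
  by split => //; rewrite /= /upd /= e17.
clearbody s0.
have [s1 [es1 e1 inp1 f1 [f2 f3]]] : exists s1,
    [/\ s1 = den (PFor 12 0 0 (setrv 6 (RSub (rvar 6) delta))) s0,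
     rmem s1 6 0 = (rmem s 4 a - n%:R * D)%R, input_ok s1,
     nmem s1 18 = nmem s 18 & nmem s1 16 = nmem s 16 /\ rmem s1 5 = rmem s 5].
  exists (den (PFor 12 0 0 (setrv 6 (RSub (rvar 6) delta))) s0); split => //.
  - pose P k s' := (rmem s' 6 0 = rmem s 4 a - k%:R * D)%R.
    apply: (@for_ind _ 12 0 0 _ _ P) => //; first exact: in_n inp0.
      by rewrite /P /= /upd /= g6 mul0r subr0.
    move=> k s2 kn ek hn hr; rewrite /P /= /upd /= => ->.
    by rewrite hr // (in_D inp0) -natr1; ring.
  - exact: input_ok_den.
  - by rewrite nframe.
  - by split; [rewrite nframe // g16|rewrite rframe // g5].
rewrite -es1 {es1}.
pose P k s' := [/\ nmem s' 18 0 = p + k,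
  rmem s' 6 0 = (rmem s 4 a - n%:R * D + k%:R * D)%R,
  forall x, x < p -> rmem s' 5 x = rmem s 5 x
  & forall k', k' < k ->
        rmem s' 5 (p + k') = (rmem s 4 a - n%:R * D + k'%:R * D)%R].
suff [] : P (n + n + 1) (den loop s1) by [].
apply: (@for_ind _ 19 16 0 _ _ P) => //; first by rewrite f2.
  split => //=; first by rewrite /upd /= f1 addn0.
    by rewrite e1 mul0r addr0.
  by rewrite f3.
move=> k s2 kn ek hn hr [h1 h2 h3 h4]; split => /=; rewrite /upd /=.
- by rewrite h1 addn1 addnS.
- by rewrite h2 hr //= (in_D inp1) -natr1; ring.
- by move=> x xp; rewrite h1 ltn_eqF ?h3 // ltn_addr.
- move=> k'; rewrite ltnS leq_eqVlt h1 eqn_add2l => /orP[/eqP ->|lt].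
    by rewrite eqxx h2.
  by rewrite (ltn_eqF lt) h4.
Qed.

(** The n points and the two sides, each with the offsets from -n to n, and the two outer
    backbones. *)
Definition ncand := (n + 2) * (n + n + 1) + 2.

Record cands s : Prop := Cands {
  cd_n : nmem s 20 0 = ncand;
  cd_bot : rmem s 5 0 = (yb I - D)%R;
  cd_top : rmem s 5 1 = (yt I + D)%R;
  cd_pos : forall a k, a < n + 2 -> k < n + n + 1 ->
    rmem s 5 (2 + a * (n + n + 1) + k) = (rmem s 4 a - n%:R * D + k%:R * D)%R }.

Lemma cand_phase_spec s : input_ok s -> nmem s 15 0 = n.+2 ->
  nmem s 16 0 = n + n + 1 -> cands (den cand_phase s).
Proof.
move=> inp e15 e16; rewrite /cand_phase.
pose P a s' := [/\ nmem s' 18 0 = 2 + a * (n + n + 1),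
  rmem s' 5 0 = (yb I - D)%R, rmem s' 5 1 = (yt I + D)%R &
  forall a' k, a' < a -> k < n + n + 1 ->
    rmem s' 5 (2 + a' * (n + n + 1) + k) = (rmem s 4 a' - n%:R * D + k%:R * D)%R].
rewrite !den_seq; set s1 := den (setv 18 (NConst 2)) _.
have inp1 : input_ok s1 by do 3!apply: input_ok_den => //.
suff hP : P n.+2 (den (PFor 17 15 0 cand_body) s1).
  have f4 : rmem (den (PFor 17 15 0 cand_body) s1) 4 = rmem s 4 by rewrite rframe.
  move: hP f4; move: (den (PFor 17 15 0 cand_body) s1) => s2 [h1 h2 h3 h4] f4.
  split; rewrite /= /upd /= ?h1 ?h2 ?h3 ?f4 //; first by rewrite /ncand; lia.
  by move=> a k; rewrite addn2; apply: h4.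
apply: (@for_ind _ 17 15 0 _ _ P) => //.
  by split => //=; rewrite /upd /= ?(in_yb inp) ?(in_yt inp) (in_D inp).
move=> a s2 an ea hn hr [h1 h2 h3 h4].
have inp2 : input_ok s2 by exact: input_ok_out inp1 hn hr _.
have [] := @cand_body_spec s2 a inp2 _ ea; first by rewrite hn // -e16.
rewrite h1 => g1 g2 g3.
have e4 : rmem s2 4 = rmem s 4 by rewrite hr.
rewrite e4 in g3; split.
- rewrite [LHS]g1; lia.
- by rewrite [LHS]g2.
- by rewrite [LHS]g2.
- move=> a' k; rewrite ltnS leq_eqVlt => /orP[/eqP ->|lt] kW; first exact: g3.
  rewrite [LHS]g2 ?h4 // -addnA ltn_add2l.
  have : a'.+1 * (n + n + 1) <= a * (n + n + 1) by rewrite leq_mul2r lt orbT.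
  by rewrite mulSn; lia.
Qed.

End Specs.

Lemma flat_eq W a b c d : b < W -> d < W ->
  (a * W + b == c * W + d) = (a == c) && (b == d).
Proof.
move=> bW dW; apply/eqP/andP => [e|[/eqP -> /eqP ->] //].
have W0 : 0 < W by apply: leq_ltn_trans bW.
have e1 := congr1 (fun x => x %/ W) e; have e2 := congr1 (fun x => x %% W) e.
by move: e1 e2; rewrite /= !divnMDl // !modnMDl !divn_small ?modn_small // !addn0 => -> ->.
Qed.

Section Specs.
Variables (R : realType) (n m : nat) (I : instance R n m).
Implicit Types s : state R.

Record types_ok (N : nat) s : Prop := TypesOk {
  ty_n : nmem s 25 0 = N * m;
  ty_base : forall r, r < N -> nmem s 21 r = r * m;
  ty_pos : forall r c, r < N -> c < m -> rmem s 7 (r * m + c) = rmem s 5 r;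
  ty_col : forall r c, r < N -> c < m -> nmem s 24 (r * m + c) = c }.

Lemma type_body_spec s r : input_ok I s -> nmem s 22 0 = r ->
  nmem s 18 0 = r * m ->
  let s' := den type_body s in
  [/\ nmem s' 18 0 = r.+1 * m,
     forall x, nmem s' 21 x = if x == r then r * m else nmem s 21 x,
     forall x, x < r * m -> rmem s' 7 x = rmem s 7 x /\ nmem s' 24 x = nmem s 24 x
   & forall c, c < m -> rmem s' 7 (r * m + c) = rmem s 5 r /\
                        nmem s' 24 (r * m + c) = c].
Proof.
move=> inp e22 e18 s'; rewrite /s' /type_body den_seq; set s0 := den _ s.
set loop := PFor _ _ _ _.
have inp0 : input_ok I s0 by exact: input_ok_den.
have [f18 f21 f24 [f22 [f5 f7]]] : [/\ nmem s0 18 0 = r * m,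
    forall x, nmem s0 21 x = if x == r then r * m else nmem s 21 x,
    nmem s0 24 = nmem s 24 & nmem s0 22 0 = r /\ rmem s0 5 = rmem s 5 /\
    rmem s0 7 = rmem s 7].
  by split => // x; rewrite /= /upd /= e22 e18.
clearbody s0.
pose P c s1 := [/\ nmem s1 18 0 = r * m + c,
     forall x, nmem s1 21 x = if x == r then r * m else nmem s 21 x,
     forall x, x < r * m -> rmem s1 7 x = rmem s 7 x /\ nmem s1 24 x = nmem s 24 x
   & forall c', c' < c -> rmem s1 7 (r * m + c') = rmem s 5 r /\
                        nmem s1 24 (r * m + c') = c'].
suff : P m (den loop s0) by rewrite /P mulSn addnC.
apply: (@for_ind _ 23 0 1 _ _ P) => //; first exact: in_m inp0.
  by split => //; [rewrite addn0|rewrite /= f7 /upd /= f24].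
move=> c s1 cm ec hn hr [h1 h2 h3 h4]; split => //=; rewrite /upd /=.
- by rewrite h1 addn1 addnS.
- move=> x hx; rewrite h1 ltn_eqF ?ltn_addr //; exact: h3.
- move=> c'; rewrite ltnS leq_eqVlt h1 eqn_add2l => /orP[/eqP ->|lt].
    by rewrite eqxx hr // hn // f22 f5 ec.
  by rewrite (ltn_eqF lt); apply: h4.
Qed.

Lemma type_phase_spec N s : input_ok I s -> nmem s 20 0 = N ->
  types_ok N (den type_phase s).
Proof.
move=> inp e20; rewrite /type_phase !den_seq; set s0 := den _ s.
have inp0 : input_ok I s0 by exact: input_ok_den.
have [f18 f20 f5] : [/\ nmem s0 18 0 = 0, nmem s0 20 0 = N & rmem s0 5 = rmem s 5].
  by split.
clearbody s0.
pose P k s1 := [/\ nmem s1 18 0 = k * m, forall r, r < k -> nmem s1 21 r = r * m,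
  forall r c, r < k -> c < m -> rmem s1 7 (r * m + c) = rmem s 5 r &
  forall r c, r < k -> c < m -> nmem s1 24 (r * m + c) = c].
suff hP : P N (den (PFor 22 20 0 type_body) s0).
  have e5 : rmem (den (PFor 22 20 0 type_body) s0) 5 = rmem s 5 by rewrite rframe.
  move: hP e5; move: (den _ s0) => s1 [h1 h2 h3 h4] e5.
  by split; rewrite /= /upd //= e5.
apply: (@for_ind _ 22 20 0 _ _ P) => //.
move=> k s1 kN ek hn hr [h1 h2 h3 h4].
have inp1 : input_ok I s1 by exact: input_ok_out inp0 hn hr _.
have [] := type_body_spec inp1 ek h1.
have lower r c : r < k -> c < m -> r * m + c < k * m.
  move=> rk cm; apply: (@leq_trans (r.+1 * m)); first by rewrite mulSn addnC ltn_add2r.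
  by rewrite leq_mul2r rk orbT.
move=> g1 g2 g3 g4; split => //.
- move=> r; rewrite ltnS leq_eqVlt [nmem _ _ _]g2 => /orP[/eqP ->|lt].
    by rewrite eqxx.
  by rewrite (ltn_eqF lt) h2.
- move=> r c; rewrite ltnS leq_eqVlt => /orP[/eqP ->|lt] cm.
    by have [-> _] := g4 c cm; rewrite hr // f5.
  by have [-> _] := g3 _ (lower _ _ lt cm); apply: h3.
- move=> r c; rewrite ltnS leq_eqVlt => /orP[/eqP ->|lt] cm.
    by have [_ e] := g4 c cm; exact: e.
  by have [_ e] := g3 _ (lower _ _ lt cm); rewrite [LHS]e; apply: h4.
Qed.

Lemma beval_close s y p : input_ok I s ->
  beval s (close y p) = ~~ (minsep I <= `|reval s y - reval s p|)%R.
Proof. by move=> inp; rewrite far_cases /= (in_D inp) negb_or. Qed.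

Definition far_after s (x k q : nat) : Prop := forall y, k < y -> y < x ->
  (minsep I <= `|rmem s 8 y - rmem s 7 q|)%R.

Lemma lim_body_spec s q : input_ok I s -> nmem s 41 0 = q ->
  let s' := den lim_body s in
  (forall x, x <> q -> nmem s' 26 x = nmem s 26 x) /\
  (forall k, nmem s' 26 q <= k.+1 <-> far_after s n k q).
Proof.
move=> inp e41 s'; rewrite /s' /lim_body den_seq; set s0 := den _ s.
set loop := PFor _ _ _ _.
have inp0 : input_ok I s0 by exact: input_ok_den.
have [f1 f2 [f3 [f4 f5]]] : [/\ nmem s0 26 q = 0,
    forall x, x <> q -> nmem s0 26 x = nmem s 26 x &
    nmem s0 41 0 = q /\ rmem s0 8 = rmem s 8 /\ rmem s0 7 = rmem s 7].
  split => //; first by rewrite /= /upd /= e41 eqxx.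
  by move=> x /eqP/negbTE h; rewrite /= /upd /= e41 h.
clearbody s0.
pose P y s1 := (forall x, x <> q -> nmem s1 26 x = nmem s 26 x) /\
  (forall k, nmem s1 26 q <= k.+1 <-> far_after s y k q).
suff : P n (den loop s0) by [].
apply: (@for_ind _ 27 0 0 _ _ P) => //; first exact: in_n inp0.
  by split => // k; rewrite /= /upd /= f1.
move=> x s1 xn ex hn hr [h1 h2].
have inp1 : input_ok I s1 by exact: input_ok_out inp0 hn hr _.
have e41' : nmem s1 41 0 = q by rewrite hn.
have e8 : rmem s1 8 = rmem s 8 by rewrite hr.
have e7 : rmem s1 7 = rmem s 7 by rewrite hr.
rewrite /P den_if beval_close // [reval s1 _]/= [reval s1 (RGet 7 _)]/=.
rewrite e41' ex e8 e7; case: ifP => c.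
  split.
    by move=> y ny; rewrite /= /upd /= e41'; move/eqP/negbTE: (ny) => ->; apply: h1.
  move=> k; rewrite /= /upd /= e41' eqxx ex addn1; split.
    move=> xk y ky; rewrite ltnS => yx; lia.
  move=> h; case: (leqP x k) => // kx; move: c.
  by rewrite h.
split => // k; rewrite /= /upd /=; rewrite h2; split.
  move=> h y ky; rewrite ltnS leq_eqVlt => /orP[/eqP ->|]; last exact: h.
  by apply/negPn; rewrite c.
by move=> h y ky yx; apply: h => //; apply: ltnW.
Qed.

Lemma lim_phase_spec Q s : input_ok I s -> nmem s 25 0 = Q ->
  let s' := den lim_phase s in
  forall k q, q < Q ->
    (nmem s' 26 q <= k.+1) = clear n (minsep I) (rmem s 8) (rmem s 7) k q.
Proof.
move=> inp e25; rewrite /lim_phase.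
pose P x s1 := forall q, q < x -> forall k,
   nmem s1 26 q <= k.+1 <-> far_after s n k q.
suff hP : P Q (den (PFor 41 25 0 lim_body) s).
  move=> k q qQ; apply/idP/clearP => [|h].
    by move/(hP q qQ k) => h y /andP[]; apply: h.
  by apply/(hP q qQ k) => y ky yn; apply: h; rewrite ky.
apply: (@for_ind _ 41 25 0 _ _ P) => //.
move=> x s1 xQ ex hn hr IH q qx k.
have inp1 : input_ok I s1 by exact: input_ok_out inp hn hr _.
have [g1 g2] := lim_body_spec inp1 ex.
have e8 : rmem s1 8 = rmem s 8 by rewrite hr.
have e7 : rmem s1 7 = rmem s 7 by rewrite hr.
have fe y : far_after s1 n k y <-> far_after s n k y by rewrite /far_after e8 e7.
move: qx; rewrite ltnS leq_eqVlt => /orP[/eqP ->|lt].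
  by rewrite -fe; apply: g2.
by have /g1 e : q <> x by [lia]; rewrite [nmem _ _ _]e; apply: IH.
Qed.

Lemma multiples_spec arr v limit L A s step :
  v \notin [:: arr; 32] -> limit \notin [:: arr; 32; v] -> arr != 32 ->
  nmem s limit 0 = L ->
  (forall s', (forall b, b \notin v :: [:: 32; arr; 32] -> nmem s' b = nmem s b) ->
     neval s' step = A) ->
  let s' := den (multiples arr v limit step) s in
  nmem s' 32 0 = L * A /\ forall x, x < L -> nmem s' arr x = x * A.
Proof.
move=> vn ln an eL eA; rewrite /multiples den_seq; set s0 := den _ s.
have f32 : nmem s0 32 0 = 0 by [].
have f0 b : b != 32 -> nmem s0 b = nmem s b.
  by move=> /negbTE h; apply: funext => i; rewrite /s0 /= /upd h.
have e0 : nmem s0 limit 0 = L.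
  by rewrite f0 //; apply: contraNneq ln => ->; rewrite !inE eqxx ?orbT.
clearbody s0.
pose P x s1 := nmem s1 32 0 = x * A /\ forall y, y < x -> nmem s1 arr y = y * A.
apply: (@for_ind _ v limit 0 _ _ P) => //.
  by split => //; rewrite /= /upd; case: eqP => // e; rewrite -e !inE eqxx orbT in vn.
move=> x s1 xL ex hn hr [h1 h2].
have v32 : (32 == v) = false.
  by apply/negbTE; apply: contraNneq vn => ->; rewrite !inE eqxx ?orbT.
have va : (arr == v) = false.
  by apply/negbTE; apply: contraNneq vn => ->; rewrite !inE eqxx ?orbT.
have e32 : (32 == arr) = false by rewrite eq_sym (negbTE an).
rewrite den_seq; set s2 := den (PN arr _ _) s1.
have f2 b i : nmem s2 b i = if (b == arr) && (i == x) then x * A else nmem s1 b i.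
  by rewrite /s2 [den _ s1]/= nmem_setn ex h1.
clearbody s2.
rewrite /P; split.
  rewrite nmem_setn v32 [den _ s2]/= nmem_setn /=.
  rewrite f2 e32 h1 mulSn addnC; congr (_ + _); apply: eA => b.
  rewrite !inE !negb_or => /andP[b1 /andP[b2 /andP[b3 _]]].
  apply: funext => i; rewrite f2 (negbTE b3) /=.
  by rewrite hn ?f0 // !inE !negb_or b1 b2 b3.
move=> y; rewrite nmem_setn va andFb [den _ s2]/= nmem_setn (negbTE an) andFb f2 eqxx andTb ltnS leq_eqVlt.
move=> /orP[/eqP ->|lt]; first by rewrite eqxx.
by rewrite (ltn_eqF lt) h2.
Qed.

Record addr_ok (Q B : nat) s : Prop := AddrOk {
  ad_x : forall x, x < n.+1 -> nmem s 31 x = x * (Q * (Q * B));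
  ad_a : forall q, q < Q -> nmem s 29 q = q * (Q * B);
  ad_b : forall q, q < Q -> nmem s 30 q = q * B }.

Lemma addr_phase_spec Q B s : nmem s 25 0 = Q -> nmem s 28 0 = B ->
  nmem s 35 0 = n.+1 -> addr_ok Q B (den addr_phase s).
Proof.
move=> e25 e28 e35; rewrite /addr_phase.
set m1 := multiples 30 _ _ _; set m2 := multiples 29 _ _ _; set m3 := multiples 31 _ _ _.
rewrite (den_seq m1) (den_seq (setv 33 _)) (den_seq m2) (den_seq (setv 34 _)).
have [] // := @multiples_spec 30 41 25 Q B s (var 28).
  by move=> s' h; rewrite /= h.
rewrite -/m1; set s1 := den m1 s => a1 a2.
have b25 : nmem s1 25 0 = Q by rewrite nframe.
have b35 : nmem s1 35 0 = n.+1 by rewrite nframe.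
clearbody s1; set s2 := den (setv 33 _) s1.
have [c33 c25 c35 c30] : [/\ nmem s2 33 0 = Q * B, nmem s2 25 0 = Q,
  nmem s2 35 0 = n.+1 & nmem s2 30 = nmem s1 30] by split.
clearbody s2.
have [] // := @multiples_spec 29 41 25 Q (Q * B) s2 (var 33).
  by move=> s' h; rewrite /= h.
rewrite -/m2; have d30 : nmem (den m2 s2) 30 = nmem s1 30 by rewrite nframe.
have d35 : nmem (den m2 s2) 35 0 = n.+1 by rewrite nframe.
move: (den m2 s2) d30 d35 => s3 d30 d35 a3 a4.
set s4 := den (setv 34 _) s3.
have [e34 e35' e30 e29] : [/\ nmem s4 34 0 = Q * (Q * B), nmem s4 35 0 = n.+1,
  nmem s4 30 = nmem s1 30 & nmem s4 29 = nmem s3 29] by split.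
clearbody s4.
have [] // := @multiples_spec 31 40 35 n.+1 (Q * (Q * B)) s4 (var 34).
  by move=> s' h; rewrite /= h.
rewrite -/m3 => _ a5; split => //.
- by move=> q qQ; rewrite nframe // e29; apply: a4.
- by move=> q qQ; rewrite nframe // e30; apply: a2.
Qed.

End Specs.

(** * Codes of the numbers of labels *)

Section Specs.
Variables (R : realType) (n m : nat) (I : instance R n m).
Implicit Types s : state R.

(** Common to both versions: [V] lists the codes kept, [B] bounds them strictly and is the stride
    below the last index of the table, and [w k] is what a label with leftmost point [k] adds to the
    code. *)
Record codes_ok (V : seq nat) (B : nat) (w : nat -> nat) s : Prop := CodesOk {
  co_size : nmem s 38 0 = size V;
  co_vec : forall t, t < size V -> nmem s 36 t = nth 0 V t;
  co_val : forall j, nmem s 37 j = (j \in V);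
  co_bound : forall j, j \in V -> j < B;
  co_B : nmem s 28 0 = B;
  co_w : forall k, k < n -> nmem s 39 k = w k }.

Lemma mark_spec V s p : nmem s 38 0 = size V ->
  (forall t, t < size V -> nmem s 36 t = nth 0 V t) ->
  (forall j, nmem s 37 j = 0) ->
  p = PFor 44 38 0 (PN 37 (NGet 36 (var 44)) (NConst 1)) ->
  forall j, nmem (den p s) 37 j = (j \in V).
Proof.
move=> e38 e36 e37 ->.
pose P t s1 := forall j, nmem s1 37 j = (j \in take t V).
suff : P (size V) (den (PFor 44 38 0 (PN 37 (NGet 36 (var 44)) (NConst 1))) s).
  by rewrite /P take_size.
apply: (@for_ind _ 44 38 0 _ _ P) => //.
  by move=> j; rewrite take0 /= /upd /= e37.
move=> t s1 tV et hn hr IH j; rewrite (take_nth 0) // mem_rcons inE.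
rewrite /= /upd /= et hn // e36 // IH.
by case: eqP.
Qed.

Lemma global_codes_spec K s : input_ok I s -> nmem s 0 2 = K ->
  (forall j, nmem s 37 j = 0) ->
  codes_ok (iota 0 K.+1) K.+1 (fun=> 1) (den global_codes (den global_counts s)).
Proof.
move=> inp eK e37; set s0 := den global_counts s.
have inp0 : input_ok I s0 by exact: input_ok_den.
have [f38 f37] : nmem s0 38 0 = K.+1 /\ nmem s0 37 = nmem s 37.
  by split => //; rewrite /= /upd /= eK addn1.
clearbody s0; rewrite /global_codes; set l1 := PFor _ _ _ _; set l2 := PFor _ _ _ _.
rewrite !den_seq.
have [g1 g2] : (forall t, t < K.+1 -> nmem (den l1 s0) 36 t = t) /\
    (forall j, nmem (den l1 s0) 37 j = (j < K.+1)).
  pose P t s1 := (forall i, i < t -> nmem s1 36 i = i) /\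
    (forall j, nmem s1 37 j = (j < t)).
  suff : P K.+1 (den l1 s0) by [].
  apply: (@for_ind _ 44 38 0 _ _ P) => //.
    by split => // j; rewrite /= /upd /= f37 e37.
  move=> t s1 tK et hn hr [h1 h2]; split => [i|j].
    rewrite ltnS leq_eqVlt /= /upd /= et => /orP[/eqP ->|lt]; first by rewrite eqxx.
    by rewrite (ltn_eqF lt) h1.
  rewrite ltnS leq_eqVlt /= /upd /= et h2.
  by case: eqP.
have g3 k : k < n -> nmem (den l2 (den l1 s0)) 39 k = 1.
  have e0 : nmem (den l1 s0) 0 0 = n by rewrite nframe // (in_n inp0).
  pose P t s1 := forall i, i < t -> nmem s1 39 i = 1.
  suff : P n (den l2 (den l1 s0)) by apply.
  apply: (@for_ind _ 40 0 0 _ _ P) => //.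
  move=> t s1 tK et hn hr h1 i; rewrite ltnS leq_eqVlt /= /upd /= et.
  by case: eqP => // _ /= /h1.
split.
- by rewrite size_iota !nframe.
- by move=> t; rewrite size_iota => tK; rewrite nframe // nframe // nth_iota // g1.
- by move=> j; rewrite nframe // nframe // g2 mem_iota.
- by move=> j; rewrite mem_iota.
- have -> : nmem (den (setv 28 (var 38)) (den l2 (den l1 s0))) 28 0 =
    nmem (den l2 (den l1 s0)) 38 0 by [].
  by rewrite !nframe.
- by move=> k kn; rewrite nframe // g3.
Qed.

Definition radix (c : nat) : nat := n.+1 ^ c.

(* The label of the leftmost point of each color is not counted: the digit of
   color c is then less than k_c, so that at most \prod_c k_c codes occur. *)
Definition first_weight (C : nat -> nat) (k : nat) : nat :=
  if has (fun y => (k < y) && (C y == C k)) (iota 0 n) then radix (C k) else 0.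

Section Vector.
Variables (kv C : nat -> nat).

(** A color has at most n labels, whatever its bound; the minimum keeps the digits below the radix n
    + 1. *)
Definition cap (c : nat) : nat := minn (kv c) n.

Fixpoint vecs (c : nat) : seq nat :=
  if c is c'.+1 then
    flatten [seq [seq v + r * radix c' | v <- vecs c'] | r <- iota 0 (cap c')]
  else [:: 0].

Lemma size_vecs c : size (vecs c) = \prod_(e < c) cap e.
Proof.
elim: c => [|c IHc]; first by rewrite big_ord0.
rewrite big_ord_recr /= -IHc size_flatten /shape -map_comp.
rewrite (eq_map (_ : _ =1 fun=> size (vecs c))); last by move=> r /=; rewrite size_map.
by rewrite sumnE big_map big_const_seq count_predT size_iota iter_addn_0.
Qed.

Lemma vecsP c j : reflect (exists2 d : nat -> nat,
    forall e, e < c -> d e < cap e & j = \sum_(e < c) d e * radix e)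
  (j \in vecs c).
Proof.
elim: c j => [|c IHc] j.
  rewrite inE; apply: (iffP eqP) => [->|[d _ ->]]; last by rewrite big_ord0.
  by exists (fun=> 0) => //; rewrite big_ord0.
apply: (iffP flatten_mapP) => [[r]|[d dc ->]].
  rewrite mem_iota add0n => /= rc /mapP[v /IHc[d dc ->] ->].
  exists (fun e => if e == c then r else d e).
    move=> e; rewrite ltnS leq_eqVlt; case: eqP => [-> //|_ /=]; exact: dc.
  rewrite big_ord_recr /= eqxx; congr (_ + _); apply: eq_bigr => e _.
  by rewrite (ltn_eqF (ltn_ord e)).
exists (d c); first by rewrite mem_iota dc /=.
rewrite big_ord_recr /=; apply: map_f; apply/IHc; exists d => // e ec.
by apply: dc; apply: ltnW.
Qed.

Lemma vecs_lt c j : j \in vecs c -> j < radix c.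
Proof.
elim: c j => [|c IHc] j; first by rewrite inE => /eqP ->.
case/flatten_mapP => r; rewrite mem_iota add0n => /= rc /mapP[v /IHc vc ->].
rewrite /radix expnS -/(radix c).
have : r < n by apply: leq_trans rc _; exact: geq_minr.
move=> rn; apply: leq_trans (_ : r.+1 * radix c <= _).
  by rewrite mulSn ltn_add2r.
by rewrite leq_mul2r (leqW rn) orbT.
Qed.

Record counts_ok s : Prop := CountsOk {
  ct_cap : forall c, c < m -> nmem s 61 c = cap c;
  ct_radix : forall c, c < m -> nmem s 62 c = radix c;
  ct_prod : nmem s 38 0 = \prod_(e < m) cap e;
  ct_big : nmem s 28 0 = radix m;
  ct_w : forall k, k < n -> nmem s 39 k = first_weight C k }.

Lemma color_loop_spec s : input_ok I s -> nmem s 63 0 = 1 -> nmem s 38 0 = 1 ->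
  (forall c, nmem s 2 c = kv c) ->
  let s' := den color_loop s in
  [/\ nmem s' 63 0 = radix m, nmem s' 38 0 = \prod_(e < m) cap e,
    forall c, c < m -> nmem s' 61 c = cap c
  & forall c, c < m -> nmem s' 62 c = radix c].
Proof.
move=> inp e63 e38 e2.
rewrite /color_loop; set body := (PIf _ _ _ ;; _)%prog.
pose P c s1 := [/\ nmem s1 63 0 = radix c, nmem s1 38 0 = \prod_(e < c) cap e,
    forall c', c' < c -> nmem s1 61 c' = cap c'
  & forall c', c' < c -> nmem s1 62 c' = radix c'].
suff : P m (den (PFor 23 0 1 body) s) by [].
apply: (@for_ind _ 23 0 1 _ _ P) => //; first exact: in_m inp.
  by split => //; rewrite /= /upd /= ?e63 ?e38 // big_ord0.
move=> c s1 cm ec hn hr [h1 h2 h3 h4].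
have inp1 : input_ok I s1 by exact: input_ok_out inp hn hr _.
rewrite /body (den_seq (PIf _ _ _)) (den_seq (PN 62 _ _)) (den_seq (setv 64 _))
  (den_seq (setv 65 _)) (den_seq (PFor _ _ _ _)) (den_seq (setv 63 _)).
set s2 := den (setv 65 _) _.
have inp2 : input_ok I s2 by rewrite /s2; do 4!apply: input_ok_den => //.
have [g61 g62 g63 [g64 g65 g38 g23]] : [/\
    forall x, nmem s2 61 x = if x == c then cap c else nmem s1 61 x,
    forall x, nmem s2 62 x = if x == c then radix c else nmem s1 62 x,
    nmem s2 63 0 = radix c & [/\ nmem s2 64 0 = 0, nmem s2 65 0 = 0,
    nmem s2 38 0 = nmem s1 38 0 & nmem s2 23 0 = c]].
  have e2' : nmem s1 2 c = kv c by rewrite hn // e2.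
  rewrite /s2 /= ec e2' (in_n inp1); case: (leqP (kv c) n) => kn.
    have ck : cap c = kv c by rewrite /cap; apply/minn_idPl.
    by split; [move=> x|move=> x| |split]; rewrite /= /upd /= ?ec ?h1 ?ck.
  have ck : cap c = n by rewrite /cap; apply/minn_idPr/ltnW.
  by split; [move=> x|move=> x| |split]; rewrite /= /upd /= ?ec ?h1 ?ck.
clearbody s2; set l := PFor 12 0 0 _.
have [k64 k65] : nmem (den l s2) 64 0 = cap c * nmem s1 38 0 /\
    nmem (den l s2) 65 0 = n * radix c.
  pose P' i s' := nmem s' 64 0 = minn i (cap c) * nmem s1 38 0 /\
    nmem s' 65 0 = i * radix c.
  have : P' n (den l s2).
    apply: (@for_ind _ 12 0 0 _ _ P') => //; first exact: in_n inp2.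
      by split; rewrite ?min0n /= /upd //= ?g64 ?g65.
    move=> i s3 kn ei hn' hr' [p1 p2].
    have q23 : nmem s3 23 0 = c by rewrite hn'.
    have q38 : nmem s3 38 0 = nmem s1 38 0 by rewrite hn' // g38.
    have q63 : nmem s3 63 0 = radix c by rewrite hn' // g63.
    have q61 : nmem s3 61 c = cap c by rewrite hn' // g61 eqxx.
    rewrite /P' /= /upd /= q23 q61 ei -ltnNge.
    case: ltnP => lt; rewrite /= /upd /= ?p1 p2 ?q38 q63; split; try by rewrite mulSn addnC.
      by rewrite (minn_idPl (ltnW lt)) (minn_idPl lt) mulSn addnC.
    by rewrite (minn_idPr lt) (minn_idPr (leqW lt)).
  by case=> -> ->; split => //; rewrite /cap (minn_idPr (geq_minr (kv c) n)).
have k61 : nmem (den l s2) 61 = nmem s2 61 by rewrite nframe.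
have k62 : nmem (den l s2) 62 = nmem s2 62 by rewrite nframe.
have k63 : nmem (den l s2) 63 = nmem s2 63 by rewrite nframe.
move: (den l s2) k64 k65 k61 k62 k63 => s3 k64 k65 k61 k62 k63.
split; rewrite /= /upd /=.
- by rewrite k65 k63 g63 /radix expnS mulSn addnC.
- by rewrite k64 h2 big_ord_recr /= mulnC.
- move=> c'; rewrite k61 g61 ltnS leq_eqVlt; case: eqP => [-> //|_ /= lt].
  exact: h3.
- move=> c'; rewrite k62 g62 ltnS leq_eqVlt; case: eqP => [-> //|_ /= lt].
  exact: h4.
Qed.

Lemma weight_loop_spec s : input_ok I s -> (forall k, nmem s 11 k = C k) ->
  (forall k, k < n -> C k < m) -> (forall c, c < m -> nmem s 62 c = radix c) ->
  let s' := den weight_loop s in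
  forall k, k < n -> nmem s' 39 k = first_weight C k.
Proof.
move=> inp e11 Cm e62; rewrite /weight_loop; set body := (PN _ _ _ ;; _)%prog.
pose P k s1 := forall i, i < k -> nmem s1 39 i = first_weight C i.
suff : P n (den (PFor 40 0 0 body) s) by [].
apply: (@for_ind _ 40 0 0 _ _ P) => //; first exact: in_n inp.
move=> k s1 kn ek hn hr IH.
have inp1 : input_ok I s1 by exact: input_ok_out inp hn hr _.
rewrite /body (den_seq (PN 39 _ _)); set s2 := den (PN 39 _ _) s1.
have inp2 : input_ok I s2 by exact: input_ok_den.
have [f39 f40 f11 f62] : [/\ forall x, nmem s2 39 x = if x == k then 0 else nmem s1 39 x,
   nmem s2 40 0 = k, nmem s2 11 = nmem s 11 & nmem s2 62 = nmem s 62].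
  split => //; first by move=> x; rewrite /= /upd /= ek.
  - by rewrite -(hn 11).
  - by rewrite -(hn 62).
clearbody s2.
pose P' y s3 := forall x, nmem s3 39 x = if x == k then
  (if has (fun y => (k < y) && (C y == C k)) (iota 0 y) then radix (C k) else 0)
  else nmem s1 39 x.
set l := PFor 27 0 0 _.
have hP : P' n (den l s2).
  apply: (@for_ind _ 27 0 0 _ _ P') => //; first exact: in_n inp2.
  move=> y s3 yn ey hn' hr' h x.
  have q40 : nmem s3 40 0 = k by rewrite hn'.
  have q11 z : nmem s3 11 z = C z by rewrite hn' // f11.
  have q62 : nmem s3 62 (C k) = radix (C k) by rewrite hn' // f62 e62 // Cm.
  have -> : iota 0 y.+1 = iota 0 y ++ [:: y] by rewrite -addn1 iotaD.
  rewrite has_cat den_if [has _ [:: y]]/= orbF.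
  have -> : beval s3 (BAnd (NLt (var 40) (var 27))
      (NEq (NGet 11 (var 27)) (NGet 11 (var 40)))) = (k < y) && (C y == C k).
    by rewrite /= ey q40 !q11 -ltnNge eqn_leq.
  case: ifP => c; rewrite /= /upd /= ?q40 ?q11 ?q62.
    by rewrite h orbT; case: eqP.
  by rewrite h orbF.
move=> i; rewrite ltnS leq_eqVlt nmem_setn /= hP.
by case: eqP => [-> //|_ /= /IH].
Qed.

Lemma vector_counts_spec s : input_ok I s -> (forall k, nmem s 11 k = C k) ->
  (forall k, k < n -> C k < m) -> (forall c, nmem s 2 c = kv c) ->
  counts_ok (den vector_counts s).
Proof.
move=> inp e11 Cm e2; rewrite /vector_counts.
rewrite (den_seq (setv 38 _)) (den_seq (setv 63 _)) (den_seq color_loop)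
  (den_seq (setv 28 _)).
set s0 := den (setv 63 _) _.
have inp0 : input_ok I s0 by rewrite /s0; do 2!apply: input_ok_den => //.
have [f63 f38 f2 f11] : [/\ nmem s0 63 0 = 1, nmem s0 38 0 = 1, nmem s0 2 = nmem s 2
  & nmem s0 11 = nmem s 11] by [].
clearbody s0.
have [|h1 h2 h3 h4] := color_loop_spec inp0 f63 f38; first by move=> c; rewrite f2.
have k11 : nmem (den color_loop s0) 11 = nmem s 11 by rewrite nframe.
have inp1 : input_ok I (den color_loop s0) by exact: input_ok_den.
move: (den color_loop s0) h1 h2 h3 h4 k11 inp1 => s1 h1 h2 h3 h4 k11 inp1.
set s2 := den (setv 28 _) s1.
have inp2 : input_ok I s2 by exact: input_ok_den.
have [g61 g62 g38 [g28 g11]] : [/\ nmem s2 61 = nmem s1 61, nmem s2 62 = nmem s1 62,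
  nmem s2 38 = nmem s1 38 & nmem s2 28 0 = radix m /\ nmem s2 11 = nmem s1 11] by [].
clearbody s2; split.
- by move=> c cm; rewrite nframe // g61 h3.
- by move=> c cm; rewrite nframe // g62 h4.
- by rewrite nframe // g38.
- by rewrite nframe.
- apply: weight_loop_spec => //; first by move=> k; rewrite g11 k11.
  by move=> c cm; rewrite g62 h4.
Qed.

Definition holds_list s (l : seq nat) : Prop :=
  nmem s 66 0 = size l /\ forall t, t < size l -> nmem s 36 t = nth 0 l t.

Lemma append_loop_spec s l lo off N : holds_list s l -> nmem s 38 0 = N ->
  nmem s 67 0 = lo -> nmem s 68 0 = off -> lo <= size l -> lo <= N ->
  let s' := den append_loop s in
  holds_list s' (l ++ [seq nth 0 l t + off | t <- iota 0 lo]).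
Proof.
move=> [h1 h2] e38 e67 e68 lol loN.
pose P t s1 := holds_list s1 (l ++ [seq nth 0 l t + off | t <- iota 0 (minn t lo)]).
suff : P N (den append_loop s) by rewrite /P (minn_idPr loN).
apply: (@for_ind _ 44 38 0 _ _ P) => //.
  by rewrite /P min0n cats0.
move=> t s1 tN et hn hr [g1 g2].
have q67 : nmem s1 67 0 = lo by rewrite hn.
have q68 : nmem s1 68 0 = off by rewrite hn.
rewrite /P den_if [beval _ _]/= et q67 -ltnNge; case: ltnP => lt; last first.
  by move: g1 g2; rewrite (minn_idPr lt) (minn_idPr (leqW lt)); split.
have e1 : minn t lo = t by apply/minn_idPl/ltnW.
have e2 : minn t.+1 lo = t.+1 by apply/minn_idPl.
rewrite e1 in g1 g2; rewrite e2.
have tl : t < size l by apply: leq_trans lt lol.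
have -> : iota 0 t.+1 = iota 0 t ++ [:: t] by rewrite -addn1 iotaD.
rewrite map_cat catA; set l' := l ++ _; rewrite -/l' in g1 g2.
split; first by rewrite /= /upd /= g1 size_cat.
move=> x; rewrite size_cat /= addn1 ltnS leq_eqVlt /= /upd /= g1 et q68 nth_cat.
case: eqP => [-> _|_ /= lx]; last by rewrite lx g2.
rewrite ltnn subnn /= g2; last by rewrite size_cat ltn_addr.
by rewrite nth_cat tl.
Qed.

Hypothesis cap_gt0 : forall c, c < m -> 0 < cap c.

(** All caps being positive, the list of codes never shrinks from one color to the next: its final
    length is a valid limit for all copying loops. *)
Lemma size_vecs_le c : c <= m -> size (vecs c) <= \prod_(e < m) cap e.
Proof.
move=> cm; rewrite size_vecs.
suff le d : c + d <= m -> \prod_(e < c) cap e <= \prod_(e < c + d) cap e.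
  by have := le (m - c); rewrite subnKC //; apply.
elim: d => [|d IHd] dm; first by rewrite addn0.
rewrite addnS in dm *; rewrite big_ord_recr /=.
by apply: leq_trans (IHd (ltnW dm)) _; rewrite leq_pmulr // cap_gt0.
Qed.

Lemma vector_codes_spec s : input_ok I s -> counts_ok s ->
  (forall j, nmem s 37 j = 0) ->
  codes_ok (vecs m) (radix m) (first_weight C) (den vector_codes s).
Proof.
move=> inp [c1 c2 c3 c4 c5] e37; rewrite /vector_codes.
set l1 := PFor 23 _ _ _; set l2 := PFor 44 _ _ (PN _ _ _).
rewrite (den_seq (PN 36 _ _)) (den_seq (setv 66 _)) (den_seq l1).
set s0 := den (setv 66 _) _.
have inp0 : input_ok I s0 by rewrite /s0; do 2!apply: input_ok_den => //.
have [f61 f62 f38 [f37 f28 f39]] : [/\ nmem s0 61 = nmem s 61, nmem s0 62 = nmem s 62,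
  nmem s0 38 = nmem s 38 & [/\ nmem s0 37 = nmem s 37, nmem s0 28 = nmem s 28 &
  nmem s0 39 = nmem s 39]] by [].
have hl0 : holds_list s0 [:: 0].
  by split => //; case.
clearbody s0.
pose P c s1 := holds_list s1 (vecs c).
have hP : P m (den l1 s0).
  apply: (@for_ind _ 23 0 1 _ _ P) => //; first exact: in_m inp0.
  move=> c s1 cm ec hn hr IH.
  have inp1 : input_ok I s1 by exact: input_ok_out inp0 hn hr _.
  rewrite (den_seq (setv 67 _)) (den_seq (setv 68 _)); set s2 := den (setv 68 _) _.
  have inp2 : input_ok I s2 by rewrite /s2; do 2!apply: input_ok_den => //.
  have q38 : nmem s2 38 = nmem s1 38 by [].
  have q61 : nmem s2 61 c = cap c by rewrite -(c1 c cm) -f61 -(hn 61).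
  have q62 : nmem s2 62 c = radix c by rewrite -(c2 c cm) -f62 -(hn 62).
  have {}q38 : nmem s2 38 0 = \prod_(e < m) cap e by rewrite q38 hn // f38 c3.
  have q67 : nmem s2 67 0 = size (vecs c) by case: IH.
  have q68 : nmem s2 68 0 = 0 by [].
  have q23 : nmem s2 23 0 = c by [].
  have {}IH : holds_list s2 (vecs c) by [].
  clearbody s2.
  (* The list after [r] blocks, one per value of the new digit. The block of digit 0 is the old list
     itself, so [cap c - 1] blocks are appended; this explains the [i.+1] in the invariant below. *)
  pose bl r := flatten [seq [seq v + i * radix c | v <- vecs c] | i <- iota 0 r].
  have blS r : bl r.+1 = bl r ++ [seq v + r * radix c | v <- vecs c].
    by rewrite /bl -addn1 iotaD map_cat flatten_cat /= cats0.
  have bl1 : bl 1 = vecs c.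
    rewrite /bl /= cats0 -[RHS]map_id; apply: eq_map => v; exact: addn0.
  have capc := cap_gt0 cm.
  pose P' i s3 := holds_list s3 (bl (minn i.+1 (cap c))) /\
    nmem s3 68 0 = (minn i.+1 (cap c)).-1 * radix c.
  have [] // : P' n (den (PFor 12 0 0 (
      PIf (NLt (NAdd (var 12) (NConst 1)) (NGet 61 (var 23)))
        (setv 68 (NAdd (var 68) (NGet 62 (var 23))) ;; append_loop) PSkip)%prog) s2).
    apply: (@for_ind _ 12 0 0 _ _ P') => //; first exact: in_n inp2.
      by rewrite /P' (minn_idPl capc) bl1; split.
    move=> i s3 kn ei hn' hr' [p1 p2].
    have z23 : nmem s3 23 0 = c by rewrite hn'.
    have z61 : nmem s3 61 c = cap c by rewrite hn'.
    have z62 : nmem s3 62 c = radix c by rewrite hn'.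
    have z38 : nmem s3 38 0 = \prod_(e < m) cap e by rewrite hn'.
    have z67 : nmem s3 67 0 = size (vecs c) by rewrite hn'.
    rewrite /P' den_if [beval _ _]/= z23 z61 ei -ltnNge addn1.
    case: ltnP => lt; last first.
      by move: p1 p2; rewrite (minn_idPr lt) (minn_idPr (leqW lt)); split.
    rewrite den_seq; set s4 := den (setv 68 _) s3.
    rewrite (minn_idPl (ltnW lt)) in p1 p2.
    rewrite (minn_idPl lt) blS.
    have y68 : nmem s4 68 0 = i.+1 * radix c.
      by rewrite /= /upd /= p2 z23 z62 mulSn addnC.
    have y38 : nmem s4 38 0 = \prod_(e < m) cap e by [].
    have y67 : nmem s4 67 0 = size (vecs c) by [].
    have {}p1 : holds_list s4 (bl i.+1) by [].
    clearbody s4.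
    have sl : size (vecs c) <= size (bl i.+1).
      rewrite -bl1 /bl !size_flatten /shape /= addn0.
      by rewrite leq_addr.
    have ap := append_loop_spec p1 y38 y67 y68 sl (size_vecs_le (ltnW cm)).
    split; last first.
      by rewrite nmem_setn (_ : (68 == 12) = false) // nframe // y68.
    suff <- : [seq nth 0 (bl i.+1) t + i.+1 * radix c | t <- iota 0 (size (vecs c))]
      = [seq v + i.+1 * radix c | v <- vecs c] by exact: ap.
    rewrite -{2}(mkseq_nth 0 (vecs c)) /mkseq -map_comp; apply/eq_in_map => t.
    rewrite mem_iota /= => tc; congr (_ + _).
    have -> : bl i.+1 = vecs c ++ flatten [seq [seq v + i * radix c | v <- vecs c] | i <- iota 1 i].
      rewrite /bl /=; congr (_ ++ _); rewrite -[RHS]map_id; apply: eq_map => v; exact: addn0.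
    by rewrite nth_cat tc.
  by rewrite /P /= -/(bl (cap c)) (minn_idPr (_ : cap c <= n.+1)) // leqW // geq_minr.
have k38 : nmem (den l1 s0) 38 0 = size (vecs m) by rewrite nframe // f38 c3 size_vecs.
have k37 j : nmem (den l1 s0) 37 j = 0 by rewrite nframe // f37.
have [k66 k36] := hP; split.
- by rewrite nframe.
- by move=> t tl; rewrite nframe // k36.
- by move=> j; apply: mark_spec.
- exact: vecs_lt.
- by rewrite nframe // nframe // f28.
- by move=> k kn; rewrite nframe // nframe // f39 c5.
Qed.

End Vector.
End Specs.

(** * Correctness of the dynamic program *)

Section Specs.
Variables (R : realType) (n m : nat) (I : instance R n m).
Variables (N B : nat) (V : seq nat) (w : nat -> nat).
Local Notation Q := (N * m).
Implicit Types s : state R.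

(** What the dynamic program consults without modifying it. By [env_out] it survives any phase that
    avoids the banks of [env_n] and [env_r]. *)
Record env s : Prop := Env {
  ev_in : input_ok I s;
  ev_N : nmem s 20 0 = N;
  ev_ty : types_ok m N s;
  ev_co : codes_ok n V B w s;
  ev_ad : addr_ok n Q B s;
  ev_lim : forall k q, q < Q ->
    (nmem s 26 q <= k.+1) = clear n (minsep I) (rmem s 8) (rmem s 7) k q;
  ev_col : forall k, k < n -> nmem s 11 k < m }.

Definition env_n := [:: 0; 1; 11; 20; 21; 24; 25; 26; 28; 29; 30; 31; 36; 37; 38; 39].
Definition env_r := [:: 0; 1; 2; 5; 7; 8].

Lemma env_out (ws wr : seq nat) s s' : env s ->
  (forall b, b \notin ws -> nmem s' b = nmem s b) ->
  (forall b, b \notin wr -> rmem s' b = rmem s b) ->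
  all [pred b | b \notin ws] env_n && all [pred b | b \notin wr] env_r ->
  env s'.
Proof.
case=> inp eN [t1 t2 t3 t4] [c1 c2 c3 c4 c5 c6] [a1 a2 a3] l c hn hr /andP[/allP an /allP ar].
have n' b : b \in env_n -> nmem s' b = nmem s b by move=> /an; apply: hn.
have r' b : b \in env_r -> rmem s' b = rmem s b by move=> /ar; apply: hr.
split; rewrite ?n' //.
- apply: input_ok_agree inp _ _ => b; rewrite !inE.
    by move=> /orP[] /eqP ->; apply: n'.
  by move=> /or3P[] /eqP ->; apply: r'.
- by split; rewrite ?n' ?r'.
- by split; rewrite ?n'.
- by split; rewrite ?n'.
- by rewrite !r'.
Qed.

Lemma env_den p s : env s ->
  all [pred b | b \notin nwrites p] env_n &&
  all [pred b | b \notin rwrites p] env_r -> env (den p s).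
Proof.
by move=> e; apply: env_out e _ _ => b; [apply: nframe|apply: rframe].
Qed.

Definition cell (k q q' j : nat) : nat :=
  k * (Q * (Q * B)) + q * (Q * B) + q' * B + j.

Lemma cell_inj k q q' j k1 q1 q1' j1 : q < Q -> q' < Q -> j < B ->
  q1 < Q -> q1' < Q -> j1 < B ->
  (cell k q q' j == cell k1 q1 q1' j1) =
  [&& k == k1, q == q1, q' == q1' & j == j1].
Proof.
move=> h1 h2 h3 h4 h5 h6; rewrite /cell -!addnA.
have low a b : a < Q -> b < B -> a * B + b < Q * B.
  move=> aQ bB; apply: (@leq_trans (a.+1 * B)); first by rewrite mulSn addnC ltn_add2r.
  by rewrite leq_mul2r aQ orbT.
have low2 a b : a < Q -> b < Q * B -> a * (Q * B) + b < Q * (Q * B).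
  move=> aQ bB; apply: (@leq_trans (a.+1 * (Q * B))); first by rewrite mulSn addnC ltn_add2r.
  by rewrite leq_mul2r aQ orbT.
rewrite flat_eq; [|by apply: low2; [|apply: low]..].
by rewrite flat_eq ?low // flat_eq.
Qed.

Lemma addr_eval s ek eq eq' ej k q q' j : addr_ok n Q B s ->
  neval s ek = k -> neval s eq = q -> neval s eq' = q' -> neval s ej = j ->
  k < n.+1 -> q < Q -> q' < Q ->
  neval s (addr ek eq eq' ej) = cell k q q' j.
Proof.
by move=> [a1 a2 a3] /= -> -> -> -> kn hq hq'; rewrite a1 // a2 // a3.
Qed.

Definition reached s k q q' j : bool := nmem s 49 (cell k q q' j) == 1.
Definition optval s k q q' j : R := rmem s 11 (cell k q q' j).
Definition chosen s k q q' j : nat := nmem s 50 (cell k q q' j).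
Definition chlow s k q q' j : nat := nmem s 51 (cell k q q' j).
Definition chup s k q q' j : nat := nmem s 52 (cell k q q' j).

(** * Filling one row of the table *)

Section Cell.
Variables (s0 : state R) (k q q' : nat).
Hypotheses (kn : k < n) (qQ : q < Q) (q'Q : q' < Q) (E0 : env s0).
Local Notation D := (minsep I).
Local Notation Y := (rmem s0 8).
Local Notation g := (rmem s0 9).
Local Notation tpos := (rmem s0 7).
Local Notation C := (nmem s0 11).
Local Notation tcol := (nmem s0 24).
Local Notation valid := (admissible n D (yb I) (yt I) Y tpos k q q').
Local Notation option_ok :=
  (option_ok n Q D (yb I) (yt I) Y tpos C tcol (reached s0) (mem V) k q q').
Local Notation chg := (charge w q q' k).
Local Notation prc := (price Y g tpos q q' k).

Hypothesis virgin : forall j, j < B -> nmem s0 49 (cell k.+1 q q' j) = 0.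

Definition others s : Prop := forall x,
  (forall j, j < B -> x <> cell k.+1 q q' j) ->
  [/\ nmem s 49 x = nmem s0 49 x, nmem s 50 x = nmem s0 50 x,
      nmem s 51 x = nmem s0 51 x, nmem s 52 x = nmem s0 52 x
    & rmem s 11 x = rmem s0 11 x].

(** [O] is the set of options tried so far: each reached entry comes from a genuine option, and no
    option in [O] beats it. The lower layer is read in the initial state [s0], as only layer [k.+1]
    is being written. *)
Definition best s (O : nat -> nat -> nat -> Prop) : Prop :=
  [/\ forall j, j \in V -> reached s k.+1 q q' j ->
        let b := chosen s k.+1 q q' j in
        let u := chlow s k.+1 q q' j in let v := chup s k.+1 q q' j in
        [/\ option_ok b u v, u + v + chg b = j &
          optval s k.+1 q q' j = (optval s0 k q b u + optval s0 k b q' v + prc b)%R]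
    & forall b u v, O b u v -> option_ok b u v ->
        let j := u + v + chg b in j \in V ->
        reached s k.+1 q q' j /\
        (optval s k.+1 q q' j <= optval s0 k q b u + optval s0 k b q' v + prc b)%R].

Record current s : Prop := Current {
  cu_others : others s;
  cu_env : env s;
  cu_vars : [/\ nmem s 40 0 = k, nmem s 41 0 = q & nmem s 42 0 = q'];
  cu_banks : [/\ nmem s 11 = C, nmem s 24 = tcol, rmem s 8 = Y, rmem s 9 = g
    & rmem s 7 = tpos] }.

Lemma Q_other k1 q1 q1' j1 : q1 < Q -> q1' < Q -> j1 < B ->
  (k1, q1, q1') <> (k.+1, q, q') ->
  forall j, j < B -> cell k1 q1 q1' j1 <> cell k.+1 q q' j.
Proof.
move=> h1 h2 h3 ne j jB /eqP; rewrite cell_inj // => /and4P[/eqP e1 /eqP e2 /eqP e3 _].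
by apply: ne; rewrite e1 e2 e3.
Qed.

Lemma relax_spec s O b tu tv : current s -> best s O ->
  b < Q -> tcol b = C k -> valid b ->
  nmem s 46 0 = b -> nmem s 47 0 = chg b -> rmem s 10 0 = prc b ->
  nmem s 44 0 = tu -> nmem s 45 0 = tv -> tu < size V -> tv < size V ->
  let s' := den relax s in
  current s' /\ best s' (fun b' u v => O b' u v \/
     (b' = b /\ u = nth 0 V tu /\ v = nth 0 V tv)).
Proof.
move=> [oth env_s [e40 e41 e42] [eC etc eY eg etp]] [bs1 bs2] bQ cb vb e46 e47 e10.
move=> e44 e45 tuV tvV.
set u := nth 0 V tu; set v := nth 0 V tv.
have uV : u \in V by apply: mem_nth.
have vV : v \in V by apply: mem_nth.
have uB : u < B := co_bound (ev_co env_s) uV.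
have vB : v < B := co_bound (ev_co env_s) vV.
rewrite /relax.
set ju := NGet 36 (var 44); set jv := NGet 36 (var 45).
set jj := NAdd _ _; set a1 := addr _ _ _ _; set a2 := addr _ _ _ _.
set a := addr _ _ _ _; set new := RAdd _ _.
have eju : neval s ju = u by rewrite /= e44 (co_vec (ev_co env_s)).
have ejv : neval s jv = v by rewrite /= e45 (co_vec (ev_co env_s)).
have ejj : neval s jj = u + v + chg b by rewrite [LHS]/= -/ju -/jv; move: eju ejv => /= -> ->; rewrite e47.
set j := u + v + chg b in ejj.
have ea1 : neval s a1 = cell k q b u.
  by apply: addr_eval (ev_ad env_s) _ _ _ _ _ _ _; rewrite ?e40 ?e41 //; apply: leqW.
have ea2 : neval s a2 = cell k b q' v.
  by apply: addr_eval (ev_ad env_s) _ _ _ _ _ _ _; rewrite ?e40 ?e41 //; apply: leqW.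
have ea : neval s a = cell k.+1 q q' j.
  by apply: addr_eval (ev_ad env_s) _ _ _ _ _ _ _; rewrite //= e40 addn1.
(* Only the row of [k.+1], [q], [q'] has changed since [s0], so layer [k] still has its values in
   [s0]. *)
have layer b1 b2 x : b1 < Q -> b2 < Q -> x < B ->
    reached s k b1 b2 x = reached s0 k b1 b2 x /\ optval s k b1 b2 x = optval s0 k b1 b2 x.
  move=> h1 h2 h3; rewrite /reached /optval.
  by have [|-> _ _ _ ->] // := oth (cell k b1 b2 x);
    apply: Q_other => // -[/eqP]; rewrite ltn_eqF.
have [fu vu] := layer _ _ _ qQ bQ uB; have [fv vv] := layer _ _ _ bQ q'Q vB.
have enew : reval s new = (optval s0 k q b u + optval s0 k b q' v + prc b)%R.
  by rewrite -vu -vv -e10 -[RHS]/(rmem s 11 _ + rmem s 11 _ + _)%R -ea1 -ea2.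
set x := reval s new in enew.
rewrite den_if; set cond := beval s _.
have econd : cond = [&& j \in V, reached s0 k q b u & reached s0 k b q' v] &&
    ~~ (reached s k.+1 q q' j && (optval s k.+1 q q' j <= x)%R).
  have e1 e : beval s (NEq e (NConst 1)) = (neval s e == 1) by rewrite /= -eqn_leq.
  rewrite /cond -fu -fv /reached /optval -ea1 -ea2 -ea.
  rewrite -[beval s _]/(beval s (NEq (NGet 37 jj) (NConst 1)) &&
   (beval s (NEq (NGet 49 a1) (NConst 1)) && beval s (NEq (NGet 49 a2) (NConst 1))) &&
   ~~ (beval s (NEq (NGet 49 a) (NConst 1)) && (rmem s 11 (neval s a) <= x)%R)).
  rewrite !e1; congr ((_ && _) && _).
  by rewrite -[neval s _]/(nmem s 37 (neval s jj)) ejj (co_val (ev_co env_s)); case: (_ \in _).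
case: ifP; rewrite econd; last first.
  move=> cf; split; first by split.
  split; first exact: bs1.
  move=> b' u' v' [|[-> [-> ->]]]; first exact: bs2.
  move=> [_ _ _ _ [h1 h2]] j' jV; move: cf.
  rewrite -/u -/v h1 h2 jV /= => /negbFE/andP[-> h3]; split => //.
  by rewrite -enew.
move=> /andP[/and3P[jV hu hv] cn].
have jB : j < B := co_bound (ev_co env_s) jV.
set p := (PR 11 a new ;; _)%prog.
have es : den p s = setn 52 (cell k.+1 q q' j) v (setn 51 (cell k.+1 q q' j) u
  (setn 50 (cell k.+1 q q' j) b (setn 49 (cell k.+1 q q' j) 1
  (setr 11 (cell k.+1 q q' j) x s)))).
  by rewrite -eju -ejv -ea -e46.
have env_p : env (den p s) by exact: env_den.
split.
  split => // y hy; have [h1 h2 h3 h4 h5] := oth y hy.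
  have /eqP/negbTE ne := hy j jB.
  by rewrite es; split; rewrite /= /upd /= ne.
have same j' : j' < B -> j' != j ->
    [/\ reached (den p s) k.+1 q q' j' = reached s k.+1 q q' j',
        optval (den p s) k.+1 q q' j' = optval s k.+1 q q' j',
        chosen (den p s) k.+1 q q' j' = chosen s k.+1 q q' j',
        chlow (den p s) k.+1 q q' j' = chlow s k.+1 q q' j'
      & chup (den p s) k.+1 q q' j' = chup s k.+1 q q' j'].
  move=> j'B ne; rewrite es /reached /optval /chosen /chlow /chup /= /upd /=.
  by rewrite cell_inj // !eqxx (negbTE ne).
have [n1 n2 n3 n4 n5] : [/\ reached (den p s) k.+1 q q' j = true,
        optval (den p s) k.+1 q q' j = x, chosen (den p s) k.+1 q q' j = b,
        chlow (den p s) k.+1 q q' j = u & chup (den p s) k.+1 q q' j = v].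
  by rewrite es /reached /optval /chosen /chlow /chup /= /upd /= eqxx.
split.
  move=> j' j'V; case: (eqVneq j' j) => [-> _|ne].
    by rewrite n2 n3 n4 n5; split.
  have [-> -> -> -> ->] := same j' (co_bound (ev_co env_s) j'V) ne.
  exact: bs1.
move=> b' u' v' hO ok j' j'V.
case: hO => [hO|[eb [eu ev]]]; last first.
  have -> : j' = j by rewrite /j' eb eu ev.
  by rewrite n1 n2 enew eb eu ev.
have [f' l'] := bs2 _ _ _ hO ok j'V.
case: (eqVneq j' j) => [e|ne].
  rewrite e n1 n2; split => //.
  by move: cn; rewrite -e f' /= -ltNge => lt; apply: le_trans (ltW lt) l'.
by have [-> -> _ _ _] := same j' (co_bound (ev_co env_s) j'V) ne.
Qed.

Definition cur_n := env_n ++ [:: 40; 41; 42; 49; 50; 51; 52].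
Definition cur_r := env_r ++ [:: 9; 11].

Lemma current_out (ws wr : seq nat) s s' : current s ->
  (forall b, b \notin ws -> nmem s' b = nmem s b) ->
  (forall b, b \notin wr -> rmem s' b = rmem s b) ->
  all [pred b | b \notin ws] cur_n && all [pred b | b \notin wr] cur_r ->
  current s' /\ forall O, best s O -> best s' O.
Proof.
move=> [oth ev [v1 v2 v3] [b1 b2 b3 b4 b5]] hn hr.
rewrite !all_cat => /andP[/andP[an1 /allP an2] /andP[ar1 /allP ar2]].
have n' b : b \in [:: 40; 41; 42; 49; 50; 51; 52] -> nmem s' b = nmem s b.
  by move=> /an2; apply: hn.
have r' b : b \in [:: 9; 11] -> rmem s' b = rmem s b by move=> /ar2; apply: hr.
have n2 b : b \in env_n -> nmem s' b = nmem s b.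
  by move=> h; apply: hn; apply: (allP an1).
have r2 b : b \in env_r -> rmem s' b = rmem s b.
  by move=> h; apply: hr; apply: (allP ar1).
split.
  split; first by move=> x hx; rewrite !n' // r' //; apply: oth.
  - by apply: env_out ev hn hr _; rewrite an1 ar1.
  - by split; rewrite n'.
  - by split; [rewrite n2|rewrite n2|rewrite r2|rewrite r'|rewrite r2].
by move=> O; rewrite /best /reached /optval /chosen /chlow /chup !n' // !r'.
Qed.

Lemma current_den p s : current s ->
  all [pred b | b \notin nwrites p] cur_n &&
  all [pred b | b \notin rwrites p] cur_r ->
  current (den p s) /\ forall O, best s O -> best (den p s) O.
Proof.
by move=> c; apply: current_out c _ _ => b; [apply: nframe|apply: rframe].
Qed.

Lemma current_setn v x s : current s -> v \notin cur_n ->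
  current (setn v 0 x s) /\ forall O, best s O -> best (setn v 0 x s) O.
Proof.
move=> c vn; apply: (@current_out [:: v] [::] s) => //.
  move=> b; rewrite inE => /negbTE bv; apply: funext => i.
  by rewrite nmem_setn bv.
apply/andP; split => //; apply/allP => b hb /=; rewrite inE.
by apply: contraNneq vn => <-.
Qed.

Lemma check_type_spec s r : current s -> r < N -> nmem s 43 0 = r ->
  let s' := den check_type s in
  let b := r * m + C k in
  [/\ current s' /\ (forall O, best s O -> best s' O), b < Q, tcol b = C k,
      nmem s' 46 0 = b & nmem s' 48 0 = valid b /\
      (valid b -> nmem s' 47 0 = chg b /\ rmem s' 10 0 = prc b)].
Proof.
move=> cur rN er s' b.
have ckm : C k < m by exact: ev_col E0 k kn.
have bQ : b < Q.
  apply: (@leq_trans (r.+1 * m)); first by rewrite /b mulSn addnC ltn_add2r.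
  by rewrite leq_mul2r rN orbT.
have cb : tcol b = C k by rewrite /b; apply: (ty_col (ev_ty E0)).
split => //; first exact: current_den.
all: rewrite /s' /check_type; set y := RGet 8 (var 40); set eb := RGet 7 (var 46);
  set s1 := setv 46 _; set s2 := setv 48 _; set s3 := setv 47 _;
  set s4 := dist y eb 10; set fl := BRealLe _ (RSub y _); set fh := BRealLe _ (RSub _ y);
  set p := PIf _ _ PSkip.
all: have hs : den (s1 ;; s2 ;; s3 ;; s4 ;; p)%prog s =
  den p (den s4 (den s3 (den s2 (den s1 s)))) by [].
all: rewrite hs.
- rewrite nframe // nframe //.
  have [_ ev [e40 _ _] [eC _ _ _ _]] := cur.
  by rewrite /= /upd /= er e40 eC (ty_base (ev_ty ev)).
- have [cur4 _] : current (den s4 (den s3 (den s2 (den s1 s)))) /\ True.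
    split => //; apply: (proj1 (current_den _ _)) => //.
    do 3!apply: (proj1 (current_den _ _)) => //.
  have [e46 e47 e48 e10] : [/\ nmem (den s4 (den s3 (den s2 (den s1 s)))) 46 0 = b,
     nmem (den s4 (den s3 (den s2 (den s1 s)))) 47 0 = 0,
     nmem (den s4 (den s3 (den s2 (den s1 s)))) 48 0 = 0 &
     rmem (den s4 (den s3 (den s2 (den s1 s)))) 10 0 = `|Y k - tpos b|%R].
    have [_ ev [e40 _ _] [eC _ eY _ etp]] := cur.
    have e46 : nmem (den s3 (den s2 (den s1 s))) 46 0 = b.
      by rewrite /= /upd /= er e40 eC (ty_base (ev_ty ev)).
    have e40' : nmem (den s3 (den s2 (den s1 s))) 40 0 = k by [].
    have [f47 f48] : nmem (den s3 (den s2 (den s1 s))) 47 0 = 0 /\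
      nmem (den s3 (den s2 (den s1 s))) 48 0 = 0 by [].
    have [fY ftp] : rmem (den s3 (den s2 (den s1 s))) 8 = Y /\
      rmem (den s3 (den s2 (den s1 s))) 7 = tpos by [].
    move: (den s3 _) e46 e40' f47 f48 fY ftp => s5 e46 e40' f47 f48 fY ftp.
    rewrite /s4 /dist den_if [beval _ _]/= e46 e40' fY ftp.
    case: (lerP (Y k) (tpos b)) => h; (split; [exact: e46|exact: f47|exact: f48|]);
      by rewrite /= /upd /= e46 e40' fY ftp.
  move: (den s4 _) cur4 e46 e47 e48 e10 => s5 [_ ev [e40 e41 e42] [_ _ eY eg etp]].
  move=> e46 e47 e48 e10 {hs}.
  have fle : beval s5 fl = (D <= Y k - tpos q)%R.
    by rewrite /= (in_D (ev_in ev)) e40 e41 eY etp.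
  have fhe : beval s5 fh = (D <= tpos q' - Y k)%R.
    by rewrite /= (in_D (ev_in ev)) e40 e42 eY etp.
  have neq e f : beval s5 (NEq e f) = (neval s5 e == neval s5 f).
    by rewrite /= eqn_leq.
  rewrite /p /admissible /charge /price /opens den_if.
  set inr := beval s5 _.
  have -> : inr = ((yb I <= tpos b) && (tpos b <= yt I))%R.
    by rewrite /inr /= (in_yb (ev_in ev)) (in_yt (ev_in ev)) e46 etp.
  rewrite andbA; case: (_ && _)%R; last by split.
  rewrite den_if neq [neval _ _]/= [X in _ == X]/= e46 e41.
  case: (eqVneq b q) => [bq|nq].
    by rewrite den_if fhe; case: ifP => h; split => //= _; rewrite /upd /= ?e48 // e47 e10 addr0.
  rewrite den_if neq [neval _ _]/= [X in _ == X]/= e46 e42.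
  case: (eqVneq b q') => [bq|nq'].
    by rewrite den_if fle; case: ifP => h; split => //= _; rewrite /upd /= ?e48 // e47 e10 addr0.
  rewrite !den_seq; set s6 := den (setrv 10 _) _.
  have [f47 f10 f48 [f40 f41 f42 [f46 f26]]] : [/\ nmem s6 47 0 = w k,
      rmem s6 10 0 = (`|Y k - tpos b| + g k)%R, nmem s6 48 0 = 0 &
      [/\ nmem s6 40 0 = k, nmem s6 41 0 = q, nmem s6 42 0 = q' &
      nmem s6 46 0 = b /\ nmem s6 26 = nmem s5 26]].
    split => //; rewrite /= /upd /= e40.
      by rewrite (co_w (ev_co ev)).
    by rewrite e10 eg.
  have [f8 f7 f0] : [/\ rmem s6 8 = Y, rmem s6 7 = tpos & rmem s6 0 4 = D].
    by split => //; exact: in_D (ev_in ev).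
  clearbody s6.
  rewrite den_if; set cd := beval s6 _.
  have -> : cd = [&& (D <= tpos b - tpos q)%R, (D <= tpos q' - tpos b)%R,
     (D <= Y k - tpos q)%R, (D <= tpos q' - Y k)%R & clear n D Y tpos k b].
    rewrite /cd /= f0 f46 f41 f42 f40 f8 f7 f26 addn1.
    by rewrite (ev_lim ev) // eY etp.
  by case: ifP => h; split => //= _; rewrite /upd /=.
Qed.

(** Used when a loop ends, to see that the options enumerated cover all those that satisfy
    [option_ok]. *)
Lemma best_sub s O O' : best s O ->
  (forall b u v, O' b u v -> option_ok b u v -> O b u v) -> best s O'.
Proof.
by move=> [h1 h2] h; split => // b u v o' ok; apply: h2 => //; apply: h.
Qed.

Lemma pair_loops_spec s O b : current s -> best s O ->
  b < Q -> tcol b = C k -> valid b ->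
  nmem s 46 0 = b -> nmem s 47 0 = chg b -> rmem s 10 0 = prc b ->
  let s' := den (PFor 44 38 0 (PFor 45 38 0 relax)) s in
  current s' /\ best s' (fun b' u v => O b' u v \/ b' = b).
Proof.
move=> cur bst bQ cb vb e46 e47 e10.
pose P t s1 := current s1 /\
  best s1 (fun b' u v => O b' u v \/ (b' = b /\ exists2 i, i < t & u = nth 0 V i)).
suff [c1 b1] : P (size V) (den (PFor 44 38 0 (PFor 45 38 0 relax)) s).
  split => //; apply: best_sub b1 _ => b' u v [h|->]; first by left.
  move=> [_ _ _ [uV _] _]; right; split => //; exists (index u V).
    by rewrite index_mem.
  by rewrite nth_index.
apply: (@for_ind _ 44 38 0 _ _ P) => //.
- exact: co_size (ev_co (cu_env cur)).
- have [c1 c2] := @current_setn 44 0 s cur isT; split => //.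
  by apply: best_sub (c2 _ bst) _ => b' u v [//|[_ []]].
move=> t s1 tV et hn hr [cur1 bst1].
pose P' y s2 := current s2 /\
  best s2 (fun b' u v => (O b' u v \/ (b' = b /\ exists2 i, i < t & u = nth 0 V i))
    \/ (b' = b /\ u = nth 0 V t /\ exists2 i, i < y & v = nth 0 V i)).
have [c1 b1] : P' (size V) (den (PFor 45 38 0 relax) s1).
  apply: (@for_ind _ 45 38 0 _ _ P') => //.
  - exact: co_size (ev_co (cu_env cur1)).
  - have [c1 c2] := @current_setn 45 0 s1 cur1 isT; split => //.
    by apply: best_sub (c2 _ bst1) _ => b' u v [//|[_ [_ []]]].
  move=> y s2 yV ey hn' hr' [cur2 bst2].
  have q46 : nmem s2 46 0 = b by rewrite hn' // hn.
  have q47 : nmem s2 47 0 = chg b by rewrite hn' // hn.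
  have q10 : rmem s2 10 0 = prc b by rewrite hr' // hr.
  have q44 : nmem s2 44 0 = t by rewrite hn'.
  have [c1 b1] := relax_spec cur2 bst2 bQ cb vb q46 q47 q10 q44 ey tV yV.
  have [c2 b2] := @current_setn 45 y.+1 _ c1 isT; split => //.
  apply: best_sub (b2 _ b1) _ => b' u v [h|[-> [-> [i]]]]; first by left; left.
  rewrite ltnS leq_eqVlt => /orP[/eqP -> ->|iy ->]; first by right.
  by left; right; do 2!split => //; exists i.
have [c2 b2] := @current_setn 44 t.+1 _ c1 isT; split => //.
apply: best_sub (b2 _ b1) _ => b' u v [h|[-> [i]]]; first by left; left.
move=> it -> [_ _ _ [_ vV] _]; move: it.
rewrite ltnS leq_eqVlt => /orP[/eqP ->|it].
  right; do 2!split => //; exists (index v V); first by rewrite index_mem.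
  by rewrite nth_index.
by left; right; split => //; exists i.
Qed.

Hypothesis vars0 : [/\ nmem s0 40 0 = k, nmem s0 41 0 = q & nmem s0 42 0 = q'].

Lemma current0 : current s0.
Proof. by split. Qed.

Lemma best0 : best s0 (fun _ _ _ => False).
Proof.
split => // j jV.
by rewrite /reached (virgin (co_bound (ev_co E0) jV)).
Qed.

Lemma split_loop_spec : let s' := den split_loop s0 in
  current s' /\ best s' (fun _ _ _ => True).
Proof.
rewrite /split_loop; set body := (check_type ;; _)%prog.
pose P r s1 := current s1 /\
  best s1 (fun b _ _ => exists2 r', r' < r & b = r' * m + C k).
suff [c1 b1] : P N (den (PFor 43 20 0 body) s0).
  split => //; apply: best_sub b1 _ => b u v _ [bQ cb _ _ _].
  have m0 : 0 < m by apply: leq_ltn_trans (ev_col E0 kn).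
  (* The color of a type is its remainder modulo [m], so the quotient is the candidate whose turn
     has tried [b]. *)
  exists (b %/ m); first by rewrite ltn_divLR.
  rewrite {1}(divn_eq b m); congr (_ + _); rewrite -cb.
  rewrite {2}(divn_eq b m) (ty_col (ev_ty E0)) ?ltn_mod //.
  by rewrite ltn_divLR.
apply: (@for_ind _ 43 20 0 _ _ P) => //.
- exact: ev_N E0.
- have [c1 c2] := @current_setn 43 0 s0 current0 isT; split => //.
  by apply: best_sub (c2 _ best0) _ => b' u v [].
move=> r s1 rN er hn hr [cur1 bst1].
rewrite den_seq.
have [[c2 b2] bQ cb e46 [e48 ev]] := check_type_spec cur1 rN er.
move: (den check_type s1) c2 b2 e46 e48 ev => s2 c2 b2 e46 e48 ev.
have [c3 b3] : current (den (PIf (NEq (var 48) (NConst 1))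
    (PFor 44 38 0 (PFor 45 38 0 relax)) PSkip) s2) /\
  best (den (PIf (NEq (var 48) (NConst 1))
    (PFor 44 38 0 (PFor 45 38 0 relax)) PSkip) s2)
    (fun b _ _ => exists2 r', r' < r.+1 & b = r' * m + C k).
  rewrite den_if.
  have -> : beval s2 (NEq (var 48) (NConst 1)) = valid (r * m + C k).
    by rewrite /= e48; case: valid.
  case: ifP => vb.
    have [e47 e10] := ev vb.
    have [c3 b3] := pair_loops_spec c2 (b2 _ bst1) bQ cb vb e46 e47 e10.
    split => //; apply: best_sub b3 _ => b u v [r' + ->] _.
    rewrite ltnS leq_eqVlt => /orP[/eqP ->|lt]; first by right.
    by left; exists r'.
  split => //; apply: best_sub (b2 _ bst1) _ => b u v [r' + ->] [_ _ vb' _ _].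
  rewrite ltnS leq_eqVlt => /orP[/eqP e|lt]; first by rewrite e vb in vb'.
  by exists r'.
have [c4 b4] := @current_setn 43 r.+1 _ c3 isT.
by split => //; apply: b4.
Qed.

Lemma copy_loop_spec : let s' := den copy_loop s0 in
  current s' /\ forall j, j \in V ->
    reached s' k.+1 q q' j = reached s0 k q q' j /\ optval s' k.+1 q q' j = optval s0 k q q' j.
Proof.
rewrite /copy_loop; set j := NGet 36 (var 44).
set a := addr (NAdd _ _) _ _ _; set a0 := addr (var 40) _ _ _.
set body := (PN _ _ _ ;; _)%prog.
pose P t s1 := current s1 /\ forall i, i < t ->
    reached s1 k.+1 q q' (nth 0 V i) = reached s0 k q q' (nth 0 V i) /\
    optval s1 k.+1 q q' (nth 0 V i) = optval s0 k q q' (nth 0 V i).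
suff [c1 h] : P (size V) (den (PFor 44 38 0 body) s0).
  split => // j' j'V; have := h (index j' V); rewrite index_mem nth_index //; exact.
apply: (@for_ind _ 44 38 0 _ _ P) => //.
- exact: co_size (ev_co E0).
- by have [c1 c2] := @current_setn 44 0 s0 current0 isT; split.
move=> t s1 tV et hn hr [cur IH].
have [oth ev [e40 e41 e42] [eC etc eY eg etp]] := cur.
set u := nth 0 V t.
have uV : u \in V by apply: mem_nth.
have uB : u < B := co_bound (ev_co ev) uV.
have eu : neval s1 j = u by rewrite /= et (co_vec (ev_co ev)).
have ea : neval s1 a = cell k.+1 q q' u.
  by apply: addr_eval (ev_ad ev) _ _ _ _ _ _ _; rewrite //= e40 addn1.
have ea0 : neval s1 a0 = cell k q q' u.
  by apply: addr_eval (ev_ad ev) _ _ _ _ _ _ _; rewrite ?e40 ?e41 //; apply: leqW.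
have low : forall j, j < B -> cell k q q' u <> cell k.+1 q q' j.
  by apply: Q_other => // -[/eqP]; rewrite ltn_eqF.
have es : den body s1 = setr 11 (cell k.+1 q q' u) (rmem s1 11 (cell k q q' u))
    (setn 49 (cell k.+1 q q' u) (nmem s1 49 (cell k q q' u)) s1).
  by rewrite -ea -ea0.
have env_b : env (den body s1) by exact: env_den.
have cur' : current (den body s1).
  split => // y hy; have [h1 h2 h3 h4 h5] := oth y hy.
  have /eqP/negbTE ne := hy u uB.
  by rewrite es; split; rewrite /= /upd /= ?ne.
have [c2 _] := @current_setn 44 t.+1 _ cur' isT; split => // i.
have [h1 _ _ _ h5] := oth _ low.
rewrite ltnS leq_eqVlt -[reached (setn _ _ _ _) _ _ _ _]/(reached (den body s1) k.+1 q q' (nth 0 V i)).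
rewrite -[optval (setn _ _ _ _) _ _ _ _]/(optval (den body s1) k.+1 q q' (nth 0 V i)) es.
rewrite /reached /optval /= /upd /=; case: (eqVneq (nth 0 V i) u) => [-> _|ne].
  by rewrite eqxx h1 h5.
move=> /orP[/eqP e|it]; first by move: ne; rewrite e eqxx.
have iB : nth 0 V i < B.
  by apply: (co_bound (ev_co ev)); apply: mem_nth; apply: ltn_trans tV.
by rewrite cell_inj // !eqxx (negbTE ne) /=; apply: IH.
Qed.

Lemma strip_body_spec : let s' := den strip_body s0 in
  [/\ current s',
    strip Y tpos q q' k -> best s' (fun _ _ _ => True)
  & ~~ strip Y tpos q q' k -> forall j, j \in V ->
    reached s' k.+1 q q' j = reached s0 k q q' j /\ optval s' k.+1 q q' j = optval s0 k q q' j].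
Proof.
rewrite /strip_body den_if.
have [v1 v2 v3] := vars0.
have -> : beval s0 (in_strip (RGet 8 (var 40)) (RGet 7 (var 41)) (RGet 7 (var 42)))
    = strip Y tpos q q' k.
  by rewrite /= v1 v2 v3 -ltNge.
case: ifP => sk.
  by have [h1 h2] := split_loop_spec; split.
by have [h1 h2] := copy_loop_spec; split.
Qed.

End Cell.

(** * The invariant of the three nested loops *)

Definition same_cell s s' (x : nat) : Prop :=
  [/\ nmem s' 49 x = nmem s 49 x, nmem s' 50 x = nmem s 50 x,
      nmem s' 51 x = nmem s 51 x, nmem s' 52 x = nmem s 52 x
    & rmem s' 11 x = rmem s 11 x].

Definition same_points s s' : Prop :=
  [/\ nmem s' 11 = nmem s 11, nmem s' 24 = nmem s 24, rmem s' 8 = rmem s 8,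
      rmem s' 9 = rmem s 9 & rmem s' 7 = rmem s 7].

Lemma best_agree s0 s0' s s' k q q' O : q < Q -> q' < Q -> same_points s0 s0' ->
  (forall b1 b2 x, b1 < Q -> b2 < Q -> x \in V -> same_cell s0 s0' (cell k b1 b2 x)) ->
  (forall x, x \in V -> same_cell s s' (cell k.+1 q q' x)) ->
  best s0 k q q' s O -> best s0' k q q' s' O.
Proof.
move=> hq hq' [e1 e2 e3 e4 e5] hlow hup [h1 h2].
have low b1 b2 x : b1 < Q -> b2 < Q -> x \in V ->
    reached s0' k b1 b2 x = reached s0 k b1 b2 x /\ optval s0' k b1 b2 x = optval s0 k b1 b2 x.
  by move=> h3 h4 h5; rewrite /reached /optval; have [-> _ _ _ ->] := hlow _ _ _ h3 h4 h5.
have opt b u v : option_ok n Q (minsep I) (yb I) (yt I) (rmem s0' 8) (rmem s0' 7)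
    (nmem s0' 11) (nmem s0' 24) (reached s0') (mem V) k q q' b u v <->
    option_ok n Q (minsep I) (yb I) (yt I) (rmem s0 8) (rmem s0 7)
    (nmem s0 11) (nmem s0 24) (reached s0) (mem V) k q q' b u v.
  rewrite e1 e2 e3 e5; split => -[a1 a2 a3 [a4 a5] [a6 a7]]; split => //; move: a6 a7.
    by have [-> _] := low q b u hq a1 a4; have [-> _] := low b q' v a1 hq' a5.
  by have [-> _] := low q b u hq a1 a4; have [-> _] := low b q' v a1 hq' a5.
split.
  move=> j jV; have [g1 g2 g3 g4 g5] := hup j jV.
  rewrite /reached /chosen /chlow /chup /optval g1 g2 g3 g4 g5 => fj.
  have [ok ej ev] := h1 j jV fj; split => //; first exact/opt.
  have [bQ _ _ [uV vV] _] := ok.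
  have [_ l1] := low _ _ _ hq bQ uV; have [_ l2] := low _ _ _ bQ hq' vV.
  move: l1 l2; rewrite /optval => -> ->.
  by rewrite e3 e4 e5; exact: ev.
move=> b u v hO /opt ok j jV; have [g1 g2 g3 g4 g5] := hup j jV.
have [bQ _ _ [uV vV] _] := ok.
have [_ ->] := low _ _ _ hq bQ uV; have [_ ->] := low _ _ _ bQ hq' vV.
rewrite /reached /optval g1 g5 e3 e4 e5.
exact: h2 hO ok jV.
Qed.

(** A completed row and the layer below it are never written again, so [best] may be stated with the
    current state on both sides and carried along by [done_agree]. *)
Definition done s k q q' : Prop :=
  (strip (rmem s 8) (rmem s 7) q q' k -> best s k q q' s (fun _ _ _ => True)) /\
  (~~ strip (rmem s 8) (rmem s 7) q q' k -> forall j, j \in V ->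
    reached s k.+1 q q' j = reached s k q q' j /\ optval s k.+1 q q' j = optval s k q q' j).

Lemma done_agree s s' k q q' : q < Q -> q' < Q -> same_points s s' ->
  (forall b1 b2 x, b1 < Q -> b2 < Q -> x \in V -> same_cell s s' (cell k b1 b2 x)) ->
  (forall x, x \in V -> same_cell s s' (cell k.+1 q q' x)) ->
  done s k q q' -> done s' k q q'.
Proof.
move=> hq hq' sp low up [h1 h2]; have [_ _ e3 _ e5] := sp.
split; rewrite e3 e5; first by move=> /h1; apply: best_agree.
move=> /h2 h j jV; have [g1 _ _ _ g5] := up j jV.
have [l1 _ _ _ l5] := low q q' j hq hq' jV.
by rewrite /reached /optval g1 g5 l1 l5; apply: h.
Qed.

Definition base_ok s : Prop := forall q q' j, q < Q -> q' < Q -> j \in V ->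
  reached s 0 q q' j = (j == 0) /\ optval s 0 q q' 0 = 0%R.

(** [P] tells which rows are complete. The others must still be marked unreached, because [relax]
    compares each option with what it finds in the table. *)
Record dp_inv (P : nat -> nat -> nat -> bool) s : Prop := DpInv {
  di_env : env s;
  di_base : base_ok s;
  di_done : forall k q q', k < n -> q < Q -> q' < Q -> P k q q' -> done s k q q';
  di_virgin : forall k q q', k < n -> q < Q -> q' < Q -> ~~ P k q q' ->
    forall j, j < B -> nmem s 49 (cell k.+1 q q' j) = 0 }.

Lemma dp_inv_ext P P' s :
  (forall k q q', k < n -> q < Q -> q' < Q -> P k q q' = P' k q q') ->
  dp_inv P s -> dp_inv P' s.
Proof.
move=> e [h1 h2 h3 h4]; split => // k q q' hk hq hq'; rewrite -e //.
  exact: h3.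
exact: h4.
Qed.

Lemma dp_inv_setn P v x s : v \in [:: 40; 41; 42] -> dp_inv P s ->
  dp_inv P (setn v 0 x s).
Proof.
move=> vin [h1 h2 h3 h4].
have hn b : b \notin [:: v] -> nmem (setn v 0 x s) b = nmem s b.
  by rewrite inE => /negbTE bv; apply: funext => i; rewrite nmem_setn bv.
have vn b : b \in env_n ++ [:: 49; 50; 51; 52] -> b \notin [:: v].
  by rewrite inE => hb; apply: contraTneq vin => <-; move: hb; rewrite !inE => /orP[] h;
    repeat (case/orP: h => [/eqP -> //|h]); move/eqP: h => ->.
have n49 : nmem (setn v 0 x s) 49 = nmem s 49 by rewrite hn // vn.
split.
- apply: (env_out (ws := [:: v]) (wr := [::]) h1) => //.
  by apply/andP; split => //; apply/allP => b hb; apply: vn; rewrite mem_cat hb.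
- by move=> q q' j; rewrite /reached n49; apply: h2.
- move=> k q q' hk hq hq' hP; apply: done_agree (h3 _ _ _ hk hq hq' hP) => //.
  + by split => //; rewrite hn // vn.
  + by move=> *; split => //; rewrite hn // vn.
  + by move=> *; split => //; rewrite hn // vn.
- by move=> k q q' hk hq hq' hP j jB; rewrite n49; apply: h4 jB.
Qed.

Definition lt3 (k q q' k1 q1 q1' : nat) : bool :=
  (k1 < k) || (k1 == k) && ((q1 < q) || (q1 == q) && (q1' < q')).

Lemma dp_step s k q q' : k < n -> q < Q -> q' < Q ->
  nmem s 40 0 = k -> nmem s 41 0 = q -> nmem s 42 0 = q' ->
  dp_inv (lt3 k q q') s -> dp_inv (lt3 k q q'.+1) (den strip_body s).
Proof.
move=> kn qQ q'Q e40 e41 e42 [h1 h2 h3 h4].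
have vir j : j < B -> nmem s 49 (cell k.+1 q q' j) = 0.
  by apply: h4 => //; rewrite /lt3 !ltnn !eqxx.
have [[oth ev vs bk] hb hc] := strip_body_spec kn qQ q'Q h1 vir (And3 e40 e41 e42).
move: (den strip_body s) oth ev vs bk hb hc => s' oth ev _ bk hb hc.
have vB x : x \in V -> x < B by move=> xV; exact: (co_bound (ev_co ev) xV).
have same k1 q1 q1' x : q1 < Q -> q1' < Q -> x < B ->
    (k1, q1, q1') <> (k.+1, q, q') -> same_cell s s' (cell k1 q1 q1' x).
  by move=> a1 a2 a3 ne; have [] := oth (cell k1 q1 q1' x) (Q_other qQ q'Q a1 a2 a3 ne).
have lowsame b1 b2 x k1 : k1 <= k -> b1 < Q -> b2 < Q -> x \in V ->
    same_cell s s' (cell k1 b1 b2 x).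
  by move=> kk a1 a2 a3; apply: same => //; [exact: vB|case => e; lia].
split => //.
- move=> a b j ha hb' jV.
  have [g1 _ _ _ _] := lowsame a b j 0 (leq0n _) ha hb' jV.
  have [_ e0] := h2 a b j ha hb' jV.
  rewrite /reached g1; split; first by have [] := h2 a b j ha hb' jV.
  rewrite /optval; have B0 : 0 < B by apply: leq_ltn_trans (vB _ jV).
  by have [_ _ _ _ ->] := same 0 a b 0 ha hb' B0 (fun e => ltac:(discriminate e)).
- move=> k1 q1 q1' hk hq hq'.
  case: (pselect ((k1, q1, q1') = (k, q, q'))) => [[-> -> ->] _|ne].
    have [_ _ b3 _ b5] := bk; split; rewrite b3 b5.
      by move=> /hb; apply: best_agree => // b1 b2 x a1 a2 a3; apply: lowsame.
    move=> /hc hc' j jV; have [-> ->] := hc' j jV.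
    by have [g1 _ _ _ g5] := lowsame q q' j k (leqnn k) qQ q'Q jV; rewrite /reached /optval g1 g5.
  move=> lt.
  have lt' : lt3 k q q' k1 q1 q1'.
    move: lt; rewrite /lt3; case: ltngtP => //= e1; case: ltngtP => //= e2.
    rewrite ltnS leq_eqVlt => /orP[/eqP e3|//].
    by case: ne; rewrite e1 e2 e3.
  have kk : k1 <= k by move: lt'; rewrite /lt3; lia.
  apply: done_agree (h3 _ _ _ hk hq hq' lt') => //.
    by move=> b1 b2 x a1 a2 a3; apply: lowsame.
  by move=> x xV; apply: same => //; [exact: vB|move=> [a1 a2 a3]; apply: ne; rewrite a1 a2 a3].
- move=> k1 q1 q1' hk hq hq' nlt j jB.
  have [|-> _ _ _ _] := same k1.+1 q1 q1' j hq hq' jB.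
    by case=> a1 a2 a3; move: nlt; rewrite a1 a2 a3 /lt3 ltnSn !eqxx !orbT.
  apply: h4 => //; apply: contra nlt; rewrite /lt3.
  case: ltngtP => //= e1; case: ltngtP => //= e2; exact: ltnW.
Qed.

Lemma dp_phase_spec s : dp_inv (fun _ _ _ => false) s ->
  dp_inv (fun _ _ _ => true) (den dp_phase s).
Proof.
move=> h0; rewrite /dp_phase.
pose P k s1 := dp_inv (lt3 k 0 0) s1.
suff : P n (den (PFor 40 0 0 (PFor 41 25 0 (PFor 42 25 0 strip_body))) s).
  by apply: dp_inv_ext => k q q' kn _ _; rewrite /lt3 kn.
apply: (@for_ind _ 40 0 0 _ _ P) => //.
- exact: in_n (ev_in (di_env h0)).
- by apply: dp_inv_setn => //; apply: dp_inv_ext h0 => k q q' _ _ _; rewrite /lt3 !ltn0 !andbF.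
move=> k s1 kn e40 _ _ h1; apply: dp_inv_setn => //.
pose P1 q s2 := dp_inv (lt3 k q 0) s2.
suff : P1 Q (den (PFor 41 25 0 (PFor 42 25 0 strip_body)) s1).
  apply: dp_inv_ext => k1 q q' _ qQ _; rewrite /lt3; lia.
apply: (@for_ind _ 41 25 0 _ _ P1) => //.
- exact: ty_n (ev_ty (di_env h1)).
- by apply: dp_inv_setn.
move=> q s2 qQ e41 hn2 _ h2; apply: dp_inv_setn => //.
have e40' : nmem s2 40 0 = k by rewrite hn2.
pose P2 q' s3 := dp_inv (lt3 k q q') s3.
suff : P2 Q (den (PFor 42 25 0 strip_body) s2).
  apply: dp_inv_ext => k1 q1 q1' _ _ q1Q; rewrite /lt3; lia.
apply: (@for_ind _ 42 25 0 _ _ P2) => //.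
- exact: ty_n (ev_ty (di_env h2)).
- by apply: dp_inv_setn.
move=> q' s3 q'Q e42 hn3 _ h3; apply: dp_inv_setn => //.
by apply: dp_step => //; rewrite hn3.
Qed.

Lemma dp_table s : dp_inv (fun _ _ _ => true) s ->
  table_ok n Q (minsep I) (yb I) (yt I) (rmem s 8) (rmem s 9) (rmem s 7)
    (nmem s 11) w (nmem s 24) (reached s) (optval s) (chosen s) (chlow s) (chup s) (mem V).
Proof.
move=> [h1 h2 h3 _]; split.
- by move=> q q' j hq hq' jV; apply: h2.
- move=> k q q' j kn hq hq' jV ns.
  have [_ h] := h3 k q q' kn hq hq' isT.
  by have [-> ->] := h ns j jV.
- move=> k q q' j kn hq hq' jV sk fj.
  have [h _] := h3 k q q' kn hq hq' isT.
  by have [g _] := h sk; apply: g.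
- move=> k q q' b u v kn hq hq' sk ok j jV.
  have [h _] := h3 k q q' kn hq hq' isT.
  by have [_ g] := h sk; apply: g.
Qed.

Lemma base_phase_spec s : env s -> 0 \in V -> (forall x, nmem s 49 x = 0) ->
  dp_inv (fun _ _ _ => false) (den base_phase s).
Proof.
move=> ev V0 z; have B0 : 0 < B := co_bound (ev_co ev) V0.
rewrite /base_phase; set body := (PN 49 _ _ ;; _)%prog.
pose P (lt : nat -> nat -> bool) s1 := env s1 /\
  forall k q q' j, q < Q -> q' < Q -> j < B ->
   nmem s1 49 (cell k q q' j) = [&& k == 0, lt q q' & j == 0] /\
   (lt q q' -> optval s1 0 q q' 0 = 0%R).
have set_var lt v x s1 : v \in [:: 41; 42] -> P lt s1 -> P lt (setn v 0 x s1).
  move=> vin [e h].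
  have n49 : nmem (setn v 0 x s1) 49 = nmem s1 49.
    apply: funext => i; rewrite nmem_setn; case: eqP => // e49.
    by move: vin; rewrite -e49.
  split; last by move=> k q q' j hq hq' jB; rewrite n49; apply: h.
  apply: (env_out (ws := [:: v]) (wr := [::]) e) => //.
    move=> b; rewrite inE => /negbTE bv; apply: funext => i; by rewrite nmem_setn bv.
  by move: vin; rewrite !inE => /orP[] /eqP ->.
have extP lt lt' s1 : (forall q q', q < Q -> q' < Q -> lt q q' = lt' q q') ->
    P lt s1 -> P lt' s1.
  by move=> e [h1 h2]; split => // k q q' j hq hq' jB; rewrite -e //; apply: h2.
suff [e h] : P (fun q q' => q < Q) (den (PFor 41 25 0 (PFor 42 25 0 body)) s).
  split => //; last by move=> k q q' kn hq hq' _ j jB; rewrite (proj1 (h k.+1 q q' j hq hq' jB)).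
  move=> q q' j hq hq' jV; have jB : j < B := co_bound (ev_co e) jV.
  have [h1 h2] := h 0 q q' j hq hq' jB; rewrite h2 // /reached h1 hq.
  by case: (j == 0).
apply: (@for_ind _ 41 25 0 _ _ (fun q => P (fun q1 _ => q1 < q))) => //.
- exact: ty_n (ev_ty ev).
- by apply: (set_var) => //; split => // k q q' j *; rewrite z /= andbF.
move=> q s1 qQ e41 hn1 _ h1; apply: (set_var) => //.
suff : P (fun q1 q1' => (q1 < q) || (q1 == q) && (q1' < Q)) (den (PFor 42 25 0 body) s1).
  by apply: (extP) => a b aQ bQ; lia.
apply: (@for_ind _ 42 25 0 _ _ (fun q' => P (fun q1 q1' => (q1 < q) || (q1 == q) && (q1' < q')))) => //.
- exact: ty_n (ev_ty (proj1 h1)).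
- by apply: (set_var) => //; apply: (extP) h1 => a b _ _; lia.
move=> q' s2 q'Q e42 hn2 _ [e2 h2]; apply: (set_var) => //.
have e41' : nmem s2 41 0 = q by rewrite hn2.
have ea : neval s2 (addr (NConst 0) (var 41) (var 42) (NConst 0)) = cell 0 q q' 0.
  exact: addr_eval (ev_ad e2) _ _ _ _ _ _ _.
have es : den body s2 = setr 11 (cell 0 q q' 0) 0%R (setn 49 (cell 0 q q' 0) 1 s2).
  by rewrite -ea /body /= subrr.
split; first exact: env_den.
move=> k q1 q1' j hq hq' jB; have [g1 g2] := h2 k q1 q1' j hq hq' jB.
rewrite es /optval /= /upd /= g1 !cell_inj // eqxx /=; split.
  rewrite [q1' < q'.+1]ltnS [q1' <= q']leq_eqVlt.
  by case: (k == 0); case: (q1 == q); case: (q1' == q'); case: (j == 0);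
    case: (q1 < q); case: (q1' < q').
case: (eqVneq q1 q) => [eq|nq] /=; last by rewrite !orbF; move: g2; rewrite (negbTE nq) orbF.
case: (eqVneq q1' q') => [eq'|nq'] //= lt; apply: g2.
by move: lt; rewrite eq eqxx ltnn /= ltnS leq_eqVlt (negbTE nq').
Qed.

End Specs.

(** * Correctness of the output *)

Section Specs.
Variables (R : realType) (n m : nat) (I : instance R n m).
Variables (N B : nat) (V : seq nat) (w : nat -> nat).
Local Notation Q := (N * m).
Local Notation env := (env I N B V w).
Local Notation fin := (@reached R m N B).
Local Notation val := (@optval R m N B).
Local Notation cell := (cell m N B).
Implicit Types s : state R.
Hypotheses (m_gt0 : 0 < m) (N_gt1 : 1 < N).

Let Q0 : 0 < Q. Proof. by rewrite muln_gt0 m_gt0 andbT ltnW. Qed.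
Let Qm : m < Q. Proof. by rewrite -[ltnLHS]mul1n ltn_mul2r m_gt0. Qed.

Lemma best_phase_spec s : env s -> let s' := den best_phase s in
  nmem s' 3 0 = nmem s' 53 0 /\
  ([/\ nmem s' 53 0 = 1, nmem s' 54 0 \in V, fin s n 0 m (nmem s' 54 0) &
       forall j, j \in V -> fin s n 0 m j ->
         (val s n 0 m (nmem s' 54 0) <= val s n 0 m j)%R]
   \/ (nmem s' 53 0 = 0 /\ forall j, j \in V -> ~~ fin s n 0 m j)).
Proof.
move=> ev; rewrite /best_phase (den_seq (setv 53 _)); set s0 := den (setv 53 _) s.
set j := NGet 36 (var 44); set a := addr _ _ _ _.
set body := PIf _ _ _.
rewrite (den_seq (PFor _ _ _ _)).
have ev0 : env s0 by exact: env_den.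
have [f49 f11 f53] : [/\ nmem s0 49 = nmem s 49, rmem s0 11 = rmem s 11 & nmem s0 53 0 = 0].
  by [].
clearbody s0.
pose P t s1 := ([/\ nmem s1 53 0 = 1, nmem s1 54 0 \in V /\ fin s n 0 m (nmem s1 54 0),
     rmem s1 12 0 = val s n 0 m (nmem s1 54 0) &
       forall i, i < t -> fin s n 0 m (nth 0 V i) ->
         (val s n 0 m (nmem s1 54 0) <= val s n 0 m (nth 0 V i))%R]
   \/ (nmem s1 53 0 = 0 /\ forall i, i < t -> ~~ fin s n 0 m (nth 0 V i))).
have hP : P (size V) (den (PFor 44 38 0 body) s0).
  apply: (@for_ind _ 44 38 0 _ _ P) => //.
  - exact: co_size (ev_co ev0).
  - by right; split.
  move=> t s1 tV et hn hr IH.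
  have ev1 : env s1 by exact: env_out ev0 hn hr _.
  have jV : nth 0 V t \in V by apply: mem_nth.
  have ej : neval s1 j = nth 0 V t by rewrite /= et (co_vec (ev_co ev1)).
  have ea : neval s1 a = cell n 0 m (nth 0 V t).
    apply: (addr_eval (ev_ad ev1)) => //; first exact: in_n (ev_in ev1).
    exact: in_m (ev_in ev1).
  have e49 : nmem s1 49 = nmem s 49 by rewrite hn.
  have e11 : rmem s1 11 = rmem s 11 by rewrite hr.
  have ec : beval s1 (BAnd (NEq (NGet 49 a) (NConst 1))
              (BNot (BAnd (NEq (var 53) (NConst 1)) (BRealLe (rvar 12) (RGet 11 a)))))
      = fin s n 0 m (nth 0 V t) &&
        ~~ ((nmem s1 53 0 == 1) && (rmem s1 12 0 <= val s n 0 m (nth 0 V t))%R).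
    rewrite -[beval _ _]/((nmem s1 49 (neval s1 a) <= 1) && (1 <= nmem s1 49 (neval s1 a)) &&
      ~~ ((nmem s1 53 0 <= 1) && (1 <= nmem s1 53 0) &&
        (rmem s1 12 0 <= rmem s1 11 (neval s1 a))%R)).
    by rewrite -!eqn_leq ea e49 e11.
  rewrite /body den_if ec; case: ifP => c.
    have /andP[ft c2] := c.
    have es : den (setv 53 (NConst 1) ;; setrv 12 (RGet 11 a) ;; setv 54 j)%prog s1 =
      setn 54 0 (nth 0 V t) (setr 12 0 (val s n 0 m (nth 0 V t)) (setn 53 0 1 s1)).
      by rewrite /optval -e11 -ea -ej.
    rewrite es; left; split => //.
    move=> i; rewrite ltnS leq_eqVlt [nmem _ _ _]/= /upd /= => /orP[/eqP -> //|it fi].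
    case: IH => [[h1 h2 h3 h4]|[h1 h2]]; last by have := h2 i it; rewrite fi.
    apply: le_trans (h4 i it fi).
    by move: c2; rewrite h1 eqxx /= -ltNge h3 => /ltW.
  case: IH => [[h1 h2 h3 h4]|[h1 h2]].
    left; split => // i; rewrite ltnS leq_eqVlt => /orP[/eqP ->|it fi]; last exact: h4.
    move=> ft; move: c; rewrite ft h1 eqxx /= => /negbFE; by rewrite h3.
  right; split => // i; rewrite ltnS leq_eqVlt => /orP[/eqP ->|it]; last exact: h2.
  by move: c; rewrite h1 /= andbT => ->.
move: hP; move: (den (PFor 44 38 0 body) s0) => s1 hP; split; first by [].
case: hP => [[h1 [h2 h3] h4 h5]|[h1 h2]]; [left|right]; split => //.
  by move=> i iV; have := h5 (index i V); rewrite index_mem nth_index //; apply.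
by move=> i iV; have := h2 (index i V); rewrite index_mem nth_index //; apply.
Qed.

(** * Recovering the types of the points from the recorded choices *)

Section Walk.
Variable s0 : state R.
Hypothesis ev0 : env s0.
Local Notation Y := (rmem s0 8).
Local Notation tpos := (rmem s0 7).
Local Notation chb := (@chosen R m N B s0).
Local Notation chu := (@chlow R m N B s0).
Local Notation chv := (@chup R m N B s0).
Local Notation trace := (trace Y tpos chb chu chv).
Hypothesis tab : table_ok n Q (minsep I) (yb I) (yt I) Y (rmem s0 9) tpos
  (nmem s0 11) w (nmem s0 24) (fin s0) (val s0) chb chu chv (mem V).
Hypothesis all_in : forall i, i < n -> strip Y tpos 0 m i.

(** Before the walk passes index [i], the banks 55 to 57 name a reached entry whose strip contains
    [i] and whose trace at [i] is that of the full strip. From [i] on, the type is stored and only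
    has to persist. *)
Definition walking (J i k : nat) s : Prop :=
  (i < k /\ exists q q' j, [/\ q < Q, q' < Q, j \in V, fin s0 k q q' j &
     [/\ strip Y tpos q q' i, nmem s 55 0 = q, nmem s 56 0 = q', nmem s 57 0 = j
       & trace n 0 m J i = trace k q q' j i]])
  \/ (k <= i /\ nmem s 58 i = trace n 0 m J i).

Definition same_tables s : Prop :=
  [/\ env s, nmem s 50 = nmem s0 50, nmem s 51 = nmem s0 51,
      nmem s 52 = nmem s0 52 & rmem s 8 = Y /\ rmem s 7 = tpos].

Lemma walk_body_spec J i k s : same_tables s -> k < n -> i < n ->
  nmem s 40 0 = n - k.+1 -> nmem s 12 0 = i ->
  walking J i k.+1 s -> walking J i k (den walk_body s).
Proof.
move=> [ev e50 e51 e52 [e8 e7]] kn iN e40 e12 hw.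
rewrite /walk_body.
set ek := NSub (NSub _ _) _; set a := addr _ _ _ _; set c := NGet 50 a.
have hk : neval s ek = k by rewrite /= (in_n (ev_in ev)) e40; lia.
rewrite den_if.
have es : beval s (in_strip (RGet 8 ek) (RGet 7 (var 55)) (RGet 7 (var 56))) =
    strip Y tpos (nmem s 55 0) (nmem s 56 0) k.
  rewrite -[beval _ _]/((rmem s 7 (nmem s 55 0) <= rmem s 8 (neval s ek))%R &&
    ~~ (rmem s 7 (nmem s 56 0) <= rmem s 8 (neval s ek))%R).
  by rewrite hk e8 e7 -ltNge.
rewrite es {es}.
have eqi : beval s (NEq (var 12) ek) = (i == k).
  by rewrite -[beval _ _]/((nmem s 12 0 <= neval s ek) && (neval s ek <= nmem s 12 0)) -eqn_leq hk e12.
case: hw => [[ik [q [q' [j [qQ q'Q jV fj [si e55 e56 e57 et]]]]]]|[ki e58]]; last first.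
  right; split; first exact: ltnW.
  case: ifP => // _; rewrite den_if eqi gtn_eqF // den_if.
  case: ifP => _; exact: e58.
have ea : neval s a = cell k.+1 q q' j.
  have hk1 : neval s (NAdd ek (NConst 1)) = k.+1.
    by rewrite -[LHS]/(neval s ek + 1) hk addn1.
  exact: (addr_eval (ev_ad ev)).
have ec : neval s c = chb k.+1 q q' j.
  by rewrite -[LHS]/(nmem s 50 (neval s a)) ea e50.
rewrite e55 e56; case/boolP: (strip Y tpos q q' k) => sk; last first.
  left; split.
    rewrite ltn_neqAle -ltnS ik andbT; apply: contraNneq sk => <-; exact: si.
  exists q, q', j; have [f1 _] := tab_skip tab kn qQ q'Q jV sk.
  by rewrite -f1; split => //; split => //; rewrite et /= sk.
have [[bQ _ vb [uV vV] [fu fv]] _ _] := tab_choice tab kn qQ q'Q jV sk fj.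
have etr : trace k.+1 q q' j i = if i == k then chb k.+1 q q' j
    else if (tpos (chb k.+1 q q' j) <= Y i)%R
    then trace k (chb k.+1 q q' j) q' (chv k.+1 q q' j) i
    else trace k q (chb k.+1 q q' j) (chu k.+1 q q' j) i by rewrite /= sk.
rewrite etr in et; move: ec bQ vb uV vV fu fv et {etr}.
set b := chb k.+1 q q' j; set u := chu k.+1 q q' j; set v := chv k.+1 q q' j.
move=> ec bQ vb uV vV fu fv et.
rewrite den_if eqi; case: eqP et => [eik et|nik et].
  right; split; first by rewrite eik.
  rewrite -[nmem _ _ _]/(upd (nmem s) 58 (nmem s 12 0) (neval s c) 58 i).
  by rewrite /upd e12 !eqxx ec et.
have {}ik : i < k by rewrite ltn_neqAle -ltnS ik andbT; apply/eqP.
left; split => //; rewrite den_if.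
have -> : beval s (BRealLe (RGet 7 c) (RGet 8 (var 12))) = (tpos b <= Y i)%R.
  by rewrite -[LHS]/(rmem s 7 (neval s c) <= rmem s 8 (nmem s 12 0))%R ec e7 e8 e12.
move: et; have /andP[s1 s2] := si; case: ifP => hb et.
  have -> : den (setv 46 c ;; setv 57 (NGet 52 a) ;; setv 55 (var 46))%prog s =
    setn 55 0 b (setn 57 0 v (setn 46 0 b s)).
    by rewrite -ec /v /chup -e52 -ea.
  exists b, q', v; split => //; split => //.
  by rewrite /strip hb.
have -> : den (setv 46 c ;; setv 57 (NGet 51 a) ;; setv 56 (var 46))%prog s =
    setn 56 0 b (setn 57 0 u (setn 46 0 b s)).
  by rewrite -ec /u /chlow -e51 -ea.
exists q, b, u; split => //; split => //.
by rewrite /strip s1 ltNge hb.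
Qed.

Lemma walk_phase_spec J s : same_tables s -> nmem s 54 0 = J -> J \in V ->
  fin s0 n 0 m J ->
  forall i, i < n -> nmem (den walk_phase s) 58 i = trace n 0 m J i.
Proof.
move=> st eJ JV fJ; rewrite /walk_phase; set body := (setv 55 _ ;; _)%prog.
have tab_out (ws wr : seq nat) (t t' : state R) : same_tables t ->
  (forall b, b \notin ws -> nmem t' b = nmem t b) ->
  (forall b, b \notin wr -> rmem t' b = rmem t b) ->
  all [pred b | b \notin ws] (env_n ++ [:: 50; 51; 52]) &&
  all [pred b | b \notin wr] env_r -> same_tables t'.
  move=> [h1 h2 h3 h4 [h5 h6]] hn hr; rewrite all_cat => /andP[/andP[an1 /allP an2] ar].
  have rr b : b \in env_r -> rmem t' b = rmem t b by move=> hb; apply: hr; apply: (allP ar).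
  split; first by apply: (env_out h1 hn hr); rewrite an1 ar.
  - by rewrite hn ?h2 //; apply: an2.
  - by rewrite hn ?h3 //; apply: an2.
  - by rewrite hn ?h4 //; apply: an2.
  - by rewrite !rr.
pose P x s1 := forall i, i < x -> nmem s1 58 i = trace n 0 m J i.
have evs : env s by case: st.
apply: (@for_ind _ 12 0 0 _ _ P) => //; first exact: in_n (ev_in evs).
move=> i s1 iN e12 hn hr IH.
have st1 : same_tables s1 by exact: tab_out st hn hr _.
have e54 : nmem s1 54 0 = J by rewrite hn.
rewrite (den_seq (setv 55 _)) (den_seq (setv 56 _)) (den_seq (setv 57 _)).
set s2 := den (setv 57 _) _.
have st2 : same_tables s2.
  apply: (tab_out [:: 55; 56; 57] [::] s1) => // b; rewrite !inE !negb_or.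
  move=> /and3P[/negbTE b1 /negbTE b2 /negbTE b3].
  by apply: funext => y; rewrite /s2 /= /upd b1 b2 b3.
have [f12 f58] : nmem s2 12 0 = i /\ nmem s2 58 = nmem s1 58 by [].
have ev1 : env s1 by case: st1.
have [f55 f56 f57] : [/\ nmem s2 55 0 = 0, nmem s2 56 0 = m & nmem s2 57 0 = J].
  by split => //; rewrite /= /upd /= ?(in_m (ev_in ev1)).
clearbody s2.
pose P' x s3 := walking J i (n - x) s3 /\ forall y, y <> i -> nmem s3 58 y = nmem s1 58 y.
have [] : P' n (den (PFor 40 0 0 walk_body) s2).
  apply: (@for_ind _ 40 0 0 _ _ P') => //.
  - by case: st2 => ev _ _ _ _; exact: in_n (ev_in ev).
  - split; last by move=> y _; rewrite nmem_setn /= f58.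
    rewrite subn0; left; split => //; exists 0, m, J; split => //.
    by split => //; apply: all_in.
  move=> x s3 xn e40 hn' hr' [hw h58].
  have st3 : same_tables s3 by exact: tab_out st2 hn' hr' _.
  have e12' : nmem s3 12 0 = i by rewrite hn'.
  split.
    have ek : n - x.+1 < n by lia.
    have eq1 : (n - x.+1).+1 = n - x by lia.
    have e40' : nmem s3 40 0 = n - (n - x.+1).+1 by rewrite eq1 e40; lia.
    rewrite -eq1 in hw.
    have := walk_body_spec st3 ek iN e40' e12' hw.
    by case=> [[h1 [q [q' [j [a1 a2 a3 a4 [a5 a6 a7 a8 a9]]]]]]|[h1 h2]]; [left|right];
      split => //; exists q, q', j.
  move=> y yi; rewrite nmem_setn [_ && _]/= -h58 //.
  rewrite /walk_body den_if; case: ifP => // _; rewrite den_if; case: ifP => _.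
    rewrite -[LHS]/(upd (nmem s3) 58 (nmem s3 12 0) _ 58 y) /upd e12'.
    by move/eqP/negbTE: yi => ->.
  by rewrite den_if; case: ifP.
rewrite subnn => -[[]//|[_ e58]] oth x.
rewrite ltnS leq_eqVlt => /orP[/eqP ->|lt]; first exact: e58.
rewrite -[LHS]/(nmem (den (PFor 40 0 0 walk_body) s2) 58 x) oth ?IH //.
by move=> e; rewrite e ltnn in lt.
Qed.

End Walk.

(** The types in order of first occurrence, which is the order in which the program numbers the
    labels. *)
Fixpoint types_seen (f : nat -> nat) (k : nat) : seq nat :=
  if k is k'.+1 then
    let l := types_seen f k' in if f k' \in l then l else rcons l (f k')
  else [::].

Lemma types_seen_uniq f k : uniq (types_seen f k).
Proof.
elim: k => //= k IHk; case: ifPn => // nk.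
by rewrite rcons_uniq nk.
Qed.

Lemma types_seenP f k t : reflect (exists2 i, i < k & f i = t) (t \in types_seen f k).
Proof.
elim: k t => [|k IHk] t /=; first by constructor; case.
case: ifPn => h.
  apply: (iffP (IHk t)) => [[i ik e]|[i]]; first by exists i => //; apply: ltnW.
  rewrite ltnS leq_eqVlt => /orP[/eqP -> <-|ik e]; last by exists i.
  by have [i' h1 h2] := IHk _ h; exists i'.
rewrite mem_rcons inE; apply: (iffP orP) => [[/eqP ->|/IHk[i ik e]]|[i]].
- by exists k.
- by exists i => //; apply: ltnW.
- rewrite ltnS leq_eqVlt => /orP[/eqP -> <-|ik e]; first by left; rewrite eqxx.
  by right; apply/IHk; exists i.
Qed.

Lemma output_phase_spec s (f od : nat -> nat) : env s ->
  (forall k, k < n -> nmem s 58 k = f k) -> (forall t, nmem s 59 t = 0) ->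
  (forall k, k < n -> nmem s 10 k = od k) ->
  (forall k l, k < n -> l < n -> od k = od l -> k = l) ->
  (forall k, k < n -> nmem s 24 (f k) = nmem s 11 k) ->
  let s' := den output_phase s in let l := types_seen f n in
  [/\ nmem s' 3 0 = nmem s 3 0, nmem s' 3 1 = size l,
    forall t, t < size l -> nmem s' 4 t = nmem s 24 (nth 0 l t),
    forall t, t < size l -> rmem s' 3 t = rmem s 7 (nth 0 l t) &
    forall k, k < n -> nmem s' 5 (od k) = index (f k) l].
Proof.
move=> ev e58 e59 e10 odi etc; rewrite /output_phase.
set t := NGet 58 (var 12); set body := (PIf _ _ _ ;; _)%prog.
rewrite (den_seq (setv 60 _)) (den_seq (PFor _ _ _ _)); set s0 := den (setv 60 _) s.
have ev0 : env s0 by exact: env_den.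
have [g60 g58 g59 [g10 g24 g11 g7 g3]] : [/\ nmem s0 60 0 = 0, nmem s0 58 = nmem s 58,
  nmem s0 59 = nmem s 59 & [/\ nmem s0 10 = nmem s 10, nmem s0 24 = nmem s 24,
  nmem s0 11 = nmem s 11, rmem s0 7 = rmem s 7 & nmem s0 3 = nmem s 3]] by [].
clearbody s0.
pose P k s1 := let l := types_seen f k in
  [/\ nmem s1 60 0 = size l,
    forall x, nmem s1 59 x = if x \in l then (index x l).+1 else 0,
    forall x, x < size l -> nmem s1 4 x = nmem s 24 (nth 0 l x),
    forall x, x < size l -> rmem s1 3 x = rmem s 7 (nth 0 l x) &
    forall i, i < k -> nmem s1 5 (od i) = index (f i) l].
have hP : P n (den (PFor 12 0 0 body) s0).
  apply: (@for_ind _ 12 0 0 _ _ P) => //; first exact: in_n (ev_in ev0).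
    by split => // x; rewrite nmem_setn /= g59 e59.
  move=> k s1 kn e12 hn hr [h1 h2 h3 h4 h5].
  have et : neval s1 t = f k by rewrite /= e12 hn // g58 e58.
  have b58 : nmem s1 58 k = f k by rewrite hn // g58 e58.
  have b10 : nmem s1 10 k = od k by rewrite hn // g10 e10.
  have b11 : nmem s1 11 k = nmem s 24 (f k) by rewrite hn // g11 etc.
  have b7 : rmem s1 7 = rmem s 7 by rewrite hr // g7.
  rewrite /body (den_seq (PIf _ _ _)) den_if.
  have -> : beval s1 (NEq (NGet 59 t) (NConst 0)) = (f k \notin types_seen f k).
    rewrite -[LHS]/((nmem s1 59 (neval s1 t) <= 0) && (0 <= nmem s1 59 (neval s1 t))).
    by rewrite andbT et h2; case: ifP.
  rewrite /P [types_seen f k.+1]/=; case: ifPn => [nk|/negPn kk].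
    rewrite (negbTE nk); set s2 := den _ s1.
    have es : s2 = setn 59 (f k) (size (types_seen f k)).+1 (setn 60 0 (size (types_seen f k)).+1
      (setr 3 (size (types_seen f k)) (rmem s 7 (f k))
      (setn 4 (size (types_seen f k)) (nmem s 24 (f k)) s1))).
      by rewrite -(addn1 (size _)) -h1 -b11 -b7 -et -e12.
    have [k60 k59 k4 [k3 k5 k12 k10 k58]] : [/\ nmem s2 60 0 = (size (types_seen f k)).+1,
       forall x, nmem s2 59 x = if x == f k then (size (types_seen f k)).+1 else nmem s1 59 x,
       forall x, nmem s2 4 x = if x == size (types_seen f k) then nmem s 24 (f k) else nmem s1 4 x &
       [/\ forall x, rmem s2 3 x = if x == size (types_seen f k) then rmem s 7 (f k) else rmem s1 3 x,
         nmem s2 5 = nmem s1 5, nmem s2 12 0 = k, nmem s2 10 k = od k & nmem s2 58 k = f k]].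
      by rewrite es; split => //; split.
    clearbody s2; clear es.
    have e5 : nmem (den (PN 5 (NGet 10 (var 12)) (NSub (NGet 59 t) (NConst 1))) s2) 5 =
       fun x => if x == od k then size (types_seen f k) else nmem s1 5 x.
      by apply: funext => x; rewrite /= /upd /= k12 k10 k58 k59 eqxx subn1 k5.
    have stab x : x \in types_seen f k -> index x (rcons (types_seen f k) (f k)) = index x (types_seen f k).
      by move=> hx; rewrite -cats1 index_cat hx.
    split; rewrite ?size_rcons.
    - exact: k60.
    - move=> x; rewrite -[LHS]/(nmem s2 59 x) k59 mem_rcons inE; case: eqP => [->|ne] /=.
        by rewrite -cats1 index_cat (negbTE nk) /= eqxx addn0.
      by rewrite h2; case: ifP => // hx; rewrite stab.
    - move=> x; rewrite -[nmem _ _ _]/(nmem s2 4 x) k4 nth_rcons ltnS leq_eqVlt.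
      by case: eqP => [-> _|_ /= lt]; rewrite ?ltnn ?eqxx // lt h3.
    - move=> x; rewrite -[rmem _ _ _]/(rmem s2 3 x) k3 nth_rcons ltnS leq_eqVlt.
      by case: eqP => [-> _|_ /= lt]; rewrite ?ltnn ?eqxx // lt h4.
    - move=> i; rewrite nmem_setn [_ && _]/= e5 ltnS leq_eqVlt => /orP[/eqP ->|ik].
        by rewrite eqxx -cats1 index_cat (negbTE nk) /= eqxx addn0.
      have -> : (od i == od k) = false.
        apply/eqP => e; move: (ik).
        by rewrite (odi i k (ltn_trans ik kn) kn e) ltnn.
      by rewrite h5 // stab //; apply/types_seenP; exists i.
  rewrite kk.
  have e5 : nmem (den (PN 5 (NGet 10 (var 12)) (NSub (NGet 59 t) (NConst 1))) s1) 5 =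
       fun x => if x == od k then index (f k) (types_seen f k) else nmem s1 5 x.
    have et' : nmem s1 58 k = f k by rewrite -et /= e12.
    by apply: funext => x; rewrite /= /upd /= e12 b10 et' h2 kk subn1.
  split.
  - exact: h1.
  - exact: h2.
  - exact: h3.
  - exact: h4.
  - move=> i; rewrite nmem_setn [_ && _]/= e5 ltnS leq_eqVlt => /orP[/eqP ->|ik].
      by rewrite eqxx.
    case: eqP => [e|_]; last exact: h5.
    by rewrite (odi i k (ltn_trans ik kn) kn e).
have k3 : nmem (den (PFor 12 0 0 body) s0) 3 = nmem s 3 by rewrite nframe.
move: (den (PFor 12 0 0 body) s0) hP k3 => s1 [h1 h2 h3 h4 h5] k3.
split => //.
by rewrite /= /upd /= k3.
Qed.

End Specs.

(** * Codes and bounds on the number of labels *)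

Section Digits.
Variable n : nat.
Local Notation radix := (radix n).

Lemma digits_lt c (d : nat -> nat) : (forall e, e < c -> d e <= n) ->
  \sum_(e < c) d e * radix e < radix c.
Proof.
elim: c => [|c IHc] h; first by rewrite big_ord0.
rewrite big_ord_recr /= /radix expnS -/(radix c).
have lt : \sum_(e < c) d e * radix e < radix c by apply: IHc => e ec; apply/h/ltnW.
apply: (@leq_trans ((d c).+1 * radix c)); first by rewrite mulSn ltn_add2r.
by rewrite leq_mul2r ltnS h ?orbT.
Qed.

Lemma digits_inj c (d d' : nat -> nat) : (forall e, e < c -> d e <= n) ->
  (forall e, e < c -> d' e <= n) ->
  \sum_(e < c) d e * radix e = \sum_(e < c) d' e * radix e ->
  forall e, e < c -> d e = d' e.
Proof.
elim: c => // c IHc h h' e; move: e; rewrite !big_ord_recr /=.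
have l1 : \sum_(e < c) d e * radix e < radix c by apply: digits_lt => e ec; apply/h/ltnW.
have l2 : \sum_(e < c) d' e * radix e < radix c by apply: digits_lt => e ec; apply/h'/ltnW.
rewrite ![_ + _ * _]addnC => /eqP; rewrite flat_eq // => /andP[/eqP e1 /eqP e2] e.
rewrite ltnS leq_eqVlt => /orP[/eqP -> //|ec].
by apply: IHc ec => // x xc; [apply/h/ltnW|apply/h'/ltnW].
Qed.

End Digits.

(** * Vector codes as digit expansions *)

Section Counting.
Variables (n m : nat) (C kv : nat -> nat).
Hypothesis C_lt : forall k, k < n -> C k < m.
Hypothesis kv_gt0 : forall c, c < m -> 0 < kv c.

Definition nonfirst (k : nat) : bool := has (fun y => (k < y) && (C y == C k)) (iota 0 n).

Definition extras (P : pred 'I_n) (c : nat) : nat :=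
  #|[pred k : 'I_n | P k && nonfirst k && (C k == c)]|.

(** The leftmost point of color [c], if there is one, is not an extra. Hence the digits of an actual
    assignment stay below n + 1 and its code involves no carry, even though sums of arbitrary codes
    could produce one. *)
Lemma extras_lt P c : 0 < n -> extras P c < n.
Proof.
move=> n0; rewrite -[ltnRHS]card_ord.
case: (pickP [pred k : 'I_n | P k && nonfirst k && (C k == c)]) => [k0 /andP[_ ec]|h0]; last first.
  by rewrite /extras eq_card0 // card_ord.
pose k := [arg max_(k > k0 | C k == c) (k : nat)].
have [ck mk] : C k == c /\ forall l : 'I_n, C l == c -> l <= k.
  by rewrite /k; case: arg_maxnP => [|l h1 h2]; [exact: ec|split].
apply: proper_card; apply/properP; split; first by apply/fintype.subsetP.
exists k => //; rewrite inE negb_and negb_and; apply/orP; left; apply/orP; right.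
apply/hasPn => y; rewrite mem_iota add0n => /= yn; apply/negP => /andP[ky /eqP e].
by have := mk (Ordinal yn); rewrite /= e => /(_ ck); rewrite leqNgt ky.
Qed.

Lemma weight_digits (P : pred 'I_n) :
  \sum_(k < n | P k) first_weight n C k = \sum_(c < m) extras P c * radix n c.
Proof.
transitivity (\sum_(k < n | P k && nonfirst k) radix n (C k)).
  rewrite [RHS]big_mkcondr /=; apply: eq_bigr => k _.
  by rewrite /first_weight -/(nonfirst k).
rewrite (partition_big (fun k : 'I_n => Ordinal (C_lt (ltn_ord k))) xpredT) //=.
apply: eq_bigr => c _; rewrite -sum_nat_const.
apply: eq_big => [k|k /andP[_ /eqP <-]] //.
Qed.

(** The digits on both sides are at most n, so uniqueness of the expansion identifies them with the
    numbers of extras, and membership can be read color by color. *)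
Lemma code_vecs (P : pred 'I_n) : 0 < n ->
  (\sum_(k < n | P k) first_weight n C k \in vecs n kv m) <->
  (forall c, c < m -> extras P c < kv c).
Proof.
move=> n0; rewrite weight_digits; split.
  case/vecsP => d dc e c cm.
  have -> : extras P c = d c.
    apply: (digits_inj _ _ e) => // x xm; first exact/ltnW/extras_lt.
    by apply: leq_trans (ltnW (dc x xm)) _; apply: geq_minr.
  by apply: leq_trans (dc c cm) _; apply: geq_minl.
move=> h; apply/vecsP; exists (extras P) => // c cm.
by rewrite /cap leq_min h // extras_lt.
Qed.

Lemma extras_sub (P P' : pred 'I_n) c : (forall k, P k -> P' k) ->
  extras P c <= extras P' c.
Proof.
move=> h; apply: subset_leq_card; apply/fintype.subsetP => k; rewrite !inE.
by move=> /andP[/andP[/h -> ->] ->].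
Qed.

End Counting.

Section Bounds.
Variables (R : realType) (n m : nat) (I : instance R n m).
Hypothesis wfI : wf_instance I.
Hypothesis n_gt0 : 0 < n.
Local Notation rk := (rk I).

Lemma global_boundP K (L : labeling R n m) : backbone_labeling I L ->
  global_bound K L <-> \sum_(i < n | opener I (heights L) i) 1 \in iota 0 K.+1.
Proof.
move=> BL; rewrite /global_bound (nlab_heights wfI BL) sum1_card mem_iota add0n /=.
by rewrite ltnS.
Qed.

Variables (C : nat -> nat) (kc : 'I_m -> nat).
Hypothesis C_rk : forall i, C (rk i) = pc I i.
Hypothesis kc_gt0 : forall c, 0 < kc c.
Local Notation kv := (table 0 kc).

Let C_lt k : k < n -> C k < m.
Proof. by move=> /(rk_onto wfI)[i <-]; rewrite C_rk. Qed.

Lemma table_ord T (d : T) (f : 'I_m -> T) (i : 'I_m) : table d f i = f i.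
Proof. by rewrite /table valK. Qed.

Lemma kv_gt0 c : c < m -> 0 < kv c.
Proof. by move=> cm; rewrite (table_ord 0 kc (Ordinal cm)). Qed.

Lemma nonfirstP i : reflect (exists2 j, px I j < px I i & pc I j = pc I i)%R
  (nonfirst n C (rk i)).
Proof.
apply: (iffP hasP) => [[y]|[j lt e]].
  rewrite mem_iota add0n => /= /(rk_onto wfI)[j <-]; rewrite rk_lt !C_rk.
  by move=> /andP[lt /eqP e]; exists j => //; apply: val_inj.
by exists (rk j); rewrite ?mem_iota ?rk_ord // rk_lt lt !C_rk e eqxx.
Qed.

(** The leftmost point of a color always opens a label. So a color that occurs has one label more
    than the code counts, and at most [kc c] labels means a digit below [kc c]. *)
Lemma color_boundP (L : labeling R n m) : backbone_labeling I L ->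
  color_bound kc L <->
  \sum_(i < n | opener I (heights L) i) first_weight n C (rk i) \in vecs n kv m.
Proof.
move=> BL; have hf := heights_feasible wfI BL.
pose o k := [exists i, (rk i == k) && opener I (heights L) i].
have orank i : o (rk i) = opener I (heights L) i.
  apply/existsP/idP => [[j /andP[/eqP /(rk_inj wfI) ->]]//|oi].
  by exists i; rewrite eqxx.
have -> : \sum_(i < n | opener I (heights L) i) first_weight n C (rk i) =
    \sum_(k < n | o k) first_weight n C k.
  by rewrite (sum_rk wfI o); apply: eq_bigl => i; rewrite orank.
rewrite code_vecs //.
have ext (c : 'I_m) : extras C (fun k : 'I_n => o k) c =
    #|[pred i | opener I (heights L) i && nonfirst n C (rk i) && (pc I i == c)]|.
  rewrite /extras -!sum1_card.
  rewrite (sum_rk wfI (fun k => o k && nonfirst n C k && (C k == c)) (fun=> 1)).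
  by apply: eq_bigl => i; rewrite orank C_rk.
have split_card (c : 'I_m) : #|[pred i | opener I (heights L) i && (pc I i == c)]| =
    extras C (fun k : 'I_n => o k) c +
    #|[pred i | ~~ nonfirst n C (rk i) && (pc I i == c)]|.
  rewrite ext -(cardID [pred i | nonfirst n C (rk i)]); congr (_ + _).
    apply: eq_card => i; rewrite !inE.
    by case: (opener _ _ _); case: (nonfirst _ _ _); case: (_ == _).
  apply: eq_card => i; rewrite !inE; case hn: (nonfirst n C (rk i)) => //=.
  case: eqP => ci; rewrite ?andbF // andbT.
  apply/forallP => j; apply/implyP => lt; apply/eqP => e.
  move/negP: (negbT hn); apply; apply/nonfirstP; exists j => //.
  exact: (hf_color hf e).
have first_le1 (c : 'I_m) : #|[pred i | ~~ nonfirst n C (rk i) && (pc I i == c)]| <= 1.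
  apply/card_le1_eqP => i j; rewrite !inE => /andP[h1 /eqP c1] /andP[h2 /eqP c2].
  have [_ _ _ pxI _] := wfI.
  case: (ltgtP (px I i) (px I j)) => [lt|lt|/pxI //].
    by exfalso; move/negP: h2; apply; apply/nonfirstP; exists i; rewrite // c1 c2.
  by exfalso; move/negP: h1; apply; apply/nonfirstP; exists j; rewrite // c1 c2.
split => [h c cm|h c].
  have := h (Ordinal cm); rewrite (color_heights wfI BL) split_card.
  rewrite (table_ord 0 kc (Ordinal cm)) /=.
  case: (posnP #|[pred i | ~~ nonfirst n C (rk i) && (pc I i == Ordinal cm)]|); last by lia.
  (* Without a leftmost point the color does not occur; its digit is 0, below the positive bound. *)
  move/card0_eq => h0 _.
  have -> : extras C (fun k : 'I_n => o k) (Ordinal cm) = 0; last exact: kc_gt0.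
  rewrite ext; apply: eq_card0 => i; rewrite !inE; apply/negP.
  case/andP => _ /eqP ci.
  pose j := [arg min_(j < i | pc I j == Ordinal cm) px I j]%O.
  have [cj mj] : pc I j == Ordinal cm /\ forall l, pc I l == Ordinal cm -> (px I j <= px I l)%R.
    by rewrite /j; case: arg_minP => [|l h1 h2]; rewrite ?ci.
  have := h0 j; rewrite !inE cj andbT => /negbFE /nonfirstP[l lt el].
  by have := mj l; rewrite el cj => /(_ isT); rewrite leNgt lt.
rewrite (color_heights wfI BL) split_card -[kc c](table_ord 0 kc).
by apply: leq_trans (leq_add (leqnn _) (first_le1 c)) _; rewrite addn1 h.
Qed.

End Bounds.

(** * From the filled table to an optimal labeling *)

Section Tail.
Variables (R : realType) (n m : nat) (I : instance R n m) (horiz : bool).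
Hypotheses (wfI : wf_instance I) (n_gt0 : 0 < n).
Local Notation rk := (rk I).
Local Notation N := (ncand n).
Local Notation D := (minsep I).
Implicit Types s : state R.

Record ready (V : seq nat) (B : nat) (w : nat -> nat) s : Prop := Ready {
  rd_in : input_ok I s;
  rd_sorted : forall i, sorted_at I s horiz i;
  rd_anchor : rmem s 4 n = yb I /\ rmem s 4 n.+1 = yt I;
  rd_n1 : nmem s 35 0 = n.+1;
  rd_cands : cands I s;
  rd_types : types_ok m N s;
  rd_codes : codes_ok n V B w s;
  rd_zero : forall x, nmem s 49 x = 0 /\ nmem s 59 x = 0 }.

Lemma anchor_index s a : (forall i, sorted_at I s horiz i) ->
  rmem s 4 n = yb I /\ rmem s 4 n.+1 = yt I -> a \in anchors0 I ->
  exists2 k, k < n + 2 & rmem s 4 k = a.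
Proof.
move=> srt [eb et]; rewrite mem_cat => /orP[/mapP[i _ ->]|].
  by exists (i : nat); [rewrite ltn_addr|have [_ _ _ _ ->] := srt i].
rewrite !inE => /orP[] /eqP ->.
  by exists n => //; rewrite addn2.
by exists n.+1 => //; rewrite addn2.
Qed.

Section Solve.
Variables (V : seq nat) (B : nat) (w : nat -> nat) (bound : labeling R n m -> Prop).
Hypothesis V0 : 0 \in V.
Hypothesis V_down : forall P P' : pred 'I_n, (forall i, P i -> P' i) ->
  \sum_(i < n | P' i) w i \in V -> \sum_(i < n | P i) w i \in V.
Hypothesis boundP : forall L, backbone_labeling I L ->
  bound L <-> \sum_(i < n | opener I (heights L) i) w (rk i) \in V.

Lemma candidate_type s (h : 'I_n -> R) i : input_ok I s ->
  (forall i, sorted_at I s horiz i) -> rmem s 4 n = yb I /\ rmem s 4 n.+1 = yt I ->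
  cands I s -> types_ok m N s ->
  (exists2 a, a \in anchors0 I &
    exists2 k, k < n + n + 1 & h i = (a - n%:R * D + k%:R * D)%R) ->
  exists t, [/\ t < N * m, nmem s 24 t = pc I i & rmem s 7 t = h i].
Proof.
move=> inp srt anc cd ty [a /(anchor_index srt anc)[x xn <-] [k kn ->]].
(* The two outer backbones come first among the candidates, hence the offset 2. *)
pose r := 2 + x * (n + n + 1) + k.
have rN : r < N.
  have : x.+1 * (n + n + 1) <= (n + 2) * (n + n + 1) by rewrite leq_mul2r xn orbT.
  by rewrite /r /ncand mulSn; clear -kn; lia.
exists (r * m + pc I i); split.
- apply: (@leq_trans (r.+1 * m)); first by rewrite mulSn addnC ltn_add2r.
  by rewrite leq_mul2r rN orbT.
- exact: (ty_col ty).
- by rewrite (ty_pos ty) // (cd_pos cd).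
Qed.

Lemma tail_solves s : ready V B w s -> solves I horiz bound (den main_tail s).
Proof.
case=> inp srt anc e35 cd ty co z.
have m0 : 0 < m by apply: leq_ltn_trans (ltn_ord (pc I (Ordinal n_gt0))).
have N1 : 1 < N by rewrite /ncand addn2.
rewrite /main_tail (den_seq (_ ;; _)%prog) (den_seq lim_phase).
have lim := lim_phase_spec inp (ty_n ty).
set s1 := den lim_phase s in lim *.
have ad1 : addr_ok n (N * m) B (den addr_phase s1).
  apply: addr_phase_spec; rewrite /s1 nframe //; first exact: ty_n ty.
  exact: co_B co.
set t := den addr_phase s1 in ad1 *.
have tn b : b \notin nwrites lim_phase -> b \notin nwrites addr_phase ->
    nmem t b = nmem s b by move=> h1 h2; rewrite /t nframe // /s1 nframe.
have tr b : b \notin rwrites lim_phase -> b \notin rwrites addr_phase ->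
    rmem t b = rmem s b by move=> h1 h2; rewrite /t rframe // /s1 rframe.
have col k : k < n -> nmem s 11 k < m.
  by move=> /(rk_onto wfI)[i <-]; have [_ -> _ _ _] := srt i.
have ev : env I N B V w t.
  split => //.
  - by apply: input_ok_den; [exact: input_ok_den|].
  - by rewrite tn // (cd_n cd).
  - by case: ty => a1 a2 a3 a4; split; rewrite ?tn ?tr.
  - by case: co => a1 a2 a3 a4 a5 a6; split; rewrite ?tn.
  - move=> k q qQ; rewrite (tr 7) // (tr 8) // /t nframe //; exact: lim.
  - by rewrite tn.
rewrite (den_seq (_ ;; _)%prog) (den_seq base_phase).
have z49 x : nmem t 49 x = 0 by rewrite tn //; case: (z x).
have dinv := dp_phase_spec (base_phase_spec ev V0 z49).
set u := den dp_phase _ in dinv *.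
have un b : b \notin nwrites base_phase -> b \notin nwrites dp_phase ->
    b \notin nwrites lim_phase -> b \notin nwrites addr_phase -> nmem u b = nmem s b.
  by move=> h1 h2 h3 h4; rewrite /u nframe // nframe // tn.
have ur b : b \notin rwrites base_phase -> b \notin rwrites dp_phase ->
    b \notin rwrites lim_phase -> b \notin rwrites addr_phase -> rmem u b = rmem s b.
  by move=> h1 h2 h3 h4; rewrite /u rframe // rframe // tr.
have tab := dp_table dinv; have evu := di_env dinv.
clearbody u.
have u8 : rmem u 8 = rmem s 8 by rewrite ur.
have u9 : rmem u 9 = rmem s 9 by rewrite ur.
have u7 : rmem u 7 = rmem s 7 by rewrite ur.
have u11 : nmem u 11 = nmem s 11 by rewrite un.
have u24 : nmem u 24 = nmem s 24 by rewrite un.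
have u10 : nmem u 10 = nmem s 10 by rewrite un.
have u59 : nmem u 59 = nmem s 59 by rewrite un.
have si : sorted_input I horiz m (rmem u 8) (rmem u 9) (rmem u 7) (nmem u 11).
  rewrite u8 u9 u7 u11; split.
  - by move=> i; case: (srt i).
  - by move=> i; case: (srt i).
  - by move=> i; case: (srt i).
  - by have := ty_pos ty (ltnW N1) m0; rewrite mul0n add0n => ->; rewrite (cd_bot cd).
  - by have := ty_pos ty N1 m0; rewrite mul1n addn0 => ->; rewrite (cd_top cd).
have all_in := strip_all wfI si.
have Q0 : 0 < N * m by rewrite muln_gt0 m0 ltnW.
have Qm : m < N * m by rewrite -[ltnLHS]mul1n ltn_mul2r m0.
(* Used twice: to show that an unsuccessful search means that no labeling is feasible, and to
   compare the output with an arbitrary feasible labeling. The passage to candidate heights keeps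
   the classes, hence the openers and the code. *)
have complete L : feasible I bound L -> exists2 j, j \in V &
    reached m N B u n 0 m j /\ (optval m N B u n 0 m j <= leader_length I L horiz)%R.
  move=> [BL /(boundP BL) jV].
  have hf := heights_feasible wfI BL.
  have [h' [hf' cl le hc]] := candidate_heights wfI horiz hf.
  have [|f F e] := @typed_complete R n m I wfI horiz (N * m) m (rmem u 8) (rmem u 9)
    (rmem u 7) (nmem u 11) (nmem u 24) si h' hf'.
    move=> i; have [x [h1 h2 h3]] := candidate_type inp srt anc cd ty (hc i).
    by exists x; rewrite u24 u7.
  have eh : h' = typed_heights I (rmem u 7) f by apply: funext.
  have ecode : code n (rmem u 8) (rmem u 7) w n 0 m f =
      \sum_(i < n | opener I (heights L) i) w (rk i).
    rewrite /code (newsum_heights wfI si F) -eh.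
    by apply: eq_bigl => i; rewrite (opener_same I cl).
  rewrite -ecode in jV.
  have [|fj vj] := table_complete _ tab V_down (leqnn n) Q0 Qm F jV.
    by case: wfI.
  exists (code n (rmem u 8) (rmem u 7) w n 0 m f) => //; split => //.
  apply: le_trans vj _; rewrite (cost_heights wfI si F) -eh.
  by rewrite (leader_length_heights wfI BL).
have [e3 bp] := best_phase_spec m0 N1 evu.
rewrite (den_seq best_phase) (den_seq walk_phase).
set v := den best_phase u in e3 bp *.
have n3 : nmem (den output_phase (den walk_phase v)) 3 0 = nmem v 3 0.
  rewrite /output_phase (den_seq (setv 60 _)) (den_seq (PFor _ _ _ _)).
  set p := PFor _ _ _ _.
  rewrite -[LHS]/(nmem (den p (den (setv 60 (NConst 0)) (den walk_phase v))) 3 0).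
  by rewrite nframe // nframe // nframe.
case: bp => [[b53 JV fJ Jmin]|[b53 none]]; last first.
  right; split; last by rewrite /outputs_none n3 e3 b53.
  by case=> L /complete[j jV [fj _]]; move: (none j jV); rewrite fj.
left; set J := nmem v 54 0 in JV fJ Jmin.
have evv : env I N B V w v by exact: env_den.
have st : same_tables I N B V w u v by split; rewrite /v ?nframe ?rframe.
have wk := walk_phase_spec m0 N1 tab all_in st erefl JV fJ.
set f := trace _ _ _ _ _ n 0 m J in wk.
have [|F ecost ecode] := trace_sound _ tab (leqnn n) Q0 Qm JV fJ; first by case: wfI.
rewrite -/f in F ecost ecode.
have evw : env I N B V w (den walk_phase v) by exact: env_den.
have ftype k : k < n -> f k < N * m /\ nmem u 24 (f k) = nmem u 11 k.
  by move=> kn; have [] := fs_type F kn (all_in k kn).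
pose pt (k : nat) : nat := nmem u 10 k.
have ptrk i : pt (rk i) = i by rewrite /pt u10; case: (srt i).
have [] := @output_phase_spec R n m I N B V w (den walk_phase v) f pt evw wk.
- by move=> x; rewrite nframe // nframe // u59; case: (z x).
- by move=> k kn; rewrite nframe // nframe.
- move=> k l /(rk_onto wfI)[i <-] /(rk_onto wfI)[j <-].
  by rewrite !ptrk => /val_inj ->.
- move=> k kn; rewrite !nframe //; by case: (ftype k kn).
move=> o0 o1 o2 o3 o4.
set l := types_seen f n in o1 o2 o3 o4.
have o2' x : x < size l -> nmem (den output_phase (den walk_phase v)) 4 x = nmem u 24 (nth 0 l x).
  by move=> xl; rewrite o2 // !nframe.
have o3' x : x < size l -> rmem (den output_phase (den walk_phase v)) 3 x = rmem u 7 (nth 0 l x).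
  by move=> xl; rewrite o3 // !rframe.
have lP (x : 'I_(size l)) : exists i, f (rk i) = nth 0 l x.
  have /types_seenP[k kn <-] : nth 0 l x \in l by apply: mem_nth.
  by have [i <-] := rk_onto wfI kn; exists i.
have inl i : f (rk i) \in l by apply/types_seenP; exists (rk i) => //; apply: rk_ord.
have idx i : index (f (rk i)) l < size l by rewrite index_mem.
have colt (x : 'I_(size l)) : nmem u 24 (nth 0 l x) < m.
  have [i <-] := lP x; have [_ ->] := ftype _ (rk_ord I i).
  by rewrite (si_c si).
(* The labels are the types in use, numbered as in the output; distinct ones have distinct heights
   by [typed_heights_eq]. *)
pose L := @Labeling R n m (size l) (fun x => Ordinal (colt x))
  (fun x => rmem u 7 (nth 0 l x)) (fun i => Ordinal (idx i)).
have hL : heights L = typed_heights I (rmem u 7) f.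
  by apply: funext => i; rewrite /heights /= nth_index.
have BL : backbone_labeling I L.
  apply: (backbone_labelingP wfI).
  - move=> i; apply: val_inj; rewrite /= nth_index //.
    by have [_ ->] := ftype _ (rk_ord I i); rewrite (si_c si).
  - move=> x; have [i ei] := lP x; exists i; apply: val_inj => /=.
    by rewrite ei index_uniq // types_seen_uniq.
  - move=> x y /= /eqP; have [i ei] := lP x; have [j ej] := lP y; rewrite -ei -ej.
    rewrite -[_ == _]/(typed_heights I (rmem u 7) f i == typed_heights I (rmem u 7) f j).
    rewrite (typed_heights_eq wfI si F) ei ej => e; apply: val_inj; apply/eqP.
    by rewrite -(nth_uniq 0 (ltn_ord x) (ltn_ord y) (types_seen_uniq f n)).
  - by rewrite hL; apply: (typed_feasible wfI si F).
exists L; split; last first.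
  split => //.
  - by rewrite n3 e3 b53.
  - by move=> x; rewrite o2'.
  - by move=> i; rewrite -{1}(ptrk i) o4 // rk_ord.
  - by move=> x; rewrite o3'.
split.
  split => //; apply/(boundP BL); rewrite hL -(newsum_heights wfI si F).
  by rewrite -[newsum _ _ _ _ _ _ _ _]/(code n (rmem u 8) (rmem u 7) w n 0 m f) ecode.
move=> L' /complete[j jV [fj le]]; apply: le_trans le.
rewrite (leader_length_heights wfI BL) hL -(cost_heights wfI si F) ecost.
exact: Jmin.
Qed.

End Solve.
End Tail.

(** * Running time *)

Lemma limits_le n : 0 < n -> [/\ n.+1 <= 2 * n, n.+2 <= 3 * n & n + n + 1 <= 3 * n].
Proof. by split; lia. Qed.

(** The number of candidates is 2n^2 + 5n + 4, which equals 11 for n = 1. *)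
Lemma ncand_le n : 0 < n -> ncand n <= 11 * n ^ 2.
Proof. by rewrite /ncand; nia. Qed.

Section Degrees.
Variables n m S : nat.
Hypotheses (n_gt0 : 0 < n) (m_gt0 : 0 < m) (S_gt0 : 0 < S).

(* The coefficient and the degrees in n, in |C| and in the number of codes. *)
Local Notation monomial := (nat * nat * nat * nat)%type.

Definition mval (x : monomial) : nat :=
  let: (c, a, b, d) := x in c * (n ^ a * m ^ b * S ^ d).

Definition mmul (x y : monomial) : monomial :=
  let: (c, a, b, d) := x in let: (c', a', b', d') := y in
  (c * c', a + a', b + b', d + d').

(** The deepest nest runs over the points, two types, a candidate and two codes, with limits n,
    11n^2|C| twice, 11n^2, and 2S twice: this gives the coefficient and the degrees 7, 2 and 2. *)
Definition coef_max := 11 * 11 * 11 * 2 * 2.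

Definition small (x : monomial) : bool :=
  let: (c, a, b, d) := x in [&& c <= coef_max, a <= 7, b <= 2 & d <= 2].

Definition budget := coef_max * (n ^ 7 * m ^ 2 * S ^ 2).

Definition limit_degree (b i : nat) : monomial :=
  match b, i with
  | 0, 0 => (1, 1, 0, 0)
  | 0, 1 => (1, 0, 1, 0)
  | 15, 0 | 16, 0 => (3, 1, 0, 0)
  | 20, 0 => (11, 2, 0, 0)
  | 25, 0 => (11, 2, 1, 0)
  | 35, 0 => (2, 1, 0, 0)
  | 38, 0 => (2, 0, 0, 1)
  | _, _ => (1, 8, 0, 0)  (* rejected by [small] *)
  end.

(** Boolean, so that the order of the running time of a concrete phase is checked by computation on
    its text. *)
Fixpoint fits_degree (p : prog) (acc : monomial) : bool :=
  match p with
  | PSkip | PN _ _ _ | PR _ _ _ => small acc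
  | PSeq p q => fits_degree p acc && fits_degree q acc
  | PIf _ p q => [&& small acc, fits_degree p acc & fits_degree q acc]
  | PFor _ lb li p =>
      let acc' := mmul acc (limit_degree lb li) in
      [&& small acc, small acc' & fits_degree p acc']
  end.

Lemma small_budget x : small x -> mval x <= budget.
Proof.
case: x => [[[c a] b] d] /and4P[hc ha hb hd] /=.
by rewrite leq_mul // !leq_mul // leq_pexp2l.
Qed.

Lemma mval_mul x y : mval (mmul x y) = mval x * mval y.
Proof.
case: x => [[[c a] b] d]; case: y => [[[c' a'] b'] d'] /=.
by rewrite !expnD; ring.
Qed.

Lemma fits_by_degree lim p acc x :
  (forall l, l \in limits p -> lim l.1 l.2 <= mval (limit_degree l.1 l.2)) ->
  acc <= mval x -> fits_degree p x -> fits lim p acc budget.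
Proof.
elim: p acc x => [|b i e|b i e|p IHp q IHq|b p IHp q IHq|v lb li p IHp] acc x /= hl ha.
- by move/small_budget; apply: leq_trans.
- by move/small_budget; apply: leq_trans.
- by move/small_budget; apply: leq_trans.
- move=> /andP[h1 h2]; split; [apply: (IHp _ x)|apply: (IHq _ x)] => // l hl';
    by apply: hl; rewrite mem_cat hl' ?orbT.
- move=> /and3P[h0 h1 h2]; split.
  + by apply: leq_trans ha _; apply: small_budget.
  + by apply: (IHp _ x) => // l hl'; apply: hl; rewrite mem_cat hl'.
  + by apply: (IHq _ x) => // l hl'; apply: hl; rewrite mem_cat hl' orbT.
- move=> /and3P[h0 h1 h2].
  have hm : acc * lim lb li <= mval (mmul x (limit_degree lb li)).
    by rewrite mval_mul leq_mul //; apply: (hl (lb, li)); rewrite inE eqxx.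
  split.
  + by apply: leq_trans ha _; apply: small_budget.
  + by apply: leq_trans hm _; apply: small_budget.
  + by apply: IHp hm h2 => l hl'; apply: hl; rewrite inE hl' orbT.
Qed.

Lemma mval_limits :
  [/\ mval (limit_degree 0 0) = n, mval (limit_degree 0 1) = m,
      mval (limit_degree 15 0) = 3 * n /\ mval (limit_degree 16 0) = 3 * n,
      mval (limit_degree 20 0) = 11 * n ^ 2 /\
      mval (limit_degree 25 0) = 11 * n ^ 2 * m
    & mval (limit_degree 35 0) = 2 * n /\ mval (limit_degree 38 0) = 2 * S].
Proof. by rewrite /= !expn0 !expn1 !muln1 !mul1n mulnA. Qed.

Lemma run_phase (R : realType) p (s : state R) (ls : seq (nat * nat)) :
  static p -> all (mem ls) (limits p) -> fits_degree p (1, 0, 0, 0) ->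
  (forall l, l \in ls -> nmem s l.1 l.2 <= mval (limit_degree l.1 l.2)) ->
  exists2 t, exec (compile p) s t (den p s) & t <= cst p * budget.
Proof.
move=> st /allP sub fit hl.
have [t ex bd] := @static_exec R (nmem s) p s st (fun l _ => leqnn _).
exists t => //; apply: leq_trans bd _.
rewrite -[bnd _ _]mul1n; apply: bnd_cst; apply: fits_by_degree fit => //.
by move=> l /sub; apply: hl.
Qed.

End Degrees.

Definition runs (R : realType) X p (s : state R) : Prop :=
  exists2 t, exec (compile p) s t (den p s) & t <= cst p * X.

Lemma runs_seq (R : realType) X p q (s : state R) :
  runs X p s -> runs X q (den p s) -> runs X (p ;; q)%prog s.
Proof.
move=> [t1 e1 b1] [t2 e2 b2]; exists (t1 + t2); first exact: exec_seq e1 e2.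
by rewrite [cst _]/= mulnDl leq_add.
Qed.

Definition program (horiz : bool) (counts codes : prog) : prog :=
  (sort_phase horiz ;; cand_phase ;; type_phase ;; counts ;; codes ;; main_tail)%prog.

(** * Assembling the phases *)

Section Run.
Variables (R : realType) (n m : nat) (I : instance R n m) (horiz : bool).
Variables (S : nat) (counts codes : prog) (s : state R).
Hypotheses (n_gt0 : 0 < n) (wfI : wf_instance I) (S_gt0 : 0 < S).
Hypothesis inp : input_ok I s.

Definition prelude_state : state R :=
  den type_phase (den cand_phase (den (sort_phase horiz) s)).

Let m_gt0 : 0 < m. Proof. exact: leq_ltn_trans (ltn_ord (pc I (Ordinal n_gt0))). Qed.

Lemma prelude_spec : [/\ input_ok I prelude_state,
   forall i, sorted_at I prelude_state horiz i,
   rmem prelude_state 4 n = yb I /\ rmem prelude_state 4 n.+1 = yt I,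
   nmem prelude_state 35 0 = n.+1 &
   [/\ cands I prelude_state, types_ok m (ncand n) prelude_state &
    forall b, b \notin nwrites (sort_phase horiz ;; cand_phase ;; type_phase)%prog ->
      nmem prelude_state b = nmem s b]].
Proof.
have [h1 h2 [h3 h4 h5]] := sort_phase_spec horiz wfI inp.
rewrite /prelude_state; set s1 := den (sort_phase horiz) s in h1 h2 h3 h4 h5 *.
have inp1 : input_ok I s1 by exact: input_ok_den.
have n1 b : b \notin nwrites (sort_phase horiz) -> nmem s1 b = nmem s b by exact: nframe.
clearbody s1.
have cd := cand_phase_spec inp1 h4 h5.
set s2 := den cand_phase s1 in cd *.
have inp2 : input_ok I s2 by exact: input_ok_den.
have n2 b : b \notin nwrites cand_phase -> nmem s2 b = nmem s1 b by exact: nframe.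
have r2 b : b \notin rwrites cand_phase -> rmem s2 b = rmem s1 b by exact: rframe.
clearbody s2.
have ty := type_phase_spec inp2 (cd_n cd).
split.
- exact: input_ok_den.
- move=> i; have [a1 a2 a3 a4 a5] := h1 i.
  by split; [rewrite nframe // n2|rewrite nframe // n2|rewrite rframe // r2|
    rewrite rframe // r2|rewrite rframe // r2].
- by rewrite rframe // r2.
- by rewrite nframe // n2.
split => //.
  by case: cd => c1 c2 c3 c4; split; [rewrite nframe|rewrite rframe|rewrite rframe|
    move=> *; rewrite !rframe //; apply: c4].
move=> b hb.
have [w1 w2 w3] : [/\ b \notin nwrites (sort_phase horiz), b \notin nwrites cand_phase &
    b \notin nwrites type_phase].
  have sub : nwrites (sort_phase horiz ;; cand_phase ;; type_phase)%prog =
    nwrites (sort_phase horiz) ++ (nwrites cand_phase ++ nwrites type_phase) by [].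
  rewrite sub in hb; split; apply: contra hb => h; rewrite mem_cat; apply/orP.
  - by left.
  - by right; rewrite mem_cat; apply/orP; left.
  - by right; rewrite mem_cat; apply/orP; right.
by rewrite nframe // n2 // n1.
Qed.

Variables (V : seq nat) (B : nat) (w : nat -> nat) (bound : labeling R n m -> Prop).
Local Notation s4 := (den counts prelude_state).
Local Notation s5 := (den codes s4).
Hypothesis V0 : 0 \in V.
Hypothesis V_size : size V <= 2 * S.
Hypothesis V_down : forall P P' : pred 'I_n, (forall i, P i -> P' i) ->
  \sum_(i < n | P' i) w i \in V -> \sum_(i < n | P i) w i \in V.
Hypothesis boundP : forall L, backbone_labeling I L ->
  bound L <-> \sum_(i < n | opener I (heights L) i) w (rk I i) \in V.
Hypothesis codesP : codes_ok n V B w s5.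
Hypothesis zero : forall x, nmem s 49 x = 0 /\ nmem s 59 x = 0.

(** Results of the preparatory phases, and the banks 49 and 59 whose initial zeros matter, which the
    computation of the codes must not touch. *)
Definition kept_n := [:: 0; 1; 10; 11; 20; 21; 24; 25; 35; 49; 59].
Definition kept_r := [:: 0; 1; 2; 4; 5; 7; 8; 9].

Hypotheses (counts_static : static counts) (codes_static : static codes).
Hypothesis counts_limits : all (mem [:: (0, 0); (0, 1)]) (limits counts).
Hypothesis codes_limits : all (mem [:: (0, 0); (0, 1); (38, 0)]) (limits codes).
Hypothesis counts_fits : fits_degree counts (1, 0, 0, 0).
Hypothesis codes_fits : fits_degree codes (1, 0, 0, 0).
Hypothesis kept : all [pred b | b \notin nwrites counts ++ nwrites codes] kept_n &&
  all [pred b | b \notin rwrites counts ++ rwrites codes] kept_r.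
Hypothesis kept38 : 38 \notin nwrites codes.

Let keptn b : b \in kept_n -> nmem s5 b = nmem prelude_state b /\
  nmem s4 b = nmem prelude_state b.
Proof.
move=> hb; have [/allP an _] := andP kept.
have : b \notin nwrites counts ++ nwrites codes := an b hb.
by rewrite mem_cat negb_or => /andP[h1 h2]; rewrite !(nframe _ h1, nframe _ h2).
Qed.

Let keptr b : b \in kept_r -> rmem s5 b = rmem prelude_state b.
Proof.
move=> hb; have [_ /allP ar] := andP kept.
have : b \notin rwrites counts ++ rwrites codes := ar b hb.
by rewrite mem_cat negb_or => /andP[h1 h2]; rewrite !(rframe _ h1, rframe _ h2).
Qed.

Lemma run_ready : ready I horiz V B w s5.
Proof.
have [h1 h2 h3 h4 [h5 h6 h7]] := prelude_spec.
have kn b : b \in kept_n -> nmem s5 b = nmem prelude_state b by move=> /keptn[].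
have kr b : b \in kept_r -> rmem s5 b = rmem prelude_state b by exact: keptr.
have [z49 z59] : nmem prelude_state 49 = nmem s 49 /\ nmem prelude_state 59 = nmem s 59.
  by split; apply: h7; case: (horiz).
move: h1 h2 h3 h4 h5 h6 z49 z59 kn kr codesP.
move: prelude_state s5 => s3 s6 h1 h2 h3 h4 h5 h6 z49 z59 kn kr co.
split => //.
- apply: input_ok_agree h1 _ _ => b; rewrite !inE.
    by move=> /orP[] /eqP ->; apply: kn.
  by move=> /or3P[] /eqP ->; apply: kr.
- move=> i; have [a1 a2 a3 a4 a5] := h2 i.
  by split; [rewrite kn|rewrite kn|rewrite kr|rewrite kr|rewrite kr].
- by rewrite kr.
- by rewrite kn.
- by case: h5 => c1 c2 c3 c4; split; [rewrite kn|rewrite kr|rewrite kr|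
    move=> *; rewrite !kr //; apply: c4].
- by case: h6 => c1 c2 c3 c4; split; [rewrite kn|move=> *; rewrite kn // c2|
    move=> *; rewrite !kr // c3|move=> *; rewrite kn // c4].
- by move=> x; rewrite !kn // z49 z59.
Qed.

Lemma run_program : exists t s', [/\ exec (compile (program horiz counts codes)) s t s',
  t <= cst (program horiz counts codes) * budget n m S & solves I horiz bound s'].
Proof.
have [h1 h2 h3 h4 [h5 h6 h7]] := prelude_spec.
have rd := run_ready.
have sol := tail_solves wfI n_gt0 V0 V_down boundP rd.
have N11 := ncand_le n_gt0.
have [mn mm [m15 m16] [m20 m25] [m35 m38]] := mval_limits n m S.
have [l1 l2 l3] := limits_le n_gt0.
have [h15 h16] : nmem (den (sort_phase horiz) s) 15 0 = n.+2 /\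
    nmem (den (sort_phase horiz) s) 16 0 = n + n + 1.
  by have [_ _ [_ -> ->]] := sort_phase_spec horiz wfI inp.
have run1 := @run_phase n m S n_gt0 m_gt0 S_gt0 R.
have inpA : input_ok I (den (sort_phase horiz) s) by exact: input_ok_den.
have inpB : input_ok I (den cand_phase (den (sort_phase horiz) s)) by exact: input_ok_den.
have e20 : nmem (den cand_phase (den (sort_phase horiz) s)) 20 0 = ncand n.
  by have := cd_n h5; rewrite /prelude_state nframe.
have e38 : nmem s4 38 0 = size V by rewrite -(co_size codesP) (nframe _ kept38).
have e0 : nmem s4 0 = nmem prelude_state 0 by case: (keptn (isT : 0 \in kept_n)).
have e00 : nmem s4 0 0 = n by rewrite e0 (in_n h1).
have e01 : nmem s4 0 1 = m by rewrite e0 (in_m h1).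
have [t ex bd] : runs (budget n m S) (program horiz counts codes) s.
  (* The phases are static but their sequence is not; the limits of each phase are evaluated in the
     state in which it starts. *)
  apply: runs_seq.
    apply: (run1 _ _ [:: (0, 0)]); [exact: static_sort|by case: (horiz)|by case: (horiz)|].
    by move=> l; rewrite inE => /eqP ->; rewrite mn [nmem _ _ _](in_n inp).
  apply: runs_seq.
    apply: (run1 _ _ [:: (0, 0); (15, 0); (16, 0)]) => //.
    move=> l; rewrite !inE => /or3P[] /eqP ->.
    - by rewrite mn [nmem _ _ _](in_n inpA).
    - by rewrite m15 [nmem _ _ _]h15.
    - by rewrite m16 [nmem _ _ _]h16.
  apply: runs_seq.
    apply: (run1 _ _ [:: (0, 1); (20, 0)]) => //.
    move=> l; rewrite !inE => /orP[] /eqP ->.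
    - by rewrite mm [nmem _ _ _](in_m inpB).
    - by rewrite m20 [nmem _ _ _]e20.
  apply: runs_seq.
    apply: (run1 _ _ [:: (0, 0); (0, 1)]) => //.
    move=> l; rewrite !inE => /orP[] /eqP ->.
    - by rewrite mn [nmem _ _ _](in_n h1).
    - by rewrite mm [nmem _ _ _](in_m h1).
  apply: runs_seq.
    apply: (run1 _ _ [:: (0, 0); (0, 1); (38, 0)]) => //.
    move=> l; rewrite !inE => /or3P[] /eqP ->.
    - by rewrite mn [nmem _ _ _]e00.
    - by rewrite mm [nmem _ _ _]e01.
    - by rewrite m38 [nmem _ _ _]e38.
  apply: (run1 _ _ [:: (0, 0); (20, 0); (25, 0); (35, 0); (38, 0)]) => //.
  move=> l; rewrite !inE => /orP[|/orP[|/orP[|/orP[]]]] /eqP ->.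
  - by rewrite mn [nmem _ _ _](in_n (rd_in rd)).
  - by rewrite m20 [nmem _ _ _](cd_n (rd_cands rd)).
  - by rewrite m25 [nmem _ _ _](ty_n (rd_types rd)) leq_mul2r N11 orbT.
  - by rewrite m35 [nmem _ _ _](rd_n1 rd).
  - by rewrite m38 [nmem _ _ _](co_size codesP).
by exists t, (den (program horiz counts codes) s).
Qed.

End Run.

(** * The theorem for the global bound and for the color vector *)

Section Inputs.
Variables (R : realType) (n m : nat) (I : instance R n m).

Lemma input_state_ok K k : input_ok I (input_state I K k).
Proof. by split => //= i; rewrite /table valK. Qed.

End Inputs.

Theorem theorem4 (R : realType) (horiz : bool) :
  (exists (p : cmd) (a : nat),
     forall (n m : nat) (I : instance R n m) (K : nat),
       (0 < n)%N -> wf_instance I -> (m <= K)%N ->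
       exists (t : nat) (s : state R),
         [/\ exec p (input_global I K) t s,
             (t <= a * (n ^ 7 * m ^ 2 * K ^ 2))%N
           & solves I horiz (global_bound K) s])
  /\
  (exists (p : cmd) (a : nat),
     forall (n m : nat) (I : instance R n m) (k : 'I_m -> nat),
       (0 < n)%N -> wf_instance I -> (forall c, (0 < k c)%N) ->
       exists (t : nat) (s : state R),
         [/\ exec p (input_vector I k) t s,
             (t <= a * (n ^ 7 * m ^ 2 * (\prod_(c < m) k c) ^ 2))%N
           & solves I horiz (color_bound k) s]).
Proof.
split.
  exists (compile (program horiz global_counts global_codes)).
  exists (cst (program horiz global_counts global_codes) * coef_max).
  move=> n m I K n0 wfI mK.
  have m0 : 0 < m by apply: leq_ltn_trans (ltn_ord (pc I (Ordinal n0))).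
  have K0 : 0 < K by apply: leq_trans mK.
  set s := input_global I K.
  have inp : input_ok I s by exact: input_state_ok.
  have [inpP _ _ _ [_ _ keep]] := prelude_spec horiz wfI inp.
  have k0 : nmem (prelude_state horiz s) 0 2 = K by rewrite keep //; case: (horiz).
  have k37 j : nmem (prelude_state horiz s) 37 j = 0 by rewrite keep //; case: (horiz).
  have co := global_codes_spec inpP k0 k37.
  have V0 : 0 \in iota 0 K.+1 by rewrite mem_iota.
  (* There are K + 1 codes, from 0 to K; as K is positive, this is at most 2K. *)
  have Vs : size (iota 0 K.+1) <= 2 * K by rewrite size_iota; clear -K0; lia.
  have Vd (P P' : pred 'I_n) : (forall i, P i -> P' i) ->
      \sum_(i < n | P' i) 1 \in iota 0 K.+1 -> \sum_(i < n | P i) 1 \in iota 0 K.+1.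
    move=> sub; rewrite !mem_iota !add0n /= !ltnS !sum1_card; apply: leq_trans.
    by apply: subset_leq_card; apply/fintype.subsetP => i; apply: sub.
  have bP (L : labeling R n m) : backbone_labeling I L -> global_bound K L <->
      \sum_(i < n | opener I (heights L) i) 1 \in iota 0 K.+1.
    exact: (global_boundP wfI).
  have z x : nmem s 49 x = 0 /\ nmem s 59 x = 0 by [].
  have [t [s' [h1 h2 h3]]] := run_program n0 wfI K0 inp V0 Vs Vd bP co z
    static_gcounts static_gcodes isT isT isT isT isT isT.
  by exists t, s'; split => //; rewrite -mulnA.
exists (compile (program horiz vector_counts vector_codes)).
exists (cst (program horiz vector_counts vector_codes) * coef_max).
move=> n m I k n0 wfI k_gt0.
have m0 : 0 < m by apply: leq_ltn_trans (ltn_ord (pc I (Ordinal n0))).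
have S0 : 0 < \prod_(c < m) k c by apply: prodn_gt0.
set s := input_vector I k.
have inp : input_ok I s by exact: input_state_ok.
have [inpP srt _ _ [_ _ keep]] := prelude_spec horiz wfI inp.
have k2 c : nmem (prelude_state horiz s) 2 c = table 0 k c by rewrite keep //; case: (horiz).
have k37 j : nmem (prelude_state horiz s) 37 j = 0 by rewrite keep //; case: (horiz).
pose C := nmem (prelude_state horiz s) 11.
have C_rk i : C (rk I i) = pc I i by case: (srt i).
have C_lt x : x < n -> C x < m by move=> /(rk_onto wfI)[i <-]; rewrite C_rk.
have cap_gt0 c : c < m -> 0 < cap n (table 0 k) c.
  by move=> cm; rewrite /cap leq_min n0 andbT; apply: kv_gt0.
have counts := vector_counts_spec inpP (fun=> erefl) C_lt k2.
have inpC : input_ok I (den vector_counts (prelude_state horiz s)) by exact: input_ok_den.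
have c37 j : nmem (den vector_counts (prelude_state horiz s)) 37 j = 0.
  by rewrite nframe.
have co := vector_codes_spec cap_gt0 inpC counts c37.
have cv := code_vecs (table 0 k) C_lt _ n0.
have V0 : 0 \in vecs n (table 0 k) m.
  apply/vecsP; exists (fun=> 0) => //.
  by rewrite big1.
(* One label per color is left out of the code, so the digit of a color takes at most k_c values and
   not k_c + 1. *)
have Vs : size (vecs n (table 0 k) m) <= 2 * \prod_(c < m) k c.
  rewrite size_vecs mul2n -addnn; apply: leq_trans (leq_addr _ _).
  by apply: leq_prod => c _; rewrite /cap table_ord geq_minl.
have Vd (P P' : pred 'I_n) : (forall i, P i -> P' i) ->
    \sum_(i < n | P' i) first_weight n C i \in vecs n (table 0 k) m ->
    \sum_(i < n | P i) first_weight n C i \in vecs n (table 0 k) m.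
  move=> sub /cv h; apply/cv => c cm; apply: leq_ltn_trans (h c cm).
  exact: extras_sub.
have bP (L : labeling R n m) : backbone_labeling I L -> color_bound k L <->
    \sum_(i < n | opener I (heights L) i) first_weight n C (rk I i)
      \in vecs n (table 0 k) m.
  exact: color_boundP.
have z x : nmem s 49 x = 0 /\ nmem s 59 x = 0 by [].
have [t [s' [h1 h2 h3]]] := run_program n0 wfI S0 inp V0 Vs Vd bP co z
  static_vcounts static_vcodes isT isT isT isT isT isT.
by exists t, s'; split => //; rewrite -mulnA.
Qed.
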